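(* Suppose that $X_1,\dots,X_n$ are independent zero-mean real-valued random variables and $U_1,\dots,U_n$ are independent random variables uniformly distributed on $[0,1]$, which are also independent of $X_1,\dots,X_n$. For each $i=1,\dots,n$ let $Y_i:=|X_i\,\mathsf{r}_i(X_i,(U_i)_{X_i})|$, where $\mathsf{r}_i$ is the reciprocating function of $X_i$ and $(U_i)_{X_i}$ is the randomization variable built from $X_i$ and $U_i$ (see context). For $\lambda>0$ let $$S_{Y,\lambda}:=\frac{X_1+\dots+X_n}{(Y_1^\lambda+\dots+Y_n^\lambda)^{\frac1{2\lambda}}},$$ where the rule $\frac00:=0$ is used if the denominator is zero. Suppose that for some $p\in(0,1)$ and all $i\in\{1,\dots,n\}$ $$\frac{X_i}{|\mathsf{r}_i(X_i,(U_i)_{X_i})|}\,\mathbf{I}\{X_i>0\}\le\frac{1-p}{p}\quad\text{a.s.}$$ Then for all $$\lambda\ge\lambda_*(p):=\begin{cases}\dfrac{1+p+2p^2}{2\bigl(\sqrt{p-p^2}+2p^2\bigr)} & \text{if } 0<p\le\frac12,\\[2mm] 1 & \text{if }\frac12\le p<1,\end{cases}$$ one has $$\mathsf{E}f(S_{Y,\lambda})\le\mathsf{E}f(T_n)\quad\forall f\in\mathcal{H}_+^3$$ and $$\mathsf{P}(S_{Y,\lambda}\ge x)\le c_{3,0}\,\mathsf{P}^{\mathsf{LC}}(T_n\ge x)\quad\forall x\in\mathbb{R},$$ where $T_n:=(Z_1+\dots+Z_n)/n^{1/(2\lambda)}$; $Z_1,\dots,Z_n$ are independent random variables each having the standardized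 Bernoulli distribution with parameter $p$; the function $x\mapsto\mathsf{P}^{\mathsf{LC}}(T_n\ge x)$ is the least log-concave majorant of the function $x\mapsto\mathsf{P}(T_n\ge x)$ on $\mathbb{R}$; and $c_{3,0}=2e^3/9=4.4634\ldots$. Moreover, the lower bound $\lambda_*(p)$ on $\lambda$ is the best possible one for each $p$: for each $p\in(0,1)$, there is no $\lambda_0\in(0,\lambda_*(p))$ such that the two conclusions $\mathsf{E}f(S_{Y,\lambda})\le\mathsf{E}f(T_n)$ $\forall f\in\mathcal{H}_+^3$ and $\mathsf{P}(S_{Y,\lambda}\ge x)\le c_{3,0}\,\mathsf{P}^{\mathsf{LC}}(T_n\ge x)$ $\forall x\in\mathbb{R}$ hold for all $\lambda\ge\lambda_0$, all $n$, and all $X_1,\dots,X_n,U_1,\dots,U_n$ such that $X_1,\dots,X_n$ are independent zero-mean real-valued random variables, $U_1,\dots,U_n$ are independent random variables uniformly distributed on $[0,1]$ which are also independent of $X_1,\dots,X_n$, and $\frac{X_i}{|\mathsf{r}_i(X_i,(U_i)_{X_i})|}\,\mathbf{I}\{X_i>0\}\le\frac{1-p}{p}$ a.s. for all $i\in\{1,\dots,n\}$ with this $p$.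
   Context: For a natural number $\alpha$, $\mathcal{H}_+^\alpha$ denotes the class of all functions $f\colon\mathbb{R}\to\mathbb{R}$ such that $f$ has finite derivatives $f^{(0)}:=f,f^{(1)}:=f',\dots,f^{(\alpha-1)}$ on $\mathbb{R}$, $f^{(\alpha-1)}$ is convex on $\mathbb{R}$, and $\lim_{x\to-\infty}f^{(j)}(x)=0$ for $j=0,1,\dots,\alpha-1$. The standardized Bernoulli distribution with parameter $p$ is the distribution of $(B-p)/\sqrt{p(1-p)}$, where $\mathsf{P}(B=1)=p=1-\mathsf{P}(B=0)$. For a zero-mean real-valued random variable $X$ define $$G(x):=\begin{cases}\mathsf{E}X\,\mathbf{I}\{X\in(0,x]\} & \text{if } x\in[0,\infty],\\ \mathsf{E}(-X)\,\mathbf{I}\{X\in[x,0)\} & \text{if } x\in[-\infty,0],\end{cases}$$ ($\mathbf{I}\{\cdot\}$ is the indicator) and $m:=G(\infty)=G(-\infty)=\frac12\mathsf{E}|X|<\infty$. For $h\in[0,m]$ let $$x_+(h):=\inf\{x\in[0,\infty]\colon G(x)\ge h\},\qquad x_-(h):=\sup\{x\in[-\infty,0]\colon G(x)\ge h\}.$$ For $x\in\mathbb{R}$ and $u\in[0,1]$ let $$H(x,u):=\begin{cases}G(x-)+u\,(G(x)-G(x-)) & \text{if } x\in[0,\infty),\\ G(x+)+u\,(G(x)-G(x+)) & \text{if } x\in(-\infty,0],\end{cases}$$ where $G(x\mp)$ are one-sided limits ($G$ is continuous at $0$ with $G(0)=0$, so the two lines agree at $x=0$). The reciprocating function of (the distribution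 of) $X$ is $$\mathsf{r}(x,u):=\begin{cases}x_-(H(x,u)) & \text{if } x\in[0,\infty),\\ x_+(H(x,u)) & \text{if } x\in(-\infty,0].\end{cases}$$ If $U$ is uniformly distributed on $[0,1]$ and independent of $X$, then for real $x$ put $U_x:=U$ if $\mathsf{P}(X=x)\neq0$ and $U_x:=1$ if $\mathsf{P}(X=x)=0$, and $U_X(\omega):=U_{X(\omega)}(\omega)$. The objects $\mathsf{r}_i$ and $(U_i)_{X_i}$ are $\mathsf{r}$ and $U_X$ constructed from $X_i$ and $U_i$ in place of $X$ and $U$. *)

(* Defs.v *)
From HB Require Import structures.
From mathcomp Require Import all_boot all_order all_algebra.
From mathcomp Require Import all_classical all_reals all_analysis.

Set Implicit Arguments.
Unset Strict Implicit.
Unset Printing Implicit Defensive.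

Import Order.TTheory GRing.Theory Num.Theory.
Import numFieldNormedType.Exports.

Local Open Scope classical_set_scope.
Local Open Scope ring_scope.

(* alpha ranges over the positive integers; Hplus 0 is junk. *)
Definition Hplus (R : realType) (alpha : nat) (f : R -> R) : Prop :=
  [/\ forall (j : nat) (x : R), (j < alpha.-1)%N ->
        derivable (derive1n j f) x 1,
      convex_function ([set: R] : set (convex_lmodType R^o))
        (derive1n alpha.-1 f) &
      forall j : nat, (j < alpha)%N ->
        derive1n j f x @[x --> -oo] --> (0 : R)].

Section reciprocating_function.
Local Open Scope ereal_scope.
Context d (T : measurableType d) (R : realType) (P : probability T R).
Implicit Types (X U : {RV P >-> R}) (x u : R) (h : \bar R).

(* G of X: truncated first moments; its argument ranges over [-oo, +oo]. *)
Definition recG X (y : \bar R) : \bar R :=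
  if 0 <= y then
    'E_P[fun w => (X w * ((0 < X w)%R && ((X w)%:E <= y)%E)%:R)%R]
  else
    'E_P[fun w => (- X w * ((y <= (X w)%:E)%E && (X w < 0)%R)%:R)%R].

Definition xplus X h : \bar R := ereal_inf [set y | 0 <= y /\ h <= recG X y].

Definition xminus X h : \bar R := ereal_sup [set y | y <= 0 /\ h <= recG X y].

(* G is continuous at 0 with G 0 = 0, so both branches agree at x = 0 although
   Gminus then uses the values of G at negative points. *)
Definition recH X x u : \bar R :=
  let G := recG X in
  let Gminus := lim (G y%:E @[y --> x^'-]) in
  let Gplus := lim (G y%:E @[y --> x^'+]) in
  if (0 <= x)%R then Gminus + u%:E * (G x%:E - Gminus)
  else Gplus + u%:E * (G x%:E - Gplus).

(* The reciprocating function r of the distribution of X, and then the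
   randomization variable U_X. *)
Definition recip X x u : \bar R :=
  if (0 <= x)%R then xminus X (recH X x u) else xplus X (recH X x u).

Definition randomize X U (w : T) : R :=
  if P (X @^-1` [set X w]) != 0 then U w else 1%R.

Definition recipX X U (w : T) : \bar R := recip X (X w) (randomize X U w).

(* In \bar R, a / 0 = +oo for a > 0, and 0 * +oo = 0. *)
Definition asym_ratio X U (w : T) : \bar R :=
  (X w)%:E / `|recipX X U w| * ((0 < X w)%R%:R)%:E.

(* The value +oo is possible, but only on a null set. *)
Definition Yprod X U (w : T) : \bar R := `|(X w)%:E * recipX X U w|.

(* The rule 0 / 0 := 0; a denominator +oo yields 0, on a null set only. *)
Definition self_norm_sum n (X U : 'I_n -> {RV P >-> R}) (lambda : R) (w : T) : R :=
  let D := poweR (\sum_(i < n) poweR (Yprod (X i) (U i) w) lambda)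
                 (2 * lambda)^-1%R in
  if D == 0 then 0%R else fine ((\sum_(i < n) X i w)%R%:E / D).

End reciprocating_function.

Section laws_and_independence.
Local Open Scope ereal_scope.
Context d (T : measurableType d) (R : realType) (P : probability T R).

Definition has_law (Z : {RV P >-> R}) (mu : set R -> \bar R) : Prop :=
  forall A : set R, measurable A -> distribution P Z A = mu A.

Definition zero_mean (X : {RV P >-> R}) : Prop :=
  P.-integrable [set: T] (EFin \o X) /\ 'E_P[X] = 0.

Definition mutually_independent n (X : 'I_n -> {RV P >-> R}) : Prop :=
  forall (J : {set 'I_n}) (A : 'I_n -> set R), (forall i, measurable (A i)) ->
    P (\bigcap_(i in [set` J]) (X i @^-1` A i)) =
    \prod_(i in J) P (X i @^-1` A i).

Definition sigma_of n (X : 'I_n -> {RV P >-> R}) : set (set T) :=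
  <<s \bigcup_i preimage_set_system [set: T] (X i) measurable >>.

Definition independent_families n (X U : 'I_n -> {RV P >-> R}) : Prop :=
  forall A B, sigma_of X A -> sigma_of U B -> P (A `&` B) = P A * P B.

Definition std_bernoulli_law (p : R) (A : set R) : \bar R :=
  bernoulli_prob p
    ((fun b : bool => ((b%:R - p) / Num.sqrt (p * (1 - p)))%R) @^-1` A).

Definition normalized_sum n (Z : 'I_n -> {RV P >-> R}) (lambda : R) (w : T) : R :=
  ((\sum_(i < n) Z i w) / n%:R `^ (2 * lambda)^-1)%R.

Definition tail (S : T -> R) (x : R) : \bar R := P [set w | (x <= S w)%R].

End laws_and_independence.

Section log_concave.
Context (R : realType).
Implicit Types q g : R -> R.

Definition log_concave g : Prop :=
  (forall x, 0 <= g x) /\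
  (forall x y t, 0 < t < 1 ->
     g x `^ t * g y `^ (1 - t) <= g (t * x + (1 - t) * y)).

Definition log_concave_majorants q : set (R -> R) :=
  [set g | log_concave g /\ (forall x, q x <= g x)].

Definition lc_majorant q (x : R) : R :=
  inf [set g x | g in log_concave_majorants q].

Lemma lc_majorant_least q M : (forall x, q x <= M) ->
  log_concave_majorants q (lc_majorant q) /\
  (forall g, log_concave_majorants q g -> forall x, lc_majorant q x <= g x).
Proof.
move=> qM.
have least g : log_concave_majorants q g -> forall x, lc_majorant q x <= g x.
  move=> qg x; apply: ge_inf; last by exists g.
  by exists 0 => _ [h [[h0 _] _] <-].
pose c := Num.max M 0.
have c0 : 0 <= c by rewrite le_max lexx orbT.
have qc : log_concave_majorants q (fun=> c).
  split; last by move=> x; rewrite (le_trans (qM x))// le_max lexx.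
  split=> // x y t _; rewrite -powRD ?subrKC ?powRr1//.
  by rewrite oner_eq0.
have ne x : [set g x | g in log_concave_majorants q] !=set0.
  by exists c, (fun=> c).
have lc0 x : 0 <= lc_majorant q x.
  by apply: lb_le_inf => // _ [h [[h0 _] _] <-].
split=> //; split; last first.
  by move=> x; apply: lb_le_inf => // _ [h [_ qh] <-].
split=> // x y t /andP[t0 t1]; apply: lb_le_inf => // _ [h qh <-].
have [[h0 hlc] _] := qh.
apply: le_trans (hlc x y t _); last by rewrite t0.
by apply: ler_pM; rewrite ?powR_ge0// ge0_ler_powR ?nnegrE ?least// ltW//
  subr_gt0.
Qed.

End log_concave.

Definition lambda_star (R : realType) (p : R) : R :=
  if p <= 2^-1 then
    (1 + p + 2 * p ^+ 2) / (2 * (Num.sqrt (p - p ^+ 2) + 2 * p ^+ 2))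
  else 1.

Definition c30 (R : realType) : R := 2 * expR 1 ^+ 3 / 9.

Definition admissible d (T : measurableType d) (R : realType)
    (P : probability T R) (p : R) n (X U : 'I_n -> {RV P >-> R}) : Prop :=
  [/\ mutually_independent X /\ (forall i, zero_mean (X i)),
      mutually_independent U /\
        (forall i, has_law (U i) (uniform_prob (@ltr01 R))),
      independent_families X U &
      forall i, {ae P, forall w,
        (asym_ratio (X i) (U i) w <= ((1 - p) / p)%:E)%E}].

Definition std_bernoulli_sample d (T : measurableType d) (R : realType)
    (P : probability T R) (p : R) n (Z : 'I_n -> {RV P >-> R}) : Prop :=
  mutually_independent Z /\ (forall i, has_law (Z i) (std_bernoulli_law p)).

Definition dominated d (T : measurableType d) d' (T' : measurableType d')
    (R : realType) (P : probability T R) (P' : probability T' R)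
    (S : T -> R) (V : T' -> R) : Prop :=
  (forall f, Hplus 3 f -> ('E_P[f \o S] <= 'E_P'[f \o V])%E) /\
  (forall x, (tail P S x <=
     (c30 R * lc_majorant (fun y => fine (tail P' V y)) x)%:E)%E).

(* Main.v *)
From HB Require Import structures.
Require Import Defs.
From mathcomp Require Import all_boot all_order all_algebra.
From mathcomp Require Import all_classical all_reals all_analysis.
From mathcomp Require Import measurable_realfun.
From mathcomp Require Import ring lra.

(** The first half compares each X_i with a scaled Bernoulli variable. Let R be the
reciprocating value of X. Almost surely one of X, R is a number b > 0 and the
other one is - a < 0, unless X = 0, and given these two numbers X = b and
X = - a have the odds a : b. This is the swap identity, which holds because the
positive and the negative part of X are quantiles of one level that is uniform
on [0, m]. Hence, given the two numbers, the variable X is a centred two-point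
variable with variance a b, and the hypothesis on the ratio b / a
makes the scaled Bernoulli variable sqrt(a b) Z the more skewed of the two.
For f with a convex derivative, a quadratic interpolation of f then gives
E f (X) <= E f (sqrt(a b) Z): that is two_point, integrated in
partner_inequality. Since a b = Y is the weight that enters the denominator,
one can replace the X_i one after the other while all the weights stay as they
are; independence of the pairs (X_i, U_i) is used through Tonelli at each step
(hybrid).

What remains is deterministic. With weights normalized to have sum of
Y_i^lambda equal to 1, the scales of the Bernoulli variables are
s_i^(1/(2 lambda)) with s_i >= 0 of sum 1, and one needs the expectation of
f (sum s_i^(1/(2 lambda)) Z_i) to be largest at equal s_i (equalize). It is
enough to bring two coordinates closer while their sum is fixed (spread_mono).
The derivative along such a move compares two increments of f'; the
chord of the convex function f'' between the two inner points reduces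
the comparison to f'(x) = (x - tau)_+^2 (gap_ineq), that is, to a polynomial
inequality with the factor r^(2 lambda - 1), r being the ratio of the scales.
For p < 1/2 the least admissible factor is computed in closed form, and
2 lambda_star p - 1 is the smallest exponent for which the power of r stays
below it (key_power).

The tail bound follows from the moment bound for f = (x - t)_+^3. If g is a
log-concave majorant of the Bernoulli tail, this tail lies below an exponential
function equal to g x at x, so that the truncated third moment is at most the
one of an exponential tail; the best t gives the constant 2 e^3 / 9
(tail_le_lc).

Sharpness needs only n = 2 and X_i = s_i Z_i. These variables are admissible
with Y_i = s_i^2, and the weights are not random. Domination would therefore
force the Bernoulli average at the scales s_1, s_2 to be at most the one at
their power mean. For lambda < 1 the weights 1, 0 contradict this, by
comparing variances for t far to the left; for 1 <= lambda < lambda_star p the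
weights 1 + x, 1 - x do, with small x and the t at which the second order
condition is an equality for lambda = lambda_star p (sharp_exceeds). *)

Set Implicit Arguments.
Unset Strict Implicit.
Unset Printing Implicit Defensive.

Import Order.TTheory GRing.Theory Num.Theory.
Import numFieldNormedType.Exports.

Local Open Scope classical_set_scope.
Local Open Scope ring_scope.

(** * Derivatives and positive parts *)

Section calculus.
Context {R : realType}.
Implicit Types (f g h : R -> R) (a b x y t : R).

Lemma is_derive_continuous f a x : is_derive x 1 f a -> {for x, continuous f}.
Proof.
by move=> [fx _]; apply: differentiable_continuous; exact/derivable1_diffP.
Qed.

Lemma is_derive_within_continuous f g a b :
  (forall x, a <= x <= b -> is_derive x 1 f (g x)) ->
  {within `[a, b], continuous f}.
Proof.
move=> fg; apply: continuous_in_subspaceT => x.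
rewrite inE/= in_itv/= => /fg; exact: is_derive_continuous.
Qed.

Lemma derive_ge0_le f g a b : a <= b ->
  (forall x, a <= x <= b -> is_derive x 1 f (g x)) ->
  (forall x, a < x < b -> 0 <= g x) -> f a <= f b.
Proof.
rewrite le_eqVlt => /predU1P[->//|ab] fg g0; rewrite -subr_ge0.
have fg' x : x \in `]a, b[ -> is_derive x 1 f (g x).
  by rewrite in_itv/= => /andP[/ltW ax /ltW xb]; apply: fg; rewrite ax.
have [c] := MVT ab fg' (is_derive_within_continuous fg).
by rewrite in_itv/= => /g0 gc0 ->; rewrite mulr_ge0// subr_ge0 ltW.
Qed.

Lemma derive_le0_ge f g a b : a <= b ->
  (forall x, a <= x <= b -> is_derive x 1 f (g x)) ->
  (forall x, a < x < b -> g x <= 0) -> f b <= f a.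
Proof.
move=> ab fg g0; rewrite -lerN2.
apply: (@derive_ge0_le (- f) (fun x => - g x)) => // x xab.
  by apply: is_deriveN; exact: fg.
by rewrite oppr_ge0; exact: g0.
Qed.

Lemma is_derive_affine f a c k x : is_derive (c + k * x) 1 f a ->
  is_derive x 1 (fun y => f (c + k * y)) (a * k).
Proof.
move=> fa; apply: (is_derive1_comp (g := fun y => c + k * y)) => //.
apply: is_derive_eq.
by rewrite /GRing.scale/=; ring.
Qed.

(** Cubes of these functions are the test functions for tails, and their squares are
the extreme cases among derivatives of test functions. *)
Definition ppart t x : R := Num.max (x - t) 0.

Lemma ppart_ge0 t x : 0 <= ppart t x.
Proof. by rewrite le_max lexx orbT. Qed.

Lemma ppartE t x : t <= x -> ppart t x = x - t.
Proof. by move=> tx; rewrite /ppart max_l// subr_ge0. Qed.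

Lemma ppart0 t x : x <= t -> ppart t x = 0.
Proof. by move=> tx; rewrite /ppart max_r// subr_le0. Qed.

Lemma is_derive_expn_shift n (c : R) x :
  is_derive x 1 (fun y => (y + c) ^+ n.+1) (n.+1%:R * (x + c) ^+ n).
Proof.
apply: (is_derive_eq (is_derive1_comp
    (f := fun z => z ^+ n.+1) (g := fun y => y + c)
    (a := n.+1%:R * (x + c) ^+ n) (b := 1) _ _)) => //=.
    by split; [exact: exprn_derivable|rewrite exp_derive /GRing.scale/= mulr1].
  exact: is_derive_shift.
by rewrite mulr1.
Qed.

(** The knot t is the only delicate point: there the power n + 2 >= 2 makes the
difference quotient tend to 0. *)
Lemma is_derive_ppart n t x :
  is_derive x 1 (fun y => ppart t y ^+ n.+2) (n.+2%:R * ppart t x ^+ n.+1).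
Proof.
have [tx|xt|<-] := ltgtP t x.
- rewrite ppartE ?ltW//; apply: near_eq_is_derive (is_derive_expn_shift n.+1 (- t) x).
  by near=> y; rewrite ppartE//; apply/ltW; near: y; exact: lt_nbhsr.
- rewrite ppart0 ?ltW// expr0n mulr0.
  apply: (@near_eq_is_derive _ _ _ (cst 0)).
  near=> y; rewrite ppart0 ?expr0n//; apply/ltW; near: y; exact: lt_nbhsl.
rewrite ppart0// expr0n mulr0.
have h0 : h^-1 *: (ppart t (h *: 1 + t) ^+ n.+2 - ppart t t ^+ n.+2)
    @[h --> 0^'] --> (0 : R).
  apply/cvgr0Pnorm_le => e e0; near=> h.
  rewrite (ppart0 (lexx t)) expr0n/= subr0 /ppart {1}/GRing.scale/= [h *: _]mulr1 addrK.
  have hn0 : h != 0 by near: h; exact: nbhs_dnbhs_neq.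
  have hlt : `|h| <= Num.min e 1.
    by near: h; apply: dnbhs0_le; rewrite lt_min e0 ltr01.
  rewrite normrM normfV normrX.
  have hm : `|Num.max h 0| <= `|h|.
    by have [h0|h0] := leP 0 h; rewrite ?normr0.
  rewrite ler_pdivrMl ?normr_gt0//.
  apply: le_trans (_ : `|h| ^+ n.+2 <= _).
    by rewrite lerXn2r ?nnegrE.
  rewrite exprS ler_wpM2l// exprS.
  apply: le_trans (_ : e * 1 <= _); last by rewrite mulr1.
  move: hlt; rewrite le_min => /andP[he h1].
  by rewrite ler_pM// exprn_ile1.
by split; [apply/cvg_ex; exists 0|exact: cvg_lim].
Unshelve. all: by end_near. Qed.

End calculus.

(** * A four point inequality for convex derivatives *)

Section four_points.
Context {R : realType}.
Implicit Types (f g h G H : R -> R) (a b x y t k p s : R).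

(** Convexity written without division, so that it can be used on points that may
coincide. *)
Definition convex3 h := forall x y z, x <= y <= z ->
  (z - x) * h y <= (z - y) * h x + (y - x) * h z.

Definition chord h a b x := h a + (h b - h a) / (b - a) * (x - a).

Lemma chord_ge h a b x : convex3 h -> a < b -> a <= x <= b ->
  h x <= chord h a b x.
Proof.
move=> ch ab axb; have ba : 0 < b - a by rewrite subr_gt0.
rewrite -(ler_pM2l ba) (le_trans (ch _ _ _ axb))// le_eqVlt; apply/orP; left.
by apply/eqP; rewrite /chord; field; rewrite gt_eqF.
Qed.

Lemma chord_le h a b x : convex3 h -> a < b -> x <= a \/ b <= x ->
  chord h a b x <= h x.
Proof.
move=> ch ab xab; have ba : 0 < b - a by rewrite subr_gt0.
rewrite -(ler_pM2l ba).
have -> : (b - a) * chord h a b x = (b - x) * h a + (x - a) * h b.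
  by rewrite /chord; field; rewrite gt_eqF.
case: xab => [xa|bx].
  by have := ch x a b; rewrite xa ltW// => /(_ isT); lra.
by have := ch a b x; rewrite bx ltW// => /(_ isT); lra.
Qed.

(** With g = f', the numbers gap1 and gap2 are, up to the same positive factor, the
derivatives of the expectation of f (x + s1 Z1 + s2 Z2) in s1 and in s2, with
lengths divided by sqrt (p (1 - p)); the point x0 is the lowest of the four
possible values of the sum. *)
Definition gap1 p s1 s2 x0 g := (1 - p) * (g (x0 + s1) - g x0) +
  p * (g (x0 + (s1 + s2)) - g (x0 + s2)).
Definition gap2 p s1 s2 x0 g := (1 - p) * (g (x0 + s2) - g x0) +
  p * (g (x0 + (s1 + s2)) - g (x0 + s1)).

(** The quantity gap2 - k gap1 is a combination, with nonnegative coefficients, of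
increments of g between the four points. Each increment of g - G has the right
sign as soon as g - G increases, then decreases, then increases again. *)
Lemma gap_compare p k s1 s2 x0 g h G H :
  0 <= p <= 1 -> 0 <= k <= 1 -> 0 <= s2 -> s2 <= s1 ->
  (forall x, is_derive x 1 g (h x)) -> (forall x, is_derive x 1 G (H x)) ->
  (forall x, x <= x0 + s2 -> H x <= h x) ->
  (forall x, x0 + s2 <= x <= x0 + s1 -> h x <= H x) ->
  (forall x, x0 + s1 <= x -> H x <= h x) ->
  k * gap1 p s1 s2 x0 G <= gap2 p s1 s2 x0 G ->
  k * gap1 p s1 s2 x0 g <= gap2 p s1 s2 x0 g.
Proof.
move=> p01 k01 s20 s12 gh GH lo mid hi.
pose e x := g x - G x.
have de x : is_derive x 1 e (h x - H x) by exact: is_deriveB.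
have e1 : e x0 <= e (x0 + s2).
  apply: (derive_ge0_le (g := fun x => h x - H x)) => //; first lra.
  by move=> x xs; rewrite subr_ge0 lo//; lra.
have e2 : e (x0 + s1) <= e (x0 + s2).
  apply: (derive_le0_ge (g := fun x => h x - H x)) => //; first lra.
  by move=> x xs; rewrite subr_le0 mid//; lra.
have e3 : e (x0 + s1) <= e (x0 + (s1 + s2)).
  apply: (derive_ge0_le (g := fun x => h x - H x)) => //; first lra.
  by move=> x xs; rewrite subr_ge0 hi//; lra.
suff : 0 <= (gap2 p s1 s2 x0 g - k * gap1 p s1 s2 x0 g) -
  (gap2 p s1 s2 x0 G - k * gap1 p s1 s2 x0 G) by lra.
have -> : (gap2 p s1 s2 x0 g - k * gap1 p s1 s2 x0 g) -
  (gap2 p s1 s2 x0 G - k * gap1 p s1 s2 x0 G) =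
   (1 - p) * (1 - k) * (e (x0 + s2) - e x0)
   + k * (e (x0 + s2) - e (x0 + s1))
   + p * (1 - k) * (e (x0 + (s1 + s2)) - e (x0 + s1)).
  by rewrite /gap1 /gap2 /e; ring.
by rewrite !addr_ge0// !mulr_ge0//; lra.
Qed.

(** For H take the positive part of the chord of h over the middle interval: by
convexity the chord is above h inside and below it outside, and h >= 0. An
antiderivative of H is a multiple of the square of a positive part, for which
the claim is the quadratic hypothesis, w being the distance from the knot to
x0 + s2; a knot to the left of x0 adds a linear term, which is what
k s1 <= s2 is for. *)
Lemma gap_ineq p k s1 s2 x0 g h :
  0 <= p <= 1 -> 0 <= k <= 1 -> 0 <= s2 -> s2 <= s1 ->
  k * s1 <= s2 ->
  (forall w, 0 <= w <= s2 ->
    k * ((1 - p) * (s1 - s2 + w) ^+ 2 + p * ((s1 + w) ^+ 2 - w ^+ 2)) <=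
    (1 - p) * w ^+ 2 + p * ((s1 + w) ^+ 2 - (s1 - s2 + w) ^+ 2)) ->
  (forall x, is_derive x 1 g (h x)) -> convex3 h ->
  {homo h : x y / x <= y} -> (forall x, 0 <= h x) ->
  k * gap1 p s1 s2 x0 g <= gap2 p s1 s2 x0 g.
Proof.
move=> p01 k01 s20 s12 ks quad gh ch hmono h0.
have [s21|] := eqVneq s1 s2.
  have -> : gap1 p s1 s2 x0 g = gap2 p s1 s2 x0 g by rewrite /gap1 /gap2 s21.
  have g1 : g x0 <= g (x0 + s2) by apply: (derive_ge0_le (g := h)) => //; lra.
  have g2 : g (x0 + s1) <= g (x0 + (s1 + s2)).
    by apply: (derive_ge0_le (g := h)) => //; lra.
  suff g0 : 0 <= gap2 p s1 s2 x0 g by  rewrite ler_piMl//; lra.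
  by rewrite /gap2 addr_ge0// mulr_ge0//; lra.
move=> ne; have {ne} lt12 : s2 < s1 by rewrite lt_neqAle eq_sym ne.
have ltx : x0 + s2 < x0 + s1 by lra.
pose m := (h (x0 + s1) - h (x0 + s2)) / (x0 + s1 - (x0 + s2)).
have m0 : 0 <= m.
  by rewrite divr_ge0// subr_ge0; [apply: hmono|]; lra.
pose H x := Num.max (chord h (x0 + s2) (x0 + s1) x) 0.
have lo x : x <= x0 + s2 -> H x <= h x.
  by move=> xs; rewrite ge_max h0 chord_le//; left.
have hi x : x0 + s1 <= x -> H x <= h x.
  by move=> xs; rewrite ge_max h0 chord_le//; right.
have mid x : x0 + s2 <= x <= x0 + s1 -> h x <= H x.
  by move=> xs; rewrite le_max chord_ge.
have [m00|] := eqVneq m 0.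
  apply: (@gap_compare p k s1 s2 x0 g h (fun x => h (x0 + s2) * x) H) => //; last first.
    have := h0 (x0 + s2).
    set c := h _ => c0.
    have : c * (k * s1) <= c * s2 by rewrite ler_wpM2l.
    by rewrite /gap1 /gap2; lra.
  move=> x; apply: is_derive_eq.
  rewrite /H /chord -/m m00 mul0r addr0 max_l// /GRing.scale/=; ring.
move=> mn0; have {mn0} mp : 0 < m by rewrite lt_neqAle eq_sym mn0.
(* the zero of the chord *)
pose tau := x0 + s2 - h (x0 + s2) / m.
have HE x : H x = m * ppart tau x.
  rewrite /H /ppart -[X in _ = m * Num.max _ X](mulr0 m).
  rewrite mulr0 maxr_pMr ?ltW// mulr0; congr Num.max.
  by rewrite /chord -/m /tau; field; rewrite gt_eqF.
pose G x := m / 2 * ppart tau x ^+ 2.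
have GH x : is_derive x 1 G (H x).
  apply: (is_derive_eq (is_deriveZ (m / 2) (is_derive_ppart 0 tau x))).
  by rewrite HE expr1 /GRing.scale/=; field.
apply: (@gap_compare p k s1 s2 x0 g h G H) => //.
have ts : tau <= x0 + s2 by rewrite gerBl divr_ge0.
suff Q : k * ((1 - p) * (ppart tau (x0 + s1) ^+ 2 - ppart tau x0 ^+ 2) +
      p * (ppart tau (x0 + (s1 + s2)) ^+ 2 - ppart tau (x0 + s2) ^+ 2)) <=
    (1 - p) * (ppart tau (x0 + s2) ^+ 2 - ppart tau x0 ^+ 2) +
      p * (ppart tau (x0 + (s1 + s2)) ^+ 2 - ppart tau (x0 + s1) ^+ 2).
  have m2 : 0 <= m / 2 by lra.
  have := ler_wpM2l m2 Q; rewrite /gap1 /gap2 /G; lra.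
rewrite !(@ppartE _ tau (_ + _))//; try lra.
have [x0t|tx0] := leP x0 tau.
  rewrite (ppart0 x0t).
  have /quad : 0 <= x0 + s2 - tau <= s2 by lra.
  have -> : s1 - s2 + (x0 + s2 - tau) = x0 + s1 - tau by ring.
  have -> : s1 + (x0 + s2 - tau) = x0 + (s1 + s2) - tau by ring.
  by rewrite expr0n/= !subr0.
rewrite (ppartE (ltW tx0)).
have /quad Q : 0 <= s2 <= s2 by lra.
have yk : (x0 - tau) * (k * s1) <= (x0 - tau) * s2.
  by rewrite ler_wpM2l//; lra.
lra.
Qed.

End four_points.

(** * The power inequality behind the critical exponent *)

Section key_power_inequality.
Context {R : realType}.
Implicit Types (p q r th al w k lam : R).

(** For the square of a positive part, slope1 and slope2 are gap1 and gap2 when the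
scales are 1 and r and the knot lies at the distance w to the left of r. *)
Definition slope1 p r w := (1 - p) * (1 - r + w) ^+ 2 + p * ((1 + w) ^+ 2 - w ^+ 2).
Definition slope2 p r w := (1 - p) * w ^+ 2 + p * ((1 + w) ^+ 2 - (1 - r + w) ^+ 2).

Lemma slope1_ge0 p r w : 0 <= p <= 1 -> 0 <= w -> 0 <= slope1 p r w.
Proof.
move=> p01 w0; rewrite /slope1 addr_ge0// mulr_ge0 ?sqr_ge0//; first lra.
  lra.
by nra.
Qed.

(** For p >= 1/2 the difference slope2 - r slope1 is visibly a sum of nonnegative
terms, so the first power of r suffices; this is why lambda_star is 1 there. *)
Lemma slope_ge_half p r w k : 2^-1 <= p -> p <= 1 -> 0 <= r <= 1 -> 0 <= w ->
  k <= r -> k * slope1 p r w <= slope2 p r w.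
Proof.
move=> p1 p2 r01 w0 kr.
apply: le_trans (_ : r * slope1 p r w <= _).
  by rewrite ler_wpM2r ?slope1_ge0//; lra.
rewrite -subr_ge0.
have -> : slope2 p r w - r * slope1 p r w =
    (1 - p) * (1 - r) * (w - r) ^+ 2 + (2 * p - 1) * (r * (1 - r)).
  by rewrite /slope1 /slope2; ring.
by rewrite addr_ge0// !(sqr_ge0, mulr_ge0)//; lra.
Qed.

(** For p < 1/2 write th = sqrt (p / (1 - p)). This is the critical value of
2 lambda - 1, namely 1 / (p + sqrt (p (1 - p))). *)
Definition crit_exp th := (1 + th ^+ 2) / (th * (1 + th)).
(** A parametrization of the ratio r of the scales in which the worst knot is at
w = th al and the least ratio of slope2 to slope1 is a rational function. *)
Definition scale_ratio th al := al * (1 + th * al) / (al + th).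
(** The least value of slope2 / slope1 over all knots, at the ratio scale_ratio th al. *)
Definition min_ratio th al :=
  al * (2 * th + (1 + th ^+ 2) * al) / (1 + th ^+ 2 + 2 * th * al).

(** The difference of the two sides is a nonnegative multiple of (w - th al)^2. *)
Lemma min_ratio_slope th al w : 0 < th -> 0 < al <= 1 ->
  forall p, p = th ^+ 2 / (1 + th ^+ 2) ->
  min_ratio th al * slope1 p (scale_ratio th al) w <= slope2 p (scale_ratio th al) w.
Proof.
move=> th0 /andP[al0 al1] p pE; rewrite -subr_ge0.
have d1 : 0 < 1 + th ^+ 2 by nra.
have d2 : 0 < 1 + th ^+ 2 + 2 * th * al by nra.
have d3 : 0 < al + th by lra.
have -> : slope2 p (scale_ratio th al) w - min_ratio th al * slope1 p (scale_ratio th al) w =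
    (1 - al ^+ 2) / (1 + th ^+ 2 + 2 * th * al) * (w - th * al) ^+ 2.
  rewrite /slope1 /slope2 /min_ratio /scale_ratio pE; field.
  by rewrite !gt_eqF.
by rewrite mulr_ge0 ?sqr_ge0// divr_ge0 ?(ltW d2)//; nra.
Qed.

(** The logarithm of min_ratio / scale_ratio ^ crit_exp. *)
Let psi th al := ln al + ln (2 * th + (1 + th ^+ 2) * al)
  - ln (1 + th ^+ 2 + 2 * th * al)
  - crit_exp th * (ln al + ln (1 + th * al) - ln (th + 1 * al)).

Let dpsi th al := al^-1 + (2 * th + (1 + th ^+ 2) * al)^-1 * (1 + th ^+ 2)
  - (1 + th ^+ 2 + 2 * th * al)^-1 * (2 * th)
  - crit_exp th * (al^-1 + (1 + th * al)^-1 * th - (th + 1 * al)^-1 * 1).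

Lemma is_derive_psi th al : 0 < th -> 0 < al ->
  is_derive al 1 (psi th) (dpsi th al).
Proof.
move=> th0 al0.
have d1 : 0 < 1 + th ^+ 2 by nra.
have L c a : 0 <= c -> 0 < a -> is_derive al 1 (fun y => ln (c + a * y)) ((c + a * al)^-1 * a).
  move=> c0 a0; apply: is_derive_affine; apply: is_derive1_ln.
  by rewrite ltr_wpDl// mulr_gt0.
apply: is_deriveB.
  apply: is_deriveB.
    apply: is_deriveD; first exact: is_derive1_ln.
    by apply: L; lra.
  by apply: L; nra.
apply: is_deriveZ.
apply: is_deriveB.
  apply: is_deriveD; first exact: is_derive1_ln.
  by apply: L; lra.
by apply: L; lra.
Qed.

(** Up to the factor 1 / al, the derivative is 1 + Y - crit_exp (1 - X), where X and
Y are largest at al = 1; there the expression vanishes, by the choice of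
crit_exp. *)
Lemma dpsi_le0 th al : 0 < th < 1 -> 0 < al -> dpsi th al <= 0.
Proof.
move=> /andP[th0 th1] al0.
have d1 : 0 < 1 + th ^+ 2 by nra.
have d2 : 0 < 1 + th ^+ 2 + 2 * th * al by nra.
have d2' : 0 < 2 * th + (1 + th ^+ 2) * al by nra.
have d3 : 0 < al + th by lra.
have d3' : 0 < 1 + th * al by nra.
have d4 : 0 < 1 + th by lra.
pose X := al * (1 - th ^+ 2) / ((1 + th * al) * (al + th)).
pose Y := al * (1 - th ^+ 2) ^+ 2 /
  ((1 + th ^+ 2 + 2 * th * al) * (2 * th + (1 + th ^+ 2) * al)).
have XE : X <= (1 - th) / (1 + th).
  rewrite /X ler_pdivrMr ?mulr_gt0// mulrAC ler_pdivlMr//.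
  have : 0 <= (1 - th) * (th * (1 - al) ^+ 2).
    by rewrite !(sqr_ge0, mulr_ge0)//; lra.
  lra.
have YE : Y <= ((1 - th) / (1 + th)) ^+ 2.
  rewrite /Y ler_pdivrMr ?mulr_gt0// expr_div_n mulrAC ler_pdivlMr ?exprn_gt0//.
  have : 0 <= (1 - th) ^+ 2 * (2 * th * (1 + th ^+ 2) * (1 - al) ^+ 2).
    by rewrite !(sqr_ge0, mulr_ge0)//; lra.
  lra.
have -> : dpsi th al = al^-1 * (1 + Y - crit_exp th * (1 - X)).
  rewrite /dpsi /X /Y /crit_exp; field.
  by rewrite !gt_eqF// addrC mul1r.
rewrite mulr_ge0_le0 ?invr_ge0 ?(ltW al0)//.
have mu0 : 0 <= crit_exp th by rewrite /crit_exp divr_ge0 ?mulr_ge0//; lra.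
have : crit_exp th * (1 - (1 - th) / (1 + th)) <= crit_exp th * (1 - X).
  by rewrite ler_wpM2l//; lra.
have -> : crit_exp th * (1 - (1 - th) / (1 + th)) = 1 + ((1 - th) / (1 + th)) ^+ 2.
  by rewrite /crit_exp; field; rewrite !gt_eqF.
lra.
Qed.

(** By monotonicity of psi it is enough to look at al = 1, where both sides are 1. *)
Lemma scale_ratio_powR_le th al : 0 < th < 1 -> 0 < al <= 1 ->
  scale_ratio th al `^ crit_exp th <= min_ratio th al.
Proof.
move=> th01 /andP[al0 al1]; have /andP[th0 th1] := th01.
have d1 : 0 < 1 + th ^+ 2 by nra.
have d2 : 0 < 1 + th ^+ 2 + 2 * th * al by nra.
have d2' : 0 < 2 * th + (1 + th ^+ 2) * al by nra.
have d3 : 0 < al + th by lra.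
have d3' : 0 < 1 + th * al by nra.
have r0 : 0 < scale_ratio th al by rewrite divr_gt0// mulr_gt0.
have Q0 : 0 < min_ratio th al by rewrite divr_gt0// mulr_gt0.
rewrite -ler_ln ?posrE ?powR_gt0// ln_powR -subr_ge0.
have -> : ln (min_ratio th al) - crit_exp th * ln (scale_ratio th al) = psi th al.
  rewrite /psi /min_ratio /scale_ratio !ln_div ?lnM ?posrE ?mulr_gt0//.
  by rewrite mul1r (addrC th).
have <- : psi th 1 = 0.
  rewrite /psi !mulr1 ln1 !add0r (addrC th) subrr mulr0 subr0.
  by rewrite (addrC (2 * th)) subrr.
apply: (derive_le0_ge (g := dpsi th)) => // x /andP[x0 x1].
  by apply: is_derive_psi => //; exact: lt_le_trans x0.
by apply: dpsi_le0 => //; exact: lt_trans x0.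
Qed.

(** Solving for al is a quadratic equation whose positive root is at most 1. *)
Lemma scale_ratio_surj th r : 0 < th -> 0 < r <= 1 ->
  exists2 al, 0 < al <= 1 & scale_ratio th al = r.
Proof.
move=> th0 /andP[r0 r1].
pose D := (1 - r) ^+ 2 + 4 * (th ^+ 2 * r).
have thr : 0 < th ^+ 2 * r by rewrite mulr_gt0 ?exprn_gt0.
have D0 : 0 <= D by rewrite /D; nra.
pose s := Num.sqrt D.
have s0 : 0 <= s by exact: sqrtr_ge0.
have s2 : s ^+ 2 = D by rewrite sqr_sqrtr.
have sl : 1 - r < s by rewrite -(@ltr_pXn2r _ 2)// ?nnegrE ?s2 /D; lra.
have su : s <= 2 * th + (1 - r).
  rewrite -(@ler_pXn2r _ 2)// ?nnegrE ?s2 /D; last lra.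
  have : 0 <= th * (th * (1 - r)) + th * (1 - r).
    by rewrite addr_ge0 ?mulr_ge0//; lra.
  lra.
pose al := (s - (1 - r)) / (2 * th).
have al0 : 0 < al by rewrite divr_gt0//; lra.
exists al; first by rewrite al0/= /al ler_pdivrMr; lra.
have E : th * al ^+ 2 + (1 - r) * al - r * th = 0.
  have -> : th * al ^+ 2 + (1 - r) * al - r * th = (s ^+ 2 - D) / (4 * th).
    by rewrite /al /D; field; rewrite gt_eqF.
  by rewrite s2 subrr mul0r.
have d3 : al + th != 0 by rewrite gt_eqF//; lra.
apply: (mulIf d3); rewrite /scale_ratio divfK//; lra.
Qed.

(** This identifies lambda_star with the exponent found in the one-parameter form of
the inequality. *)
Lemma theta_param p : 0 < p <= 2^-1 -> exists2 th, 0 < th <= 1 &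
  p = th ^+ 2 / (1 + th ^+ 2) /\ 2 * lambda_star p - 1 = crit_exp th.
Proof.
move=> /andP[p0 p1].
have q0 : 0 < 1 - p by lra.
pose th := Num.sqrt (p / (1 - p)).
have pq0 : 0 < p / (1 - p) by rewrite divr_gt0.
have th0 : 0 < th by rewrite sqrtr_gt0.
have th2 : th ^+ 2 = p / (1 - p) by rewrite sqr_sqrtr// ltW.
have th1 : th <= 1.
  by rewrite -(@ler_pXn2r _ 2) ?nnegrE ?(ltW th0)// th2 expr1n ler_pdivrMr//; lra.
have d1 : 0 < 1 + th ^+ 2 by nra.
have pE : p = th ^+ 2 / (1 + th ^+ 2).
  by rewrite th2; field; rewrite !gt_eqF//; lra.
exists th; first by rewrite th0.
split => //; rewrite /lambda_star p1.
have -> : Num.sqrt (p - p ^+ 2) = th / (1 + th ^+ 2).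
  rewrite (_ : p - p ^+ 2 = (th / (1 + th ^+ 2)) ^+ 2).
    by rewrite sqrtr_sqr ger0_norm// divr_ge0 ?(ltW d1) ?(ltW th0).
  by rewrite pE; field; rewrite gt_eqF.
rewrite pE /crit_exp; field.
have t4 : 0 < th ^+ 4 by rewrite exprn_gt0.
rewrite !gt_eqF//; nra.
Qed.

(** The inequality that fixes the range of lambda: r^(2 lambda - 1) is at most the
least ratio of the two slopes. The bound k <= r serves knots that lie to the
left of all four points. *)
Lemma key_power p lam r : 0 < p < 1 -> lambda_star p <= lam -> 0 < r <= 1 ->
  let k := r `^ (2 * lam - 1) in
  [/\ 0 <= k <= 1, k <= r & forall w, 0 <= w <= r ->
    k * slope1 p r w <= slope2 p r w].
Proof.
move=> /andP[p0 p1] hl r01 k; have /andP[r0 r1] := r01.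
have kr1 : k <= r -> 0 <= k <= 1.
  by move=> kr; rewrite powR_ge0/= (le_trans kr).
have [ph|hp] := leP 2^-1 p.
  have l1 : 1 <= lam.
    apply: le_trans hl; rewrite /lambda_star; case: ifPn => // p2.
    have -> : p = 2^-1 by apply/eqP; rewrite eq_le p2.
    have -> : 2^-1 - 2^-1 ^+ 2 = 2^-1 ^+ 2 :> R by lra.
    by rewrite sqrtr_sqr ger0_norm ?invr_ge0// ler_pdivlMr; lra.
  have kr : k <= r.
    rewrite /k -[leRHS]powRr1 ?(ltW r0)//; apply: ger_powR => //; lra.
  split => //; first exact: kr1.
  by move=> w /andP[w0 wr]; apply: slope_ge_half => //; lra.
have [|th /andP[th0 th1'] [pE lE]] := @theta_param p; first by rewrite p0 ltW.
have th1 : th < 1.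
  rewrite lt_neqAle th1' andbT; apply: contraTneq hp => t1.
  by rewrite pE t1 -leNgt ler_pdivlMr; lra.
have mu1 : 1 <= crit_exp th.
  by rewrite /crit_exp ler_pdivlMr ?mulr_gt0//; lra.
have kmu : k <= r `^ crit_exp th by apply: ger_powR => //; rewrite -lE; lra.
have kr : k <= r.
  rewrite (le_trans kmu)// -[leRHS]powRr1 ?(ltW r0)//; exact: ger_powR.
split => //; first exact: kr1.
move=> w /andP[w0 wr].
have [al al01 rE] := scale_ratio_surj th0 r01.
apply: le_trans (_ : min_ratio th al * slope1 p r w <= _).
  rewrite ler_wpM2r ?slope1_ge0//; first by rewrite !ltW.
  by rewrite (le_trans kmu)// -rE scale_ratio_powR_le// th0.
by rewrite -rE; exact: min_ratio_slope.
Qed.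

End key_power_inequality.

(** * Averages over scaled Bernoulli steps *)

Section bernoulli_operator.
Context {R : realType}.
Implicit Types (f g h : R -> R) (p x y s a b m u lam : R) (l : seq R).

Definition zval p (e : bool) : R := (e%:R - p) / Num.sqrt (p * (1 - p)).

Lemma zvalT p : zval p true = (1 - p) / Num.sqrt (p * (1 - p)).
Proof. by []. Qed.

Lemma zvalF p : zval p false = - p / Num.sqrt (p * (1 - p)).
Proof. by rewrite /zval mulr0n sub0r. Qed.

(** The expectation of f (x + s Z) for a standardized Bernoulli variable Z. Keeping
expectations as iterated two-point averages makes the extremal part of the
argument independent of any probability space. *)
Definition bern_step p s f x :=
  p * f (x + s * zval p true) + (1 - p) * f (x + s * zval p false).

(** The expectation of f (x + s_1 Z_1 + ... + s_k Z_k) for independent Z_i and the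
list l of the s_i. *)
Definition bern_mean p l f := foldr (bern_step p) f l.

(** What is needed of a member of Hplus 3: two derivatives, the second one convex,
nondecreasing and nonnegative. Unlike Hplus 3, this is visibly stable under
bern_step. *)
Record smooth3 f g h : Prop := Smooth3 {
  smooth3_d1 : forall x, is_derive x 1 f (g x) ;
  smooth3_d2 : forall x, is_derive x 1 g (h x) ;
  smooth3_cvx : convex3 h ;
  smooth3_mono : {homo h : x y / x <= y} ;
  smooth3_ge0 : forall x, 0 <= h x }.

Lemma bern_step_le p s f g x : 0 <= p <= 1 -> (forall y, f y <= g y) ->
  bern_step p s f x <= bern_step p s g x.
Proof. by move=> p01 fg; rewrite lerD// ler_wpM2l//; lra. Qed.

Lemma bern_stepC p s t f : bern_step p s (bern_step p t f) = bern_step p t (bern_step p s f).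
Proof.
apply/funext => x; rewrite /bern_step.
set z1 := zval p true; set z0 := zval p false.
by rewrite !(addrAC _ (t * _)); ring.
Qed.

Lemma bern_mean_cat p l l' f : bern_mean p (l ++ l') f = bern_mean p l (bern_mean p l' f).
Proof. exact: foldr_cat. Qed.

Lemma bern_mean_perm p l l' f : perm_eq l l' -> bern_mean p l f = bern_mean p l' f.
Proof.
elim: l l' => [|s l IH] l' ll'; first by move: ll'; rewrite perm_sym => /perm_nilP ->.
have sl' : s \in l' by rewrite -(perm_mem ll') mem_head.
case/splitPr: sl' ll' => l1 l2.
rewrite perm_sym -cat1s perm_catCA/= perm_cons perm_sym => /IH /= ->.
elim: l1 => //= t l1 IH1.
by rewrite bern_stepC IH1.
Qed.

Lemma is_derive_bern_step p s f g x : (forall y, is_derive y 1 f (g y)) ->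
  is_derive x 1 (bern_step p s f) (bern_step p s g x).
Proof.
move=> fg.
have H c : is_derive x 1 (fun y => f (y + c)) (g (x + c)).
  rewrite -[g (x + c)]mulr1.
  exact: (@is_derive1_comp _ f (shift c) x _ _ (fg _) (is_derive_shift _ _ _)).
set c1 := s * zval p true; set c0 := s * zval p false.
exact: (is_deriveD (f := p *: (fun y => f (y + c1)))
  (g := (1 - p) *: (fun y => f (y + c0)))
  (is_deriveZ p (H c1)) (is_deriveZ (1 - p) (H c0))).
Qed.

Lemma smooth3_bern_step p s f g h : 0 <= p <= 1 -> smooth3 f g h ->
  smooth3 (bern_step p s f) (bern_step p s g) (bern_step p s h).
Proof.
move=> p01 [d1 d2 cv mo h0]; split.
- by move=> x; exact: is_derive_bern_step.
- by move=> x; exact: is_derive_bern_step.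
- move=> x y z xyz; rewrite /bern_step.
  set c1 := s * zval p true; set c0 := s * zval p false.
  have := cv (x + c1) (y + c1) (z + c1).
  rewrite !lerD2r => /(_ xyz).
  have := cv (x + c0) (y + c0) (z + c0).
  rewrite !lerD2r => /(_ xyz).
  have -> c : z + c - (x + c) = z - x by ring.
  have -> c : z + c - (y + c) = z - y by ring.
  have -> c : y + c - (x + c) = y - x by ring.
  move=> H0 H1.
  have q0 : 0 <= 1 - p by lra.
  have p0 : 0 <= p by lra.
  have := ler_wpM2l p0 H1; have := ler_wpM2l q0 H0; lra.
- move=> x y xy; rewrite lerD// ler_wpM2l//; try lra; apply: mo; lra.
- by move=> x; rewrite addr_ge0// mulr_ge0//; lra.
Qed.

Lemma smooth3_bern_mean p l f g h : 0 <= p <= 1 -> smooth3 f g h ->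
  smooth3 (bern_mean p l f) (bern_mean p l g) (bern_mean p l h).
Proof. by move=> p01 fgh; elim: l => //= s l IH; exact: smooth3_bern_step. Qed.

(** Dividing all lengths by s1 turns the hypotheses of gap_ineq into key_power. *)
Lemma gap_scaled p lam f g h s1 s2 x : 0 < p < 1 -> lambda_star p <= lam ->
  smooth3 f g h -> 0 < s2 <= s1 ->
  (s2 / s1) `^ (2 * lam - 1) * gap1 p s1 s2 x g <= gap2 p s1 s2 x g.
Proof.
move=> p01 hl [_ gh ch mh h0] /andP[s20 s21].
have s10 : 0 < s1 by exact: lt_le_trans s21.
pose r := s2 / s1.
have r01 : 0 < r <= 1 by rewrite divr_gt0//= ler_pdivrMr// mul1r.
have [k01 kr quad] := key_power p01 hl r01.
set k := _ `^ _ in k01 kr quad *.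
have s2E : s2 = r * s1 by rewrite /r divfK// gt_eqF.
apply: (@gap_ineq _ p k s1 s2 x g h) => //; [lra|exact: ltW| |].
  by rewrite s2E ler_wpM2r// ltW.
move=> w /andP[w0 ws].
have /quad : 0 <= w / s1 <= r.
  by rewrite divr_ge0 ?(ltW s10)//= ler_pM2r// invr_gt0.
have wE : w = w / s1 * s1 by rewrite divfK// gt_eqF.
have s1s : 0 <= s1 ^+ 2 by exact: sqr_ge0.
move=> /(ler_wpM2l s1s).
rewrite s2E {3 4 5 6 7 8}wE /slope1 /slope2.
by set w' := w / s1; lra.
Qed.

(** Two weights with fixed sum 2 m; their distance 2 u is the parameter. The weights
are squares of scales raised to the power lambda. *)
Definition spread p (lam m : R) f x u :=
  bern_mean p [:: (m + u) `^ (2 * lam)^-1; (m - u) `^ (2 * lam)^-1] f x.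

Let dspread p lam m g x u :=
  let kap := (2 * lam)^-1 in let r := Num.sqrt (p * (1 - p)) in
  let s1 := (m + u) `^ kap in let s2 := (m - u) `^ kap in
  let y := x + s1 * zval p false + s2 * zval p false in
  p * (1 - p) / r * kap * ((m + u) `^ (kap - 1) * gap1 p (s1 / r) (s2 / r) y g
     - (m - u) `^ (kap - 1) * gap2 p (s1 / r) (s2 / r) y g).

Lemma is_derive_spread p lam m f g x u : 0 < p < 1 ->
  (forall y, is_derive y 1 f (g y)) -> 0 < m + u -> 0 < m - u ->
  is_derive u 1 (spread p lam m f x) (dspread p lam m g x u).
Proof.
move=> /andP[p0 p1] fg pos neg.
have r0 : 0 < Num.sqrt (p * (1 - p)) by rewrite sqrtr_gt0 mulr_gt0//; lra.
set kap := (2 * lam)^-1.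
have dA : is_derive u 1 (fun v => (m + v) `^ kap) (kap * (m + u) `^ (kap - 1)).
  rewrite -[X in is_derive _ _ _ X]mulr1.
  have -> : (fun v => (m + v) `^ kap) = (fun v => (m + 1 * v) `^ kap).
    by apply/funext => v; rewrite mul1r.
  apply: (is_derive_affine (f := fun z => z `^ kap)).
  by rewrite mul1r; exact: is_derive1_powR.
have dB : is_derive u 1 (fun v => (m - v) `^ kap) (- (kap * (m - u) `^ (kap - 1))).
  rewrite -[X in is_derive _ _ _ X]mulrN1.
  have -> : (fun v => (m - v) `^ kap) = (fun v => (m + (-1) * v) `^ kap).
    by apply/funext => v; rewrite mulN1r.
  apply: (is_derive_affine (f := fun z => z `^ kap)).
  by rewrite mulN1r; exact: is_derive1_powR.
set A' := kap * _ `^ _ in dA; set B' := - _ in dB.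
have term a b : is_derive u 1
    (fun v => f (x + (m + v) `^ kap * a + (m - v) `^ kap * b))
    (g (x + (m + u) `^ kap * a + (m - u) `^ kap * b) * (A' * a + B' * b)).
  apply: (is_derive1_comp (f := f)
    (g := fun v => x + (m + v) `^ kap * a + (m - v) `^ kap * b)) => //.
  have da := is_deriveZ a dA; have db := is_deriveZ b dB.
  have dd := is_deriveD (is_deriveD (is_derive_cst x u 1) da) db.
  have -> : A' * a + B' * b = 0 + a *: A' + b *: B'.
    by rewrite /GRing.scale/=; ring.
  rewrite (_ : (fun v => _) = (cst x + a \*: (fun v => (m + v) `^ kap)) +
      b \*: (fun v => (m - v) `^ kap))//.
  by apply/funext => v /=; rewrite /GRing.scale/= [_ * a]mulrC [_ * b]mulrC.
set z1 := zval p true; set z0 := zval p false.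
have D := is_deriveD
  (is_deriveZ p (is_deriveD (is_deriveZ p (term z1 z1)) (is_deriveZ (1 - p) (term z1 z0))))
  (is_deriveZ (1 - p) (is_deriveD (is_deriveZ p (term z0 z1)) (is_deriveZ (1 - p) (term z0 z0)))).
have sE : spread p lam m f x = (fun v =>
    p * (p * f (x + (m + v) `^ kap * z1 + (m - v) `^ kap * z1) +
      (1 - p) * f (x + (m + v) `^ kap * z1 + (m - v) `^ kap * z0)) +
    (1 - p) * (p * f (x + (m + v) `^ kap * z0 + (m - v) `^ kap * z1) +
      (1 - p) * f (x + (m + v) `^ kap * z0 + (m - v) `^ kap * z0))) by [].
rewrite sE; apply: (is_derive_eq D).
rewrite /dspread -/kap /gap1 /gap2 /GRing.scale/=.
set s1 := (m + u) `^ kap; set s2 := (m - u) `^ kap.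
set r := Num.sqrt _ in r0 *.
have z10 : z1 = z0 + r^-1 by rewrite /z1 /z0 zvalT zvalF -/r; field; rewrite gt_eqF.
have -> : x + s1 * z0 + s2 * z0 + s1 / r = x + s1 * z1 + s2 * z0.
  by rewrite z10; ring.
have -> : x + s1 * z0 + s2 * z0 + (s1 / r + s2 / r) = x + s1 * z1 + s2 * z1.
  by rewrite z10; ring.
have -> : x + s1 * z0 + s2 * z0 + s2 / r = x + s1 * z0 + s2 * z1.
  by rewrite z10; ring.
rewrite /B' /A' /z1 /z0 zvalT zvalF -/r.
set g11 := g _; set g10 := g _; set g01 := g _; set g00 := g _.
by field; rewrite gt_eqF.
Qed.

(** The two powers in the derivative have quotient (s2 / s1)^(2 lambda - 1), so that
its sign is given by gap_scaled. *)
Lemma dspread_le0 p lam m f g h x u : 0 < p < 1 -> lambda_star p <= lam ->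
  0 < lam -> smooth3 f g h -> 0 <= u -> u < m -> dspread p lam m g x u <= 0.
Proof.
move=> p01 hl lam0 fgh u0 um; have /andP[p0 p1] := p01.
have r0 : 0 < Num.sqrt (p * (1 - p)) by rewrite sqrtr_gt0 mulr_gt0//; lra.
rewrite /dspread; set kap := (2 * lam)^-1; set r := Num.sqrt _ in r0 *.
have kap0 : 0 < kap by rewrite invr_gt0; lra.
rewrite pmulr_rle0; last first.
  by apply: mulr_gt0 => //; rewrite divr_gt0// mulr_gt0//; lra.
set a := m + u; set b := m - u.
have b0 : 0 < b by rewrite /b; lra.
have ba : b <= a by rewrite /a /b; lra.
have a0 : 0 < a by lra.
set y := x + _ + _.
have kba : (b / a) `^ (1 - kap) * b `^ (kap - 1) = a `^ (kap - 1).
  have -> : b `^ (kap - 1) = (b / a) `^ (kap - 1) * a `^ (kap - 1).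
    by rewrite -powRM ?divfK ?gt_eqF// ?divr_ge0 ?(ltW a0) ?(ltW b0).
  rewrite mulrA -powRD; last by rewrite (gt_eqF (divr_gt0 b0 a0)) implybT.
  by rewrite (_ : 1 - kap + (kap - 1) = 0) ?powRr0 ?mul1r//; ring.
have abk : (a `^ kap) != 0 by rewrite gt_eqF// powR_gt0.
have E : ((b `^ kap / r) / (a `^ kap / r)) `^ (2 * lam - 1) = (b / a) `^ (1 - kap).
  have -> : (b `^ kap / r) / (a `^ kap / r) = (b / a) `^ kap.
    have -> : b `^ kap = (b / a) `^ kap * a `^ kap.
      by rewrite -powRM ?divfK ?gt_eqF// ?divr_ge0 ?(ltW a0) ?(ltW b0).
    by field; rewrite abk gt_eqF.
  rewrite -powRrM; congr (_ `^ _); rewrite /kap; field.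
  by rewrite gt_eqF.
have := @gap_scaled p lam f g h (a `^ kap / r) (b `^ kap / r) y p01 hl fgh.
rewrite E divr_gt0 ?powR_gt0//= ler_pM2r ?invr_gt0//.
rewrite ge0_ler_powR ?nnegrE ?(ltW kap0) ?(ltW a0) ?(ltW b0)// => /(_ isT) G.
rewrite subr_le0 -kba mulrAC mulrC ler_wpM2l ?powR_ge0//.
Qed.

(** At u = m one of the weights vanishes and the power function need not be
differentiable there; continuity replaces the derivative. *)
Lemma spread_cvg_left p lam m f x : 0 < lam -> 0 < m -> continuous f ->
  spread p lam m f x u @[u --> m^'-] --> spread p lam m f x m.
Proof.
move=> lam0 m0 cf.
set kap := (2 * lam)^-1.
have kap0 : 0 < kap by rewrite invr_gt0; lra.
have B0 : (m - u) `^ kap @[u --> m^'-] --> (m - m) `^ kap.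
  rewrite subrr powR0 ?gt_eqF//; apply/cvgr0Pnorm_lt => e e0; near=> u.
  have um : 0 < m - u by rewrite subr_gt0; near: u; exact: nbhs_left_lt.
  rewrite ger0_norm ?powR_ge0//.
  have -> : e = (e `^ kap^-1) `^ kap.
    by rewrite -powRrM mulVf ?gt_eqF// powRr1 ?ltW.
  rewrite gt0_ltr_powR ?nnegrE ?powR_ge0 ?(ltW um)//.
  by near: u; apply: nbhs_left_ltBl; exact: powR_gt0.
have A0 : (m + u) `^ kap @[u --> m^'-] --> (m + m) `^ kap.
  apply: cvg_at_left_filter.
  rewrite (_ : (fun z => _) = (fun z => (m + 1 * z) `^ kap)); last first.
    by apply/funext => z; rewrite mul1r.
  have -> : m + m = m + 1 * m by rewrite mul1r.
  have H : is_derive (m + 1 * m) 1 (fun z : R => z `^ kap) (kap * (m + 1 * m) `^ (kap - 1)).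
    by apply: is_derive1_powR; lra.
  exact: is_derive_continuous (is_derive_affine H).
have F a b : f (x + (m + u) `^ kap * a + (m - u) `^ kap * b) @[u --> m^'-]
    --> f (x + (m + m) `^ kap * a + (m - m) `^ kap * b).
  apply: continuous_cvg; first exact: cf.
  apply: cvgD; last by apply: cvgM => //; exact: cvg_cst.
  apply: cvgD; first exact: cvg_cst.
  by apply: cvgM => //; exact: cvg_cst.
by rewrite /spread/= /bern_step -/kap; apply: cvgD; apply: cvgM; try exact: cvg_cst;
  apply: cvgD; apply: cvgM; try exact: cvg_cst; exact: F.
Unshelve. all: by end_near. Qed.

Lemma smooth3_continuous f g h : smooth3 f g h -> continuous f.
Proof. by move=> [d1 _ _ _ _] x; exact: is_derive_continuous (d1 x). Qed.

(** Bringing two weights closer to each other increases the expectation. *)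
Lemma spread_mono p lam m f g h x u v : 0 < p < 1 -> lambda_star p <= lam ->
  0 < lam -> smooth3 f g h -> 0 <= u <= v -> v <= m ->
  spread p lam m f x v <= spread p lam m f x u.
Proof.
move=> p01 hl lam0 fgh /andP[u0 uv].
have inner w : u <= w -> w < m -> spread p lam m f x w <= spread p lam m f x u.
  move=> uw wm; apply: (derive_le0_ge (g := dspread p lam m g x)) => // t.
    move=> /andP[ut tw]; apply: is_derive_spread => //; try lra.
    exact: smooth3_d1 fgh.
  by move=> /andP[ut tw]; apply: (dspread_le0 _ p01 hl lam0 fgh); lra.
rewrite le_eqVlt => /predU1P[vm|]; last exact: inner.
have [->//|uv'] := eqVneq u v.
have um : u < m by rewrite -vm lt_neqAle uv'.
rewrite vm.
have m0 : 0 < m by lra.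
apply: (cvgr_to_le (@spread_cvg_left p lam m f x lam0 m0 (smooth3_continuous fgh))).
near=> w; apply: inner.
  by near: w; exact: nbhs_left_ge.
by near: w; exact: nbhs_left_lt.
Unshelve. all: by end_near. Qed.

(** The new pair m, a + b - m has the same sum and is closer, so this is an instance
of spread_mono. *)
Lemma pair_to_mean p lam f g h a b m x : 0 < p < 1 -> lambda_star p <= lam ->
  0 < lam -> smooth3 f g h -> 0 <= b -> b <= m <= a ->
  bern_mean p [:: a `^ (2 * lam)^-1; b `^ (2 * lam)^-1] f x <=
  bern_mean p [:: m `^ (2 * lam)^-1; (a + b - m) `^ (2 * lam)^-1] f x.
Proof.
move=> p01 hl lam0 fgh b0 /andP[bm ma].
pose c := (a + b) / 2.
have -> : bern_mean p [:: a `^ (2 * lam)^-1; b `^ (2 * lam)^-1] f x =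
    spread p lam c f x ((a - b) / 2).
  by rewrite /spread (_ : c + (a - b) / 2 = a) 1?(_ : c - (a - b) / 2 = b)// /c; field.
have [cm|mc] := leP c m.
  have -> : bern_mean p [:: m `^ (2 * lam)^-1; (a + b - m) `^ (2 * lam)^-1] f x =
      spread p lam c f x (m - c).
    by rewrite /spread (_ : c + (m - c) = m) 1?(_ : c - (m - c) = a + b - m)// /c; field.
  by apply: (spread_mono x p01 hl lam0 fgh); rewrite /c in cm *; lra.
have -> : bern_mean p [:: m `^ (2 * lam)^-1; (a + b - m) `^ (2 * lam)^-1] f x =
    spread p lam c f x (c - m).
  rewrite (@bern_mean_perm p _ [:: (a + b - m) `^ (2 * lam)^-1; m `^ (2 * lam)^-1]).
    by rewrite /spread (_ : c + (c - m) = a + b - m) 1?(_ : c - (c - m) = m)// /c; field.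
  by rewrite -[[:: _; _]]/([:: _] ++ [:: _]) perm_catC.
by apply: (spread_mono x p01 hl lam0 fgh); rewrite /c in mc *; lra.
Qed.

Lemma exists_above (l : seq R) m : l != [::] -> {in l, forall s, s != m} ->
  \sum_(s <- l) s = (size l)%:R * m -> exists2 a, a \in l & m < a.
Proof.
move=> l0 lm sl; apply/hasP; apply/negPn/negP => /hasPn H.
suff : \sum_(s <- l) s < \sum_(s <- l) m.
  by rewrite sl big_const_seq count_predT iter_addr_0 mulr_natl ltxx.
rewrite big_seq [ltRHS]big_seq; apply: ltr_sum => [|s sl'].
  by case: l l0 {lm sl H} => // s l _; rewrite /= mem_head.
by rewrite lt_neqAle lm//= leNgt; exact: H.
Qed.

Lemma exists_below (l : seq R) m : l != [::] -> {in l, forall s, s != m} ->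
  \sum_(s <- l) s = (size l)%:R * m -> exists2 a, a \in l & a < m.
Proof.
move=> l0 lm sl; apply/hasP; apply/negPn/negP => /hasPn H.
suff : \sum_(s <- l) m < \sum_(s <- l) s.
  by rewrite sl big_const_seq count_predT iter_addr_0 mulr_natl ltxx.
rewrite big_seq [ltRHS]big_seq; apply: ltr_sum => [|s sl'].
  by case: l l0 {lm sl H} => // s l _; rewrite /= mem_head.
by rewrite lt_neqAle eq_sym lm//= leNgt; exact: H.
Qed.

(** If no weight equals the mean then one lies above and one below it; moving this
pair until one of the two reaches the mean leaves a shorter list with the same
mean. *)
Lemma equalize p lam f g h (l : seq R) m x : 0 < p < 1 -> lambda_star p <= lam ->
  0 < lam -> smooth3 f g h -> {in l, forall s, 0 <= s} ->
  \sum_(s <- l) s = (size l)%:R * m ->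
  bern_mean p [seq s `^ (2 * lam)^-1 | s <- l] f x <=
  bern_mean p (nseq (size l) (m `^ (2 * lam)^-1)) f x.
Proof.
move=> p01 hl lam0 fgh; have p01' : 0 <= p <= 1 by lra.
move En : (size l) => n; elim: n l En x => [|n IH] l ls x l0 lm.
  by move/size0nil : ls => ->.
have step s l' : perm_eq l (s :: l') -> s = m ->
    bern_mean p [seq s `^ (2 * lam)^-1 | s <- l] f x <=
    bern_mean p (nseq n.+1 (m `^ (2 * lam)^-1)) f x.
  move=> pl sm; rewrite (bern_mean_perm _ _ (perm_map _ pl))/= sm.
  apply: bern_step_le => // y; apply: IH.
  - by move: ls; rewrite (perm_size pl) => -[].
  - by move=> t tl'; apply: l0; rewrite (perm_mem pl) inE tl' orbT.
  - have := lm; rewrite (perm_big _ pl)/= big_cons sm.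
    by rewrite -natr1; lra.
have [/hasP[s sl /eqP sm]|/hasPn allne] := boolP (has (fun s => s == m) l).
  exact: (step s _ (perm_to_rem sl) sm).
have ln : l != [::] by rewrite -size_eq0 ls.
have lm' : \sum_(s <- l) s = (size l)%:R * m by rewrite ls.
have [a al am] := exists_above ln allne lm'.
have [b bl bm] := exists_below ln allne lm'.
pose l' := rem b (rem a l).
have pl : perm_eq l (a :: b :: l').
  rewrite (perm_trans (perm_to_rem al))// perm_cons perm_to_rem// rem_mem//.
  by rewrite lt_eqF// (lt_trans bm).
rewrite (bern_mean_perm _ _ (perm_map _ pl)).
rewrite (_ : map _ _ = [:: a `^ (2 * lam)^-1; b `^ (2 * lam)^-1] ++
  [seq s `^ (2 * lam)^-1 | s <- l'])// bern_mean_cat.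
have fgh' := smooth3_bern_mean [seq s `^ (2 * lam)^-1 | s <- l'] p01' fgh.
apply: le_trans (@pair_to_mean p lam _ _ _ a b m x p01 hl lam0 fgh' _ _) _.
- exact: l0.
- by rewrite !ltW.
rewrite -bern_mean_cat/=; apply: bern_step_le => // y.
rewrite -[bern_step _ _ _]/(bern_mean p [seq s `^ (2 * lam)^-1 | s <- (a + b - m) :: l'] f).
apply: IH.
- by have := perm_size pl; rewrite ls/= => -[->].
- move=> s; rewrite inE => /predU1P[->|sl']; first by have := l0 _ bl; lra.
  by apply: l0; rewrite (perm_mem pl) !inE sl' !orbT.
- have := lm; rewrite (perm_big _ pl)/= !big_cons -natr1; lra.
Qed.

End bernoulli_operator.

(** * Two-point comparison and the class of test functions *)

Section two_point.
Context {R : realType}.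
Implicit Types (f g h e : R -> R) (p x y s a b t : R).

(** The derivative h is convex and vanishes at s and, by Rolle, at a second point of
]s, b[. So e increases up to s, decreases and increases again up to b, where it
is 0. *)
Lemma tangent_below e h s b : s < b ->
  (forall x, is_derive x 1 e (h x)) -> convex3 h ->
  h s = 0 -> e s = 0 -> e b = 0 -> forall y, y <= b -> e y <= 0.
Proof.
move=> sb eh ch hs es eb y yb.
have [xi] : exists2 xi, s < xi < b & h xi = 0.
  have eh' x : x \in `]s, b[ -> is_derive x 1 e (h x) by [].
  have [xi] := MVT sb eh' (is_derive_within_continuous (fun x _ => eh x)).
  rewrite in_itv/= es eb subrr => xi_sb /esym/eqP; rewrite mulf_eq0 subr_eq0.
  by rewrite (gt_eqF sb) orbF => /eqP hxi; exists xi.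
move=> /andP[sxi xib] hxi.
have [ys|sy] := leP y s.
  rewrite -es; apply: (derive_ge0_le (g := h)) => // x /andP[_ xs].
  have := ch x s xi; rewrite (ltW xs) (ltW sxi) hs hxi !mulr0 addr0 => /(_ isT).
  by rewrite pmulr_rge0// subr_gt0.
have [yxi|xiy] := leP y xi.
  rewrite -es; apply: (derive_le0_ge (g := h)) => //; first exact: ltW.
  move=> x /andP[sx xy].
  have := ch s x xi; rewrite (ltW sx) (ltW (lt_le_trans xy yxi)) => /(_ isT).
  by rewrite hs hxi !mulr0 addr0 pmulr_rle0// subr_gt0.
rewrite -eb; apply: (derive_ge0_le (g := h)) => // x /andP[yx xb].
have xix : xi < x by exact: lt_trans yx.
have := ch s xi x; rewrite (ltW sxi) (ltW xix) => /(_ isT).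
by rewrite hs hxi !mulr0 add0r pmulr_rge0// subr_gt0.
Qed.

(** Let x - u and x + v be the two values of x + sqrt(a b) Z, and let Q be the
quadratic function tangent to f at x - u and equal to f at x + v. By
tangent_below, f <= Q up to x + v, and the hypothesis on b / a says b <= v. The
two-point law on x + b, x - a has the same mean and variance as x + sqrt(a b) Z,
hence the same average of Q, and on the latter law Q agrees with f. *)
Lemma two_point f g p a b x : 0 < p < 1 -> 0 < a -> 0 < b ->
  b * p <= (1 - p) * a -> (forall x, is_derive x 1 f (g x)) -> convex3 g ->
  a * f (x + b) + b * f (x - a) <= (a + b) * bern_step p (Num.sqrt (a * b)) f x.
Proof.
move=> /andP[p0 p1] a0 b0 ba fg cg.
pose r := Num.sqrt (p * (1 - p)).
have pq0 : 0 < p * (1 - p) by rewrite mulr_gt0//; lra.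
have r0 : 0 < r by rewrite sqrtr_gt0.
have r2 : r ^+ 2 = p * (1 - p) by rewrite sqr_sqrtr// ltW.
pose s := Num.sqrt (a * b).
have s0 : 0 < s by rewrite sqrtr_gt0 mulr_gt0.
have s2 : s ^+ 2 = a * b by rewrite sqr_sqrtr// mulr_ge0// ltW.
pose u := s * p / r; pose v := s * (1 - p) / r.
have u0 : 0 < u by rewrite divr_gt0// mulr_gt0.
have v0 : 0 < v by rewrite divr_gt0// mulr_gt0//; lra.
have uv : u * v = a * b.
  have -> : u * v = s ^+ 2 * (p * (1 - p)) / r ^+ 2.
    by rewrite /u /v; field; rewrite gt_eqF.
  by rewrite s2 r2 mulfK// gt_eqF.
have puv : p * v = (1 - p) * u by rewrite /u /v; ring.
have bv : b <= v.
  rewrite -(@ler_pXn2r _ 2)// ?nnegrE ?(ltW b0) ?(ltW v0)//.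
  have : p * v ^+ 2 = (1 - p) * (a * b).
    by rewrite -uv expr2 mulrA puv; ring.
  have : b * (b * p) <= b * ((1 - p) * a) by rewrite ler_wpM2l// ltW.
  by move=> H1 H2; rewrite -(ler_pM2l p0) H2; lra.
pose c0 := f (x - u); pose c1 := g (x - u).
pose c2 := (f (x + v) - c0 - c1 * (u + v)) / (u + v) ^+ 2.
pose e y := f (x + 1 * y) - (c0 + c1 * (y + u) + c2 * (y + u) ^+ 2).
pose h y := g (x + 1 * y) * 1 - (c1 + c2 * (2 * (y + u))).
have uvp : u + v != 0 by rewrite gt_eqF// addr_gt0.
have eh y : is_derive y 1 e (h y).
  apply: is_deriveB; first exact: is_derive_affine.
  have d1 : is_derive y 1 (fun y => y + u) 1 by exact: is_derive_shift.
  have d2 : is_derive y 1 (fun y => (y + u) ^+ 2) (2 * (y + u)).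
    by have := is_derive_expn_shift 1 u y; rewrite expr1.
  have D := is_deriveD (is_deriveD (is_derive_cst c0 y (1 : R)) (is_deriveZ c1 d1)) (is_deriveZ c2 d2).
  apply: (is_derive_eq D).
  by rewrite /GRing.scale/= mulr1 add0r.
have ch : convex3 h.
  move=> y1 y2 y3 y123; have := cg (x + 1 * y1) (x + 1 * y2) (x + 1 * y3).
  rewrite !mul1r !lerD2l => /(_ y123); rewrite /h !mul1r; lra.
have e_le0 y : y <= v -> e y <= 0.
  apply: (@tangent_below e h (- u)) => //.
  - lra.
  - by rewrite /h mul1r /c1 addNr; ring.
  - by rewrite /e mul1r /c0 addNr; ring.
  - by rewrite /e mul1r /c2 [v + u]addrC; field.
have zT : s * zval p true = v by rewrite zvalT /v mulrA.
have zF : s * zval p false = - u by rewrite zvalF /u mulNr mulrN mulrA.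
rewrite /bern_step -/s zT zF.
have ev : f (x + v) = c0 + c1 * (v + u) + c2 * (v + u) ^+ 2.
  by rewrite /c2 [v + u]addrC; field.
have Eb := e_le0 b bv.
have Ea : e (- a) <= 0 by apply: e_le0; lra.
rewrite /e mul1r in Eb; rewrite /e mul1r in Ea.
have Eb' := ler_wpM2l (ltW a0) Eb; have Ea' := ler_wpM2l (ltW b0) Ea.
rewrite ev -/c0.
have mom : p * (c0 + c1 * (v + u) + c2 * (v + u) ^+ 2) + (1 - p) * c0 =
    c0 + c1 * u + c2 * (a * b + u ^+ 2).
  rewrite -uv.
  have -> : p * (c0 + c1 * (v + u) + c2 * (v + u) ^+ 2) + (1 - p) * c0 =
    c0 + c1 * (p * v + p * u) + c2 * (p * v * v + 2 * u * (p * v) + p * u ^+ 2) by ring.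
  have pu : p * u = u - p * v by rewrite puv; ring.
  have -> : p * u ^+ 2 = u * (p * u) by ring.
  have pvv : p * v * v = u * v - p * v * u by rewrite {1}puv; ring.
  by rewrite pu pvv; ring.
rewrite mom; lra.
Qed.

End two_point.

Section Hplus_three.
Context {R : realType}.
Implicit Types (f g h : R -> R) (t x y : R).

Lemma convex_function_convex3 h :
  convex_function ([set: R] : set (convex_lmodType R^o)) h -> convex3 h.
Proof.
move=> ch x y z /andP[xy yz].
have [xz|xz] := eqVneq x z.
  have -> : y = x by apply/eqP; rewrite eq_le xy xz yz.
  by rewrite xz; lra.
have zx : 0 < z - x by rewrite subr_gt0 lt_neqAle xz (le_trans xy).
have t01 : 0 <= (z - y) / (z - x) <= 1.
  by rewrite divr_ge0 ?(ltW zx) ?subr_ge0//= ler_pdivrMr// mul1r; lra.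
have /andP[t0 t1] := t01.
have xT (w : convex_lmodType R^o) : w \in [set: convex_lmodType R^o].
  by rewrite inE.
have H : h ((z - y) / (z - x) * x + (1 - (z - y) / (z - x)) * z) <=
    (z - y) / (z - x) * h x + (1 - (z - y) / (z - x)) * h z.
  exact: (ch (Itv01 t0 t1) x z (xT x) (xT z)).
move: H; have -> : (z - y) / (z - x) * x + (1 - (z - y) / (z - x)) * z = y.
  by field; rewrite gt_eqF.
move=> /(ler_wpM2l (ltW zx)).
have -> // : (z - x) * ((z - y) / (z - x) * h x + (1 - (z - y) / (z - x)) * h z)
   = (z - y) * h x + (y - x) * h z.
by field; rewrite gt_eqF.
Qed.

Lemma convex3_convex_function h : convex3 h ->
  convex_function ([set: R] : set (convex_lmodType R^o)) h.
Proof.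
move=> ch t x y _ _.
suff H (s : R) : 0 <= s -> s <= 1 -> forall x y : R,
    h (s * x + (1 - s) * y) <= s * h x + (1 - s) * h y.
  exact: (H t%:num).
move=> s0 s1 {}x {}y; wlog xy : x y s s0 s1 / x <= y.
  move=> W; have [|yx] := leP x y; first exact: W.
  have := W y x (1 - s); rewrite subr_ge0 (ltW yx) s1 gerBl s0.
  move=> /(_ isT isT isT); rewrite subKr addrC [X in _ <= X]addrC; exact.
have [->|xy'] := eqVneq x y; first by rewrite -!mulrDl subrKC !mul1r.
have yx0 : 0 < y - x by rewrite subr_gt0 lt_neqAle xy'.
have B : x <= s * x + (1 - s) * y <= y by nra.
have H := ch _ _ _ B.
by rewrite -(ler_pM2l yx0); lra.
Qed.

Lemma nondecreasing_cvg0_ge0 g : {homo g : x y / x <= y} ->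
  g x @[x --> -oo] --> (0 : R) -> forall x, 0 <= g x.
Proof.
move=> mg /cvgr0Pnorm_lt g0 x; rewrite leNgt; apply/negP => gx.
have /g0 [M [Mr HM]] : 0 < - g x by rewrite oppr_gt0.
have := HM (Num.min (M - 1) x); rewrite gt_min ltrBlDr ltrDl ltr01 => /(_ isT).
have gm : g (Num.min (M - 1) x) <= g x by apply: mg; rewrite ge_min lexx orbT.
by rewrite ltr0_norm ?(le_lt_trans gm)// ltrN2 ltNge gm.
Qed.

(** If h y > h z for some y < z, convexity makes h at least linear in the distance
to the left of y, which contradicts the limit 0. *)
Lemma convex3_cvg0_nondecreasing h : convex3 h ->
  h x @[x --> -oo] --> (0 : R) -> {homo h : x y / x <= y}.
Proof.
move=> ch /cvgr0Pnorm_lt /(_ _ ltr01) [M [Mr HM]] y z yz.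
rewrite leNgt; apply/negP => hyz.
pose K := (z - y) * (1 + `|h z|) / (h y - h z).
pose x := Num.min (Num.min (M - 1) (y - K - 1)) y.
have xy : x <= y by rewrite ge_min lexx orbT.
have hx : h x <= 1.
  have := HM x; rewrite !gt_min ltrBlDr ltrDl ltr01 => /(_ isT).
  by move=> /ltW; apply: le_trans; exact: ler_norm.
have xK : x <= y - K - 1 by rewrite !ge_min lexx orbT.
have hyz0 : 0 < h y - h z by rewrite subr_gt0.
have := ch x y z; rewrite xy yz => /(_ isT).
have KE : K * (h y - h z) = (z - y) * (1 + `|h z|) by rewrite /K divfK// gt_eqF.
have : (K + 1) * (h y - h z) <= (y - x) * (h y - h z) by rewrite ler_wpM2r ?(ltW hyz0)//; lra.
have : (z - y) * h x <= (z - y) * 1 by rewrite ler_wpM2l//; lra.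
have : (z - y) * (- h y) <= (z - y) * `|h z|.
  rewrite ler_wpM2l//; first lra.
  have : - h z <= `|h z| by rewrite -normrN ler_norm.
  lra.
lra.
Qed.

(** A nondecreasing function with limit 0 at -oo is nonnegative, and so the signs
pass from the second derivative down to f. *)
Lemma Hplus_smooth3 f : Hplus 3 f ->
  smooth3 f (derive1n 1 f) (derive1n 2 f) /\ (forall x, 0 <= f x).
Proof.
move=> [df cf lf].
have d1 x : is_derive x 1 f (derive1n 1 f x).
  by rewrite derive1n1 derive1E; apply: derivableP; exact: (df 0%N).
have d2 x : is_derive x 1 (derive1n 1 f) (derive1n 2 f x).
  by rewrite (derive1nS f 1) derive1E; apply: derivableP; exact: (df 1%N).
have c2 := convex_function_convex3 cf.
have m2 := convex3_cvg0_nondecreasing c2 (lf 2%N isT).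
have p2 := nondecreasing_cvg0_ge0 m2 (lf 2%N isT).
have m1 : {homo derive1n 1 f : x y / x <= y}.
  by move=> x y xy; apply: (derive_ge0_le (g := derive1n 2 f)).
have p1 := nondecreasing_cvg0_ge0 m1 (lf 1%N isT).
have m0 : {homo f : x y / x <= y}.
  by move=> x y xy; apply: (derive_ge0_le (g := derive1n 1 f)).
split; first by split.
exact: nondecreasing_cvg0_ge0 m0 (lf 0%N isT).
Qed.

Lemma convex3_ppart t : convex3 (ppart t).
Proof.
move=> x y z /andP[xy yz].
have x0 := ppart_ge0 t x; have z0 := ppart_ge0 t z.
have xt : x - t <= ppart t x by rewrite le_max lexx.
have zt : z - t <= ppart t z by rewrite le_max lexx.
have [yt|ty] := leP y t.
  by rewrite (ppart0 yt) mulr0 addr_ge0// mulr_ge0//; lra.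
rewrite (ppartE (ltW ty)).
have : (z - y) * (x - t) <= (z - y) * ppart t x by rewrite ler_wpM2l//; lra.
have : (y - x) * (z - t) <= (y - x) * ppart t z by rewrite ler_wpM2l//; lra.
lra.
Qed.

Lemma derive1_ppart n t : derive1 (fun y => ppart t y ^+ n.+2) =
  (fun y => n.+2%:R * ppart t y ^+ n.+1).
Proof.
by apply/funext => x; rewrite derive1E; case: (is_derive_ppart n t x).
Qed.

(** These are the test functions for the tail bound. *)
Lemma Hplus_ppart t : Hplus 3 (fun x => ppart t x ^+ 3).
Proof.
have E1 : derive1n 1 (fun x => ppart t x ^+ 3) = (fun x => 3 * ppart t x ^+ 2).
  by rewrite derive1n1 derive1_ppart.
have D2 x : is_derive x 1 (fun x => 3 * ppart t x ^+ 2) (6 * ppart t x).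
  apply: (is_derive_eq (is_deriveZ 3 (is_derive_ppart 0 t x))).
  by rewrite /GRing.scale/= expr1; ring.
have E2 : derive1n 2 (fun x => ppart t x ^+ 3) = (fun x => 6 * ppart t x).
  by rewrite derive1nS E1; apply/funext => x; rewrite derive1E; case: (D2 x).
split.
- move=> [|[|//]] x _; first by case: (is_derive_ppart 1 t x).
  by rewrite E1; case: (D2 x).
- rewrite E2; apply: convex3_convex_function => x y z xyz.
  by have := convex3_ppart t xyz; lra.
- move=> j j3; apply: (@cvg_trans _ ((fun=> 0) @ -oo%R)); last exact: cvg_cst.
  apply: near_eq_cvg; near=> x.
  have xt : x <= t by near: x; apply: nbhs_ninfty_le; exact: num_real.
  move: j j3 => [|[|[|//]]] _; rewrite ?E1 ?E2 ?ppart0 ?expr0n ?mulr0//.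
  by rewrite derive1n0 ppart0// expr0n.
Unshelve. all: by end_near. Qed.

End Hplus_three.

(** * From truncated third moments to tails *)

Section finite_laws.
Context {R : realType}.
Implicit Types (L : seq (R * R)) (F g : R -> R) (k t x a b u s A : R).

Definition atoms_mean L F := \sum_(wu <- L) wu.1 * F wu.2.

Definition indic_ge u : R -> R := fun y => (u <= y)%R%:R.

Definition atoms_tail L u := atoms_mean L (indic_ge u).

(** The law of a weighted sum of Bernoulli variables as a list of pairs (mass,
position). The tail argument sums over the atoms. *)
Fixpoint bern_atoms p (l : seq R) x : seq (R * R) :=
  if l is s :: l' then
    [seq (p * wu.1, wu.2) | wu <- bern_atoms p l' (x + s * zval p true)] ++
    [seq ((1 - p) * wu.1, wu.2) | wu <- bern_atoms p l' (x + s * zval p false)]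
  else [:: (1, x)].

Lemma bern_atomsE p l F x : bern_mean p l F x = atoms_mean (bern_atoms p l x) F.
Proof.
elim: l x => [|s l IH] x; first by rewrite /atoms_mean/= big_seq1 mul1r.
rewrite /atoms_mean /= big_cat !big_map /= /bern_step !IH /atoms_mean !mulr_sumr.
by congr (_ + _); apply: eq_bigr => wu _; rewrite mulrA.
Qed.

Lemma bern_atoms_gt0 p l x wu : 0 < p < 1 -> wu \in bern_atoms p l x -> 0 < wu.1.
Proof.
move=> p01; elim: l x wu => [|s l IH] x wu /=; first by rewrite inE => /eqP ->.
by rewrite mem_cat => /orP[] /mapP[v /IH v0 ->] /=; rewrite mulr_gt0//; lra.
Qed.

Lemma bern_atoms_mass p l x : atoms_mean (bern_atoms p l x) (fun=> 1) = 1.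
Proof.
by rewrite -bern_atomsE; elim: l x => //= s l IH x; rewrite /bern_step !IH; ring.
Qed.

(** The primitive of 3 (s - t)^2 exp (- k s) that vanishes at +oo. *)
Let Psi k t s : R := - (expR (- k * s) *
  (3 / k * (s - t) ^+ 2 + 6 / k ^+ 2 * (s - t) + 6 / k ^+ 3)).

Lemma is_derive_Psi k t s : k != 0 ->
  is_derive s 1 (Psi k t) (expR (- k * s) * (3 * (s - t) ^+ 2)).
Proof.
move=> k0.
have d1 : is_derive s 1 (fun y => y - t) 1 by exact: is_derive_shift.
have d2 : is_derive s 1 (fun y => (y - t) ^+ 2) (2 * (s - t)).
  by have := is_derive_expn_shift 1 (- t) s; rewrite expr1.
have de : is_derive s 1 (fun y => expR (- k * y)) (expR (- k * s) * - k).
  have H : is_derive (0 + - k * s) 1 (@expR R) (expR (0 + - k * s)).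
    exact: is_derive_expR.
  have := is_derive_affine H.
  by under eq_fun do rewrite add0r; rewrite add0r.
have D := is_deriveN (is_deriveM de (is_deriveD (is_deriveD (is_deriveZ (3 / k) d2)
   (is_deriveZ (6 / k ^+ 2) d1)) (is_derive_cst (6 / k ^+ 3) s (1 : R)))).
apply: (is_derive_eq D).
rewrite [X in _ + X *: _](_ : _ = 3 / k * (s - t) ^+ 2 +
   6 / k ^+ 2 * (s - t) + 6 / k ^+ 3)// /GRing.scale/=.
by field.
Qed.

Lemma Psi_incr k t a b : 0 < k -> t <= a -> a <= b ->
  expR (- k * b) * ((b - t) ^+ 3 - (a - t) ^+ 3) <= Psi k t b - Psi k t a.
Proof.
move=> k0 ta ab; have kn0 : k != 0 by rewrite gt_eqF.
pose D s := Psi k t s - expR (- k * b) * (s - t) ^+ 3.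
have dD s : is_derive s 1 D (expR (- k * s) * (3 * (s - t) ^+ 2) -
    expR (- k * b) * (3 * (s - t) ^+ 2)).
  apply: is_deriveB; first exact: is_derive_Psi.
  apply: is_deriveZ.
  exact: is_derive_expn_shift 2 (- t) s.
suff : D a <= D b by rewrite /D; lra.
apply: (derive_ge0_le (g := fun s => expR (- k * s) * (3 * (s - t) ^+ 2) -
    expR (- k * b) * (3 * (s - t) ^+ 2))) => // s /andP[_ sb].
rewrite -mulrBl; apply: mulr_ge0; last by rewrite mulr_ge0 ?sqr_ge0.
by rewrite subr_ge0 ler_expR !mulNr lerN2 ler_pM2l// ltW.
Qed.

Lemma Psi_le0 k t s : 0 < k -> t <= s -> Psi k t s <= 0.
Proof.
move=> k0 ts; rewrite oppr_le0 mulr_ge0 ?expR_ge0//.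
by rewrite !addr_ge0// !(sqr_ge0, exprn_ge0, invr_ge0, mulr_ge0)//; lra.
Qed.

(** Summation by parts against Psi: the bound on the tail at an atom controls all the
mass from this atom on. *)
Lemma sorted_moment L k t a A : 0 < k -> t <= a -> 0 <= A ->
  path (fun x y => x <= y) a [seq wu.2 | wu <- L] ->
  {in L, forall wu, 0 < wu.1} ->
  {in L, forall wu, atoms_tail L wu.2 <= A * expR (- k * wu.2)} ->
  \sum_(wu <- L) wu.1 * ((wu.2 - t) ^+ 3 - (a - t) ^+ 3) <= - A * Psi k t a.
Proof.
move=> k0 + A0; elim: L a => [|[w u] L IH] a ta.
  by move=> _ _ _; rewrite big_nil mulNr oppr_ge0 mulr_ge0_le0// Psi_le0.
move=> /= /andP[au pL] L0 tL.
have tu : t <= u by exact: le_trans au.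
have uL wu : wu \in L -> u <= wu.2.
  move=> wuL; have := order_path_min (@le_trans _ R) pL.
  by move=> /allP; apply; apply: map_f.
have w0 : 0 < w by apply: (L0 (w, u)); rewrite mem_head.
have IHu : \sum_(wu <- L) wu.1 * ((wu.2 - t) ^+ 3 - (u - t) ^+ 3) <= - A * Psi k t u.
  apply: IH => //.
    by move=> wu wuL; apply: L0; rewrite inE wuL orbT.
  move=> wu wuL; apply: le_trans (tL _ _); last by rewrite inE wuL orbT.
  rewrite /atoms_tail /atoms_mean big_cons lerDr mulr_ge0 ?ler0n//.
  exact: ltW.
have mass : w + \sum_(wu <- L) wu.1 <= A * expR (- k * u).
  apply: le_trans (tL (w, u) _); last by rewrite mem_head.
  rewrite /atoms_tail /atoms_mean big_cons /indic_ge /= lexx mulr1 lerD2l.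
  rewrite big_seq [leRHS]big_seq ler_sum// => wu wuL.
  by rewrite uL// mulr1.
have split3 : \sum_(wu <- L) wu.1 * ((wu.2 - t) ^+ 3 - (a - t) ^+ 3) =
    \sum_(wu <- L) wu.1 * ((wu.2 - t) ^+ 3 - (u - t) ^+ 3) +
    (\sum_(wu <- L) wu.1) * ((u - t) ^+ 3 - (a - t) ^+ 3).
  rewrite mulr_suml -big_split/=; apply: eq_bigr => wu _; ring.
rewrite big_cons split3 /=.
have c0 : 0 <= (u - t) ^+ 3 - (a - t) ^+ 3.
  by rewrite subr_ge0 lerXn2r// ?nnegrE; lra.
have H1 := ler_wpM2r c0 mass.
have H2 := ler_wpM2l A0 (Psi_incr k0 ta au).
lra.
Qed.

(** A tail below that of the exponential density with rate k has at most its
truncated third moment, which is 6 / k^3 times the value of the bound at t. *)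
Lemma moment_le L k t A : 0 < k -> 0 <= A -> {in L, forall wu, 0 < wu.1} ->
  {in L, forall wu, atoms_tail L wu.2 <= A * expR (- k * wu.2)} ->
  atoms_mean L (fun u => ppart t u ^+ 3) <= A * expR (- k * t) * (6 / k ^+ 3).
Proof.
move=> k0 A0 L0 tL.
pose r (x y : R * R) := x.2 <= y.2.
pose L' := sort r [seq wu <- L | t < wu.2].
have memL' wu : (wu \in L') = (t < wu.2) && (wu \in L).
  by rewrite mem_sort mem_filter.
have -> : atoms_mean L (fun u => ppart t u ^+ 3) =
    \sum_(wu <- L') wu.1 * ((wu.2 - t) ^+ 3 - (t - t) ^+ 3).
  rewrite (perm_big [seq wu <- L | t < wu.2]) ?perm_sort//= big_filter.
  rewrite /atoms_mean [RHS]big_mkcond; apply: eq_bigr => wu _.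
  case: ltP => [tu|ut]; first by rewrite (ppartE (ltW tu)) subrr expr0n/= subr0.
  by rewrite (ppart0 ut) expr0n/= mulr0.
apply: le_trans (@sorted_moment L' k t t A k0 (lexx t) A0 _ _ _) _.
- have st : sorted r L' by apply: sort_sorted => x y; exact: le_total.
  have : all (fun wu => t <= wu.2) L'.
    by apply/allP => wu; rewrite memL' => /andP[/ltW].
  case: L' st {memL'} => //= v l vl /andP[-> _].
  by rewrite path_map.
- by move=> wu; rewrite memL' => /andP[_ /L0].
- move=> wu; rewrite memL' => /andP[twu wuL]; apply: le_trans (tL _ wuL).
  rewrite /atoms_tail /atoms_mean (perm_big [seq wu <- L | t < wu.2]) ?perm_sort//=.
  rewrite big_filter big_mkcond/= big_seq [leRHS]big_seq ler_sum// => v vL.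
  case: ifPn => // _; rewrite mulr_ge0 ?ler0n//.
  by rewrite ltW// L0.
rewrite /Psi subrr expr0n/= !mulr0 !add0r mulrNN mulrA//.
Qed.

Lemma max_seq (S : seq R) : exists k,
  [/\ 0 <= k, {in S, forall s, s <= k} & k = 0 \/ k \in S].
Proof.
elim: S => [|s S [k [k0 kS kk]]]; first by exists 0; split => //; left.
exists (Num.max s k); split.
- by rewrite le_max k0 orbT.
- move=> v; rewrite inE => /predU1P[->|/kS vk]; first by rewrite le_max lexx.
  by rewrite le_max vk orbT.
have [sk|ks] := leP s k; last by right; rewrite mem_head.
by case: kk => [->|kS']; [left|right; rewrite inE kS' orbT].
Qed.

(** On the logarithmic scale, the steepest line through (x, ln g x) that is needed to
stay above the tail at the atoms to the left of x also stays above it at the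
atoms to the right, because g is log-concave. With k its slope, moment_le and
t = x - 3 / k give P (3 / k)^3 <= 6 e^3 g x / k^3. The cases g x = 0 and k = 0
are degenerate: then no atom lies at or beyond x, respectively g x >= 1. *)
Lemma tail_le_lc L (P x : R) (g : R -> R) :
  {in L, forall wu, 0 < wu.1} -> atoms_mean L (fun=> 1) = 1 ->
  log_concave_majorants (atoms_tail L) g -> P <= 1 ->
  (forall t, t < x -> P * (x - t) ^+ 3 <= atoms_mean L (fun u => ppart t u ^+ 3)) ->
  P <= c30 R * g x.
Proof.
move=> L0 L1 [[g0 glc] gq] P1 HP.
have tail_ge wu u : wu \in L -> u <= wu.2 -> wu.1 <= atoms_tail L u.
  move=> wuL uwu; rewrite /atoms_tail /atoms_mean (big_rem _ wuL)/= /indic_ge.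
  rewrite uwu mulr1 lerDl big_seq sumr_ge0// => v /mem_rem vL.
  by rewrite mulr_ge0 ?ler0n// ltW// L0.
have tail_gt0 wu : wu \in L -> 0 < atoms_tail L wu.2.
  by move=> wuL; rewrite (lt_le_trans (L0 _ wuL))// tail_ge.
have tail_mono u v : u <= v -> atoms_tail L v <= atoms_tail L u.
  move=> uv; rewrite /atoms_tail /atoms_mean big_seq [leRHS]big_seq.
  apply: ler_sum => wu wuL; rewrite ler_wpM2l ?(ltW (L0 _ wuL))// /indic_ge.
  by case: (leP v) => // vw; rewrite (le_trans uv vw).
have [gx0|] := eqVneq (g x) 0.
  rewrite gx0 mulr0.
  have Lx : {in L, forall wu, wu.2 < x}.
    move=> wu wuL; rewrite ltNge; apply/negP => xwu.
    have := lt_le_trans (L0 _ wuL) (tail_ge _ x wuL xwu).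
    by rewrite ltNge -gx0 gq.
  have [t tx Lt] : exists2 t, t < x & {in L, forall wu, wu.2 <= t}.
    have [k [k0 kS kk]] := max_seq [seq wu.2 - (x - 1) | wu <- L].
    exists (x - 1 + k).
      case: kk => [->|/mapP[wu /Lx wux ->]]; lra.
    move=> wu wuL; rewrite -lerBlDl; apply: kS.
    by apply/mapP; exists wu.
  have := HP t tx.
  rewrite /atoms_mean big_seq big1 ?pmulr_lle0//.
    by rewrite exprn_gt0// subr_gt0.
  by move=> wu wuL; rewrite ppart0 ?Lt// expr0n mulr0.
move=> gn0; have gx0 : 0 < g x by rewrite lt_neqAle eq_sym gn0 g0.
(* the slope needed at one atom; k is the largest of them *)
pose slope (wu : R * R) := (ln (atoms_tail L wu.2) - ln (g x)) / (x - wu.2).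
have [k [k0 kS kk]] := max_seq [seq slope wu | wu <- L & wu.2 < x].
have bound wu : wu \in L -> ln (atoms_tail L wu.2) <= ln (g x) + k * (x - wu.2).
  move=> wuL; case: (ltgtP wu.2 x) => [wx|xw|wx].
  - have xw0 : 0 < x - wu.2 by rewrite subr_gt0.
    have : slope wu <= k by apply: kS; apply: map_f; rewrite mem_filter wx.
    by rewrite ler_pdivrMr//; lra.
  - case: kk => [->|/mapP[v]].
      rewrite mul0r addr0 ler_ln ?posrE// ?tail_gt0//.
      by apply: le_trans (gq x); apply: tail_mono; exact: ltW.
    rewrite mem_filter => /andP[vx vL] kE.
    have vw : 0 < wu.2 - v.2 by rewrite subr_gt0 (lt_trans vx).
    pose s := (wu.2 - x) / (wu.2 - v.2).
    have s01 : 0 < s < 1.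
      by rewrite divr_gt0 /s /= ?vw ?subr_gt0// ltr_pdivrMr// mul1r ltrD2l ltrN2.
    have := glc v.2 wu.2 s s01.
    have -> : s * v.2 + (1 - s) * wu.2 = x by rewrite /s; field; rewrite gt_eqF.
    have gv : 0 < g v.2 by rewrite (lt_le_trans (tail_gt0 _ vL)).
    have gw : 0 < g wu.2 by rewrite (lt_le_trans (tail_gt0 _ wuL)).
    rewrite -ler_ln ?posrE ?mulr_gt0 ?powR_gt0// lnM ?posrE ?powR_gt0// !ln_powR.
    have lv : ln (atoms_tail L v.2) <= ln (g v.2) by rewrite ler_ln ?posrE ?tail_gt0.
    have lw : ln (atoms_tail L wu.2) <= ln (g wu.2) by rewrite ler_ln ?posrE ?tail_gt0.
    have s0 : 0 <= s by lra.
    have s1 : 0 <= 1 - s by lra.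
    have := ler_wpM2l s0 lv; have := ler_wpM2l s1 lw.
    move=> A1 A2 A3.
    have A4 : s * ln (atoms_tail L v.2) + (1 - s) * ln (atoms_tail L wu.2) <= ln (g x).
      lra.
    have := ler_wpM2l (ltW vw) A4.
    have -> : (wu.2 - v.2) * (s * ln (atoms_tail L v.2) + (1 - s) * ln (atoms_tail L wu.2))
      = (wu.2 - x) * ln (atoms_tail L v.2) + (x - v.2) * ln (atoms_tail L wu.2).
      by rewrite /s; field; rewrite gt_eqF.
    have xv : 0 < x - v.2 by rewrite subr_gt0.
    move=> A5; rewrite -(ler_pM2l xv).
    have -> : (x - v.2) * (ln (g x) + k * (x - wu.2)) =
      (x - v.2) * ln (g x) + (ln (atoms_tail L v.2) - ln (g x)) * (x - wu.2).
      by rewrite kE /slope; field; rewrite gt_eqF.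
    lra.
  - by rewrite -wx subrr mulr0 addr0 ler_ln ?posrE ?tail_gt0// wx.
have e3 : (2 : R) <= expR 1 by have := expR_ge1Dx (1 : R); lra.
(* slope 0: the lowest atom, whose tail is 1, forces 1 <= g x *)
have [k00|kn0] := eqVneq k 0.
  have Lne : L != [::].
    by apply/eqP => L00; move: L1; rewrite L00 /atoms_mean big_nil => /eqP; rewrite eq_sym oner_eq0.
  have [u uL umin] : exists2 u, u \in L & {in L, forall v, u.2 <= v.2}.
    have := Lne; case EL : L => [//|v0 l0] _.
    have v0L : v0 \in L by rewrite EL mem_head.
    have st : sorted (fun x y : R * R => x.2 <= y.2) (sort (fun x y : R * R => x.2 <= y.2) L).
      by apply: sort_sorted => v w; exact: le_total.
    case ES : (sort (fun x y : R * R => x.2 <= y.2) L) st => [|u S] st.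
      by move: v0L; rewrite -(mem_sort (fun x y : R * R => x.2 <= y.2)) ES.
    exists u; first by rewrite -EL -(mem_sort (fun x y : R * R => x.2 <= y.2)) ES mem_head.
    move=> v; rewrite -EL -(mem_sort (fun x y : R * R => x.2 <= y.2)) ES inE.
    move=> /predU1P[->//|vS].
    have tr : transitive (fun x y : R * R => x.2 <= y.2).
      by move=> a b c; exact: le_trans.
    by have /allP := order_path_min tr st; apply.
  have tu : atoms_tail L u.2 = 1.
    rewrite -L1 /atoms_tail /atoms_mean big_seq [RHS]big_seq.
    by apply: eq_bigr => v vL; rewrite /indic_ge umin.
  have := bound u uL; rewrite tu ln1 k00 mul0r addr0 -ln1 ler_ln ?posrE// => g1.
  apply: le_trans P1 _.
  rewrite /c30 -mulrA; have : 2 ^+ 3 <= expR 1 ^+ 3 :> R by rewrite lerXn2r ?nnegrE ?expR_ge0.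
  move=> E.
  apply: le_trans (_ : 2 * expR 1 ^+ 3 / 9 * 1 <= _); first lra.
  rewrite mulrA ler_wpM2l//; lra.
have kp : 0 < k by rewrite lt_neqAle eq_sym kn0.
have Hm := @moment_le L k (x - 3 / k) (g x * expR (k * x)) kp
   (mulr_ge0 (ltW gx0) (expR_ge0 _)) L0.
have {}Hm := Hm _.
have E3 : g x * expR (k * x) * expR (- k * (x - 3 / k)) = g x * expR 1 ^+ 3.
  rewrite -mulrA -expRD; congr (_ * _).
  have -> : k * x + - k * (x - 3 / k) = 3%:R * 1 by field.
  by rewrite expRM_natl.
rewrite E3 in Hm.
have : P * (x - (x - 3 / k)) ^+ 3 <= g x * expR 1 ^+ 3 * (6 / k ^+ 3).
  apply: le_trans (HP _ _) (Hm _); first by rewrite ltrBlDr ltrDl divr_gt0.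
  move=> wu wuL; rewrite -mulrA -expRD -ler_ln ?posrE ?tail_gt0 ?mulr_gt0 ?expR_gt0//.
  rewrite lnM ?posrE ?expR_gt0// expRK.
  by have := bound wu wuL; lra.
have k3 : 0 < k ^+ 3 by rewrite exprn_gt0.
move=> H9; have {H9} := ler_wpM2r (ltW k3) H9.
have -> : P * (x - (x - 3 / k)) ^+ 3 * k ^+ 3 = 27 * P by field.
have -> : g x * expR 1 ^+ 3 * (6 / k ^+ 3) * k ^+ 3 = 6 * (g x * expR 1 ^+ 3) by field.
rewrite /c30; lra.
Qed.

End finite_laws.

(** * Independence of disjoint blocks *)

Section blocks.
Context d (T : measurableType d) (R : realType) (P : probability T R).
Context (I : finType) (V : I -> {mfun T >-> R}).
Implicit Types (J : {set I}) (A : I -> set R) (E F : set T).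

Definition independent_coords := forall A, (forall i, measurable (A i)) ->
  P (\bigcap_i (V i @^-1` A i)) = (\prod_i P (V i @^-1` A i))%E.

(** Sets that depend on one coordinate of the block; they generate the events of the
block. *)
Definition block_gen J : set (set T) :=
  \bigcup_(i in [set` J]) preimage_set_system [set: T] (V i) measurable.

Definition boxes J : set (set T) :=
  [set \bigcap_(i in [set` J]) (V i @^-1` A i) |
    A in [set A | forall i, measurable (A i)]].

Lemma boxes_measurable J : boxes J `<=` measurable.
Proof.
move=> _ [A mA <-]; apply: fin_bigcap_measurable; first exact: finite_finset.
by move=> i _; rewrite -[X in measurable X]setTI; exact: measurable_funP.
Qed.

Lemma boxes_setI J : setI_closed (boxes J).
Proof.
move=> _ _ [A mA <-] [B mB <-]; exists (fun i => A i `&` B i).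
  by move=> i; apply: measurableI.
by rewrite -bigcapI; apply: eq_bigcapr => i _; rewrite preimage_setI.
Qed.

Lemma boxesT J : boxes J setT.
Proof.
exists (fun=> setT) => //.
by apply/seteqP; split => // w _ i _.
Qed.

Lemma block_sub_boxes J : <<s block_gen J >> `<=` <<s boxes J >>.
Proof.
apply: smallest_sub; first exact: smallest_sigma_algebra.
move=> _ [i iJ [B mB <-]]; apply: sub_sigma_algebra.
exists (fun j => if j == i then B else setT); first by move=> j; case: ifP.
apply/seteqP; split => [w/= /(_ i iJ)|w/= [_ wB] j jJ].
  by rewrite /= eqxx; split.
by rewrite /=; case: eqP => // ->.
Qed.

Let factor E F := P (E `&` F) = (P E * P F)%E.

Lemma boxes_independent J1 J2 E F : independent_coords -> (forall i, i \in J1 -> i \notin J2) ->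
  boxes J1 E -> boxes J2 F -> factor E F.
Proof.
move=> indep dis [A mA <-] [B mB <-].
pose ext J (D : I -> set R) i := if i \in J then D i else setT.
have extE J D : \bigcap_(i in [set` J]) (V i @^-1` D i) =
    \bigcap_i (V i @^-1` ext J D i).
  apply/seteqP; split => w H i; rewrite /ext/=.
    by move=> _; case: ifP => // iJ; exact: H.
  by move=> iJ; have := H i Logic.I; rewrite /ext/= iJ.
have mext J D : (forall i, measurable (D i)) -> forall i, measurable (ext J D i).
  by move=> mD i; rewrite /ext; case: ifP.
rewrite /factor !extE -bigcapI.
under eq_bigcapr do rewrite -preimage_setI.
rewrite !indep//; do ?[exact: mext].
  rewrite -big_split/=; apply: eq_bigr => i _; rewrite /ext.
  case: ifPn => iJ1; case: ifPn => iJ2.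
  - by have := dis _ iJ1; rewrite iJ2.
  - by rewrite setIT preimage_setT probability_setT mule1.
  - by rewrite setTI preimage_setT probability_setT mul1e.
  - by rewrite setTI preimage_setT probability_setT mule1.
by move=> i; apply: measurableI; exact: mext.
Qed.

(** Both E |-> P (E `&` F) and E |-> P F * P E are finite measures, and measures that
agree on a pi-system agree on the sigma-algebra it generates. *)
Lemma factor_sigma (G : set (set T)) F : G `<=` measurable -> setI_closed G ->
  G setT -> measurable F -> (forall E, G E -> factor E F) ->
  forall E, <<s G >> E -> factor E F.
Proof.
move=> Gm GI GT mF GF E GE.
have PF : (fine (P F))%:E = P F by rewrite fineK// fin_num_measure.
have PF0 : (0 <= fine (P F))%R by rewrite fine_ge0.
pose m2 : {measure set T -> \bar R} := mscale (NngNum PF0) P.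
have m2E (A : set T) : m2 A = (P F * P A)%E by rewrite -[in RHS]PF.
have cover : \bigcup_(k : nat) ((fun=> setT) k : set T) = setT.
  by rewrite bigcup_const//; exists 0%N.
have m12 (A : set T) : G A -> mrestr P mF A = m2 A.
  by move=> /GF; rewrite m2E /mrestr /factor muleC.
have finT (k : nat) : (mrestr P mF setT < +oo)%E.
  by rewrite /mrestr setTI (le_lt_trans (probability_le1 _ _))// ltry.
have := @g_sigma_algebra_measure_unique _ _ _ G Gm (fun=> setT) (fun=> GT) cover
  (mrestr P mF) m2 GI m12 finT E GE.
by rewrite /= m2E => mE; rewrite /factor muleC -mE.
Qed.

(** Boxes form a pi-system, so the product rule extends first in one block and then
in the other. *)
Lemma blocks_independent J1 J2 E F : independent_coords -> (forall i, i \in J1 -> i \notin J2) ->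
  <<s block_gen J1 >> E -> <<s block_gen J2 >> F -> factor E F.
Proof.
move=> indep dis /block_sub_boxes E1 /block_sub_boxes F2.
have mF : measurable F.
  by apply: smallest_sub F2; [exact: sigma_algebra_measurable|exact: boxes_measurable].
apply: (factor_sigma (@boxes_measurable J1) (@boxes_setI J1) (boxesT J1) mF _ E1).
move=> E' E1'.
rewrite /factor setIC muleC.
apply: (factor_sigma (@boxes_measurable J2) (@boxes_setI J2) (boxesT J2) _ _ F2).
  exact: boxes_measurable E1'.
move=> F' F2'; rewrite /factor setIC muleC.
exact: boxes_independent indep dis E1' F2'.
Qed.

End blocks.

Section independent_pairs.
Context d (T : measurableType d) (R : realType) (P : probability T R).
Context d1 (T1 : measurableType d1) d2 (T2 : measurableType d2).

Definition independent_maps (C : T -> T1) (D : T -> T2) :=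
  forall A B, measurable A -> measurable B ->
    P (C @^-1` A `&` D @^-1` B) = (P (C @^-1` A) * P (D @^-1` B))%E.

(** Independence says that the law of the pair is a product measure. *)
Lemma independent_tonelli (C : T -> T1) (D : T -> T2) (F : T1 * T2 -> \bar R) :
  measurable_fun setT C -> measurable_fun setT D -> independent_maps C D ->
  measurable_fun [set: T1 * T2] F -> (forall z, 0 <= F z)%E ->
  (\int[P]_w F (C w, D w) = \int[P]_w' \int[P]_w F (C w, D w'))%E.
Proof.
move=> mC mD CD mF F0.
pose C' : {mfun T >-> T1} := HB.pack C (isMeasurableFun.Build _ _ _ _ _ mC).
pose D' : {mfun T >-> T2} := HB.pack D (isMeasurableFun.Build _ _ _ _ _ mD).
have mCD : measurable_fun setT (fun w => (C w, D w)) by exact: measurable_fun_pair.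
pose CD' : {mfun T >-> (T1 * T2)%type} :=
  HB.pack (fun w => (C w, D w)) (isMeasurableFun.Build _ _ _ _ _ mCD).
have prodE X : measurable X ->
    (distribution P C' \x distribution P D')%E X = distribution P CD' X.
  by apply: product_measure_unique => A B mA mB; exact: CD.
rewrite -(@ge0_integral_distribution _ _ _ _ _ P CD')//.
transitivity (\int[(distribution P C' \x distribution P D')%E]_z F z)%E.
  by apply: eq_measure_integral => X mX _; exact/esym/prodE.
rewrite fubini_tonelli2//.
rewrite (@ge0_integral_distribution _ _ _ _ _ P D')//; last 2 first.
- exact: measurable_fun_fubini_tonelli_G.
- by move=> y; apply: integral_ge0 => x _; exact: F0.
apply: eq_integral => w _ /=.
rewrite /fubini_G (@ge0_integral_distribution _ _ _ _ _ P C')//.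
exact: measurableT_comp mF (pair2_measurable _).
Qed.

(** A comparison that holds for every frozen value of D holds for independent D. *)
Lemma independent_integral_le (C : T -> T1) (D : T -> T2) (F G : T1 * T2 -> \bar R) :
  measurable_fun setT C -> measurable_fun setT D -> independent_maps C D ->
  measurable_fun [set: T1 * T2] F -> (forall z, 0 <= F z)%E ->
  measurable_fun [set: T1 * T2] G -> (forall z, 0 <= G z)%E ->
  (forall y, \int[P]_w F (C w, y) <= \int[P]_w G (C w, y))%E ->
  (\int[P]_w F (C w, D w) <= \int[P]_w G (C w, D w))%E.
Proof.
move=> mC mD CD mF F0 mG G0 FG.
pose C' : {mfun T >-> T1} := HB.pack C (isMeasurableFun.Build _ _ _ _ _ mC).
have mH (H : T1 * T2 -> \bar R) (mH : measurable_fun [set: T1 * T2] H) (H0 : forall z, (0 <= H z)%E) :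
    measurable_fun setT (fun w' => \int[P]_w H (C w, D w'))%E.
  apply: (@measurableT_comp _ _ _ _ _ _ (fun y => \int[P]_w H (C w, y))%E) => //.
  rewrite (_ : (fun y => _) = fubini_G (distribution P C') H).
    exact: measurable_fun_fubini_tonelli_G.
  apply/funext => y; rewrite /fubini_G (@ge0_integral_distribution _ _ _ _ _ P C')//.
  exact: measurableT_comp mH (pair2_measurable _).
rewrite !independent_tonelli//; apply: ge0_le_integral => //.
- by move=> w _; apply: integral_ge0.
- exact: mH.
- exact: mH.
Qed.

End independent_pairs.

(** * The randomized quantile transform *)

Section quantile_transform.
Context d (T : measurableType d) (R : realType).
Context (nu : {measure set T -> \bar R}) (X U : T -> R).
Implicit Types (x y c t : R) (A : set T).

(** The intended nu has density max (X, 0) with respect to a probability. So it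
charges only positive values of X, and on each atom of X the randomization U is
still uniform. *)
Record quantile_setting : Prop := QuantileSetting {
  qs_mX : measurable_fun [set: T] X ;
  qs_mU : measurable_fun [set: T] U ;
  qs_fin : (nu [set: T] < +oo)%E ;
  qs_pos : nu [set w | X w <= 0] = 0%E ;
  qs_U01 : forall w, 0 <= U w <= 1 ;
  qs_unif : forall x t, 0 <= t <= 1 ->
    nu [set w | X w = x /\ U w <= t] = (t%:E * nu [set w | X w = x])%E }.

Definition mass : R := fine (nu [set: T]).
Definition cumul y : R := fine (nu [set w | X w <= y]).
Definition cumul_lt x : R := fine (nu [set w | X w < x]).
(** The randomized distribution function: an atom at x is spread uniformly over its
jump. *)
Definition level w : R :=
  cumul_lt (X w) + U w * (cumul (X w) - cumul_lt (X w)).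

Hypothesis qs : quantile_setting.

Lemma qs_measurable_le y : measurable [set w | X w <= y].
Proof.
rewrite -[X in measurable X]setTI; apply: measurable_fun_le => //.
exact: qs_mX qs.
Qed.

Lemma qs_measurable_lt y : measurable [set w | X w < y].
Proof.
rewrite -[X in measurable X]setTI (_ : [set w | X w < y] = X @^-1` `]-oo, y[).
  by apply: (qs_mX qs) => //; exact: measurable_itv.
by rewrite set_itvE.
Qed.

Lemma qs_measurable_eq y : measurable [set w | X w = y].
Proof.
rewrite -[X in measurable X]setTI (_ : [set w | X w = y] = X @^-1` [set y])//.
by apply: (qs_mX qs) => //; exact: measurable_set1.
Qed.

Lemma qs_finE A : measurable A -> nu A = (fine (nu A))%:E.
Proof.
move=> mA; rewrite fineK// ge0_fin_numE//.
by rewrite (le_lt_trans _ (qs_fin qs))// le_measure ?inE.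
Qed.

Lemma qs_fine_le A B : measurable A -> measurable B -> A `<=` B ->
  fine (nu A) <= fine (nu B).
Proof. by move=> mA mB AB; rewrite -lee_fin -!qs_finE// le_measure ?inE. Qed.

Lemma qs_measureD A B : measurable A -> measurable B -> B `<=` A ->
  nu (A `\` B) = (fine (nu A) - fine (nu B))%:E.
Proof.
move=> mA mB BA; rewrite EFinB -!qs_finE//.
rewrite measureD ?setIidr//.
by rewrite (le_lt_trans _ (qs_fin qs))// le_measure ?inE.
Qed.

Lemma cumul_mono x y : x <= y -> cumul x <= cumul y.
Proof.
move=> xy; apply: qs_fine_le; [exact: qs_measurable_le..|].
by move=> w /= /le_trans; exact.
Qed.

Lemma cumul_lt_le x : cumul_lt x <= cumul x.
Proof.
apply: qs_fine_le; [exact: qs_measurable_lt|exact: qs_measurable_le|].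
by move=> w /= /ltW.
Qed.

Lemma cumul_le_lt x y : x < y -> cumul x <= cumul_lt y.
Proof.
move=> xy; apply: qs_fine_le; [exact: qs_measurable_le|exact: qs_measurable_lt|].
by move=> w /= /le_lt_trans; exact.
Qed.

Lemma cumul_ge0 x : 0 <= cumul x.
Proof. exact: fine_ge0. Qed.

Lemma cumul_lt_ge0 x : 0 <= cumul_lt x.
Proof. exact: fine_ge0. Qed.

Lemma cumul_neg x : x <= 0 -> cumul x = 0.
Proof.
move=> x0; apply/eqP; rewrite eq_le cumul_ge0 andbT.
by apply: le_trans (cumul_mono x0) _; rewrite /cumul (qs_pos qs).
Qed.

Lemma measurable_cumul : measurable_fun [set: R] cumul.
Proof. by apply: nondecreasing_measurable => // x y; exact: cumul_mono. Qed.

Lemma measurable_cumul_lt : measurable_fun [set: R] cumul_lt.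
Proof.
apply: nondecreasing_measurable => // x y; rewrite le_eqVlt => /predU1P[->//|xy].
exact: le_trans (cumul_lt_le x) (cumul_le_lt xy).
Qed.

Lemma measurable_level : measurable_fun [set: T] level.
Proof.
have mX := qs_mX qs; have mU := qs_mU qs.
apply: measurable_funD; first exact: measurableT_comp measurable_cumul_lt mX.
apply: measurable_funM => //; apply: measurable_funB.
  exact: measurableT_comp measurable_cumul mX.
exact: measurableT_comp measurable_cumul_lt mX.
Qed.

Lemma level_bounds w : cumul_lt (X w) <= level w <= cumul (X w).
Proof.
have /andP[u0 u1] := qs_U01 qs w; have c := cumul_lt_le (X w).
rewrite /level lerDl mulr_ge0 ?subr_ge0//=.
by rewrite -lerBrDl ler_piMl// subr_ge0.
Qed.

Lemma level_ge0 w : 0 <= level w.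
Proof. by have /andP[+ _] := level_bounds w; apply: le_trans; exact: cumul_lt_ge0. Qed.

Lemma cumul_cvg_mass c : c < mass -> exists y, c < cumul y.
Proof.
move=> cm; pose S n := [set w | X w <= n%:R].
have US : \bigcup_n S n = setT.
  rewrite -subTset => w _; exists (Num.truncn (X w)).+1 => //=.
  by rewrite /S/= ltW// truncnS_gt.
have /fine_cvg : nu (S n) @[n --> \oo] --> mass%:E.
  rewrite /mass -qs_finE// -US; apply: nondecreasing_cvg_mu.
  - by move=> n; exact: qs_measurable_le.
  - by rewrite US.
  - by move=> a b ab; apply/subsetPset => w /= /le_trans; apply; rewrite ler_nat.
move=> /cvgr_gt /(_ _ cm) [n _ /(_ n (leqnn _)) H]; by exists n%:R.
Qed.

Lemma inv_mono (a b : nat) : (a <= b)%N -> b.+1%:R^-1 <= a.+1%:R^-1 :> R.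
Proof. by move=> ab; rewrite lef_pV2 ?posrE// ler_nat. Qed.

Lemma cumul_right x c : (forall y, x < y -> c <= cumul y) -> c <= cumul x.
Proof.
move=> H; pose S n := [set w | X w <= x + n.+1%:R^-1].
have IS : \bigcap_n S n = [set w | X w <= x].
  apply/seteqP; split => w /=; last first.
    by move=> Xx n _; rewrite /S/= (le_trans Xx)// lerDl invr_ge0.
  move=> Sw; rewrite leNgt; apply/negP => xX.
  have [n nX] := ltr_add_invr xX.
  by have := Sw n Logic.I; rewrite /S/= leNgt nX.
have mS n : measurable (S n) by exact: qs_measurable_le.
have /fine_cvg cv : nu (S n) @[n --> \oo] --> (cumul x)%:E.
  rewrite /cumul -qs_finE -?IS; last exact: bigcap_measurable.
  apply: nonincreasing_cvg_mu => //.
  - by rewrite qs_finE// ltry.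
  - exact: bigcap_measurable.
  - move=> a b ab; apply/subsetPset => w /= /le_trans; apply.
    by rewrite lerD2l inv_mono.
apply: (cvgr_to_ge cv); apply: nearW => n.
by apply: H; rewrite ltrDl.
Qed.

Lemma cumul_left x c : (forall y, y < x -> cumul y <= c) -> cumul_lt x <= c.
Proof.
move=> H; pose S n := [set w | X w <= x - n.+1%:R^-1].
have US : \bigcup_n S n = [set w | X w < x].
  apply/seteqP; split => w /=.
    by move=> [n _]; rewrite /S/= => /le_lt_trans; apply; rewrite ltrBlDr ltrDl.
  move=> /ltr_add_invr[n nX]; exists n => //=.
  by rewrite /S/= lerBrDr ltW.
have mS n : measurable (S n) by exact: qs_measurable_le.
have /fine_cvg cv : nu (S n) @[n --> \oo] --> (cumul_lt x)%:E.
  rewrite /cumul_lt -qs_finE -?US; last exact: bigcup_measurable.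
  apply: nondecreasing_cvg_mu => //; first exact: bigcup_measurable.
  move=> a b ab; apply/subsetPset => w /= /le_trans; apply.
  by rewrite lerD2l lerN2 inv_mono.
apply: (cvgr_to_le cv); apply: nearW => n.
by apply: H; rewrite ltrBlDr ltrDl.
Qed.

(** The infimum of the y with cumul y >= c is attained, by right continuity. *)
Lemma exists_quantile c : 0 < c -> c < mass ->
  exists x, [/\ 0 < x, cumul_lt x <= c, c <= cumul x &
    forall y, y < x -> cumul y < c].
Proof.
move=> c0 cm; pose S := [set y | c <= cumul y].
have S0 y : S y -> 0 < y.
  move=> /= cy; rewrite ltNge; apply/negP => /cumul_neg y0.
  by move: cy; rewrite /S/= y0 leNgt c0.
have [y0 /ltW Sy0] := cumul_cvg_mass cm.
have hS : has_inf S.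
  by split; [exists y0|exists 0 => y /S0/ltW].
have below y : y < inf S -> cumul y < c.
  move=> yx; rewrite ltNge; apply/negP => cy.
  by have := ge_inf hS.2 cy; rewrite leNgt yx.
have cx : c <= cumul (inf S).
  apply: cumul_right => y xy.
  have yx : 0 < y - inf S by rewrite subr_gt0.
  have [z Sz zy] := inf_adherent yx hS.
  by apply: le_trans Sz _; apply: cumul_mono; rewrite subrKC in zy; exact: ltW.
exists (inf S); split => //; first exact: S0.
by apply: cumul_left => y /below/ltW.
Qed.

Lemma measurable_level_lt c : measurable [set w | level w < c].
Proof.
rewrite -[X in measurable X]setTI (_ : [set w | level w < c] = level @^-1` `]-oo, c[).
  by apply: measurable_level => //; exact: measurable_itv.
by rewrite set_itvE.
Qed.

Lemma measurable_level_le c : measurable [set w | level w <= c].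
Proof.
rewrite -[X in measurable X]setTI; apply: measurable_fun_le => //.
exact: measurable_level.
Qed.

Lemma cumul_atom x : cumul x = cumul_lt x + fine (nu [set w | X w = x]).
Proof.
have mE := qs_measurable_eq x.
apply: EFin_inj; rewrite EFinD -!qs_finE//; last 2 first.
- exact: qs_measurable_lt.
- exact: qs_measurable_le.
rewrite -measureU//; last 2 first.
- exact: qs_measurable_lt.
- by apply/seteqP; split => w //= [+ xw]; rewrite xw ltxx.
congr (nu _); apply/seteqP; split => w /=.
  by rewrite le_eqVlt => /orP[/eqP ->|]; [right|left].
by move=> [/ltW|->].
Qed.

Lemma atom_split x t : 0 <= t <= 1 ->
  fine (nu [set w | X w = x /\ U w <= t]) = t * (cumul x - cumul_lt x).
Proof.
move=> t01; rewrite (qs_unif qs)// cumul_atom addrAC subrr add0r.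
rewrite fineM//.
rewrite ge0_fin_numE// (le_lt_trans _ (qs_fin qs))// le_measure ?inE//.
exact: qs_measurable_eq.
Qed.

(** At the quantile x of c, the event level < c contains X < x, is contained in X <= x,
and cuts the atom at x in the right proportion. *)
Lemma level_lt_le c : 0 < c -> c < mass ->
  fine (nu [set w | level w < c]) <= c /\ c <= fine (nu [set w | level w <= c]).
Proof.
move=> c0 cm; have [x [x0 lc cx below]] := exists_quantile c0 cm.
pose t := (c - cumul_lt x) / (cumul x - cumul_lt x).
have D0 : 0 <= cumul x - cumul_lt x by rewrite subr_ge0 cumul_lt_le.
have [gap|nogap] := eqVneq (cumul x - cumul_lt x) 0.
  have ex : cumul x = c by lra.
  have el : cumul_lt x = c by lra.
  split.
    rewrite -[leRHS]ex; apply: qs_fine_le.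
    - exact: measurable_level_lt.
    - exact: qs_measurable_le.
    move=> w /= hc; rewrite leNgt; apply/negP => xX.
    have /andP[l1 _] := level_bounds w.
    have := le_trans cx (le_trans (cumul_le_lt xX) l1).
    by rewrite leNgt hc.
  rewrite -[leLHS]el; apply: qs_fine_le.
  - exact: qs_measurable_lt.
  - exact: measurable_level_le.
  move=> w /= Xx; have /andP[_ l2] := level_bounds w.
  by rewrite (le_trans l2)// ltW// below.
have Dp : 0 < cumul x - cumul_lt x by rewrite lt_neqAle eq_sym nogap.
have t01 : 0 <= t <= 1.
  apply/andP; split; first by rewrite divr_ge0// subr_ge0.
  by rewrite ler_pdivrMr// mul1r; lra.
have tE : t * (cumul x - cumul_lt x) = c - cumul_lt x by rewrite divfK.
have mA : measurable [set w | X w = x /\ U w <= t].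
  rewrite (_ : [set w | _] = X @^-1` [set x] `&` [set w | U w <= t])//.
  apply: measurableI; first exact: qs_measurable_eq.
  rewrite -[X in measurable X]setTI; apply: measurable_fun_le => //.
  exact: qs_mU qs.
have mB : measurable ([set w | X w < x] `|` [set w | X w = x /\ U w <= t]).
  by apply: measurableU => //; exact: qs_measurable_lt.
have val : fine (nu ([set w | X w < x] `|` [set w | X w = x /\ U w <= t])) = c.
  apply: EFin_inj; rewrite -qs_finE// measureU//.
  - rewrite [X in (X + _)%E]qs_finE; last exact: qs_measurable_lt.
    rewrite [X in (_ + X)%E]qs_finE// -EFinD atom_split// tE.
    by rewrite subrKC.
  - exact: qs_measurable_lt.
  - by apply/seteqP; split => w //= [+ [xw _]]; rewrite xw ltxx.
split.
  rewrite -[leRHS]val; apply: qs_fine_le => //; first exact: measurable_level_lt.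
  move=> w /= hc; case: (ltgtP (X w) x) => [|xX|Xx]; first by left.
    have /andP[l1 _] := level_bounds w.
    have := le_trans cx (le_trans (cumul_le_lt xX) l1).
    by rewrite leNgt hc.
  right; split => //; rewrite ler_pdivlMr//.
  by move: hc; rewrite /level Xx; lra.
rewrite -[leLHS]val; apply: qs_fine_le => //; first exact: measurable_level_le.
move=> w /= [Xx|[Xx Ut]].
  by have /andP[_ l2] := level_bounds w; rewrite (le_trans l2)// ltW// below.
by rewrite /level Xx; have := ler_wpM2r D0 Ut; rewrite tE; lra.
Qed.

(** The level is uniform on [0, mass]. Its law depends on nu only through the total
mass, which is why the positive and the negative side of a centred variable
can be matched. *)
Lemma level_law_lt c :
  nu [set w | level w < c] = (Num.max 0 (Num.min c mass))%:E.
Proof.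
rewrite qs_finE; last exact: measurable_level_lt.
congr EFin; apply/eqP; rewrite eq_le; apply/andP; split.
  have [c0|c0] := leP c 0.
    rewrite (_ : [set w | _] = set0) ?measure0 ?le_max ?lexx//.
    apply/seteqP; split => w //= hc.
    by have := level_ge0 w; rewrite leNgt (lt_le_trans hc).
  rewrite le_max le_min; apply/orP; right; apply/andP; split; last first.
    by apply: qs_fine_le => //; exact: measurable_level_lt.
  have [cm|mc] := ltP c mass; first by have [] := level_lt_le c0 cm.
  by apply: le_trans mc; apply: qs_fine_le => //; exact: measurable_level_lt.
rewrite ge_max fine_ge0//=.
apply/ler_addgt0Pr => e e0.
pose c' := Num.min c mass - e.
have [c'0|c'0] := leP c' 0.
  by have := fine_ge0 (measure_ge0 nu [set w | level w < c]); rewrite /c' in c'0; lra.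
have c'm : c' < mass.
  by rewrite /c' ltrBlDr (le_lt_trans (_ : _ <= mass)) ?ge_min ?lexx ?orbT ?ltrDl.
have [_ H] := level_lt_le c'0 c'm.
have : fine (nu [set w | level w <= c']) <= fine (nu [set w | level w < c]).
  apply: qs_fine_le; [exact: measurable_level_le|exact: measurable_level_lt|].
  move=> w /= /le_lt_trans; apply; rewrite /c' ltrBlDr.
  by rewrite (le_lt_trans (_ : _ <= c)) ?ge_min ?lexx ?ltrDl.
rewrite /c' in H *; lra.
Qed.

Lemma level_law_le c : 0 <= c -> fine (nu [set w | level w <= c]) <= c.
Proof.
move=> c0; apply/ler_addgt0Pr => e e0.
apply: le_trans (_ : fine (nu [set w | level w < c + e]) <= _).
  apply: qs_fine_le; [exact: measurable_level_le|exact: measurable_level_lt|].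
  by move=> w /= /le_lt_trans; apply; rewrite ltrDl.
rewrite level_law_lt/= ge_max ge_min lexx/= addr_ge0//.
exact: ltW.
Qed.

(** If y < X then the level is at least cumul y, and the uniform law gives no mass to
the single value cumul y. *)
Lemma level_null_below y : nu [set w | y < X w /\ level w <= cumul y] = 0%E.
Proof.
have -> : [set w | y < X w /\ level w <= cumul y] =
    [set w | level w <= cumul y] `\` [set w | X w <= y].
  apply/seteqP; split => w /= [].
    by move=> yX hl; split => //; apply/negP; rewrite -ltNge.
  by move=> hl /negP; rewrite -ltNge.
have m1 := measurable_level_le (cumul y); have m2 := qs_measurable_le y.
have sub : [set w | X w <= y] `<=` [set w | level w <= cumul y].
  move=> w /= Xy; have /andP[_ l2] := level_bounds w.
  by rewrite (le_trans l2)// cumul_mono.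
rewrite qs_measureD//; congr EFin; apply/eqP; rewrite eq_le subr_le0 subr_ge0.
by rewrite (level_law_le (cumul_ge0 y)) qs_fine_le.
Qed.

Lemma level_null_ge_mass : nu [set w | mass <= level w] = 0%E.
Proof.
have -> : [set w | mass <= level w] = setT `\` [set w | level w < mass].
  apply/seteqP; split => w /=.
    by move=> ml; split => //; apply/negP; rewrite -leNgt.
  by move=> [_ /negP]; rewrite -leNgt.
have m1 := measurable_level_lt mass.
rewrite qs_measureD// level_law_lt/= minxx.
by rewrite max_r ?subrr// fine_ge0.
Qed.

Lemma level_null_le0 : nu [set w | level w <= 0] = 0%E.
Proof.
rewrite qs_finE; last exact: measurable_level_le.
congr EFin; apply/eqP; rewrite eq_le fine_ge0// andbT.
exact: level_law_le.
Qed.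

End quantile_transform.

(** * Measures with a density *)

Section weighted_measure.
Local Open Scope ereal_scope.
Context d (T : measurableType d) (R : realType) (mu : {measure set T -> \bar R}).
Context (f : T -> R).

(** The proofs of measurability and positivity are arguments in order that the measure
structure can be attached to the function itself. *)
Definition weighted (mf : measurable_fun [set: T] f) (f0 : forall x, (0 <= f x)%R)
  (A : set T) : \bar R := \int[mu]_(x in A) (f x)%:E.

Context (mf : measurable_fun [set: T] f) (f0 : forall x, (0 <= f x)%R).

Let weighted0 : weighted mf f0 set0 = 0.
Proof. by rewrite /weighted integral_set0. Qed.

Let weighted_ge0 A : 0 <= weighted mf f0 A.
Proof. by apply: integral_ge0 => x _; rewrite lee_fin. Qed.

Let weighted_sigma_additive : semi_sigma_additive (weighted mf f0).
Proof.
move=> F mF tF mUF; rewrite /weighted; apply: cvg_toP.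
  apply: ereal_nondecreasing_is_cvgn => m n mn.
  apply: lee_sum_nneg_natr => // k _ _.
  by apply: integral_ge0 => x _; rewrite lee_fin.
rewrite ge0_integral_bigcup//=.
- by apply/measurable_EFinP; exact: measurable_funTS.
- by move=> x _; rewrite lee_fin.
Qed.

HB.instance Definition _ := isMeasure.Build _ _ _ (weighted mf f0)
  weighted0 weighted_ge0 weighted_sigma_additive.

Import HBNNSimple.

Let weighted_indic E : measurable E ->
  \int[weighted mf f0]_x (\1_E x)%:E = \int[mu]_x ((f x)%:E * (\1_E x)%:E).
Proof.
move=> mE; rewrite integral_indic// setIT.
rewrite -[LHS]/(\int[mu]_(x in E) (f x)%:E) [LHS]integral_mkcond.
apply: eq_integral => x _; rewrite patchE indicE.
by case: ifPn => _; rewrite ?mule1 ?mule0.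
Qed.

Let weighted_nnsfun (g : {nnsfun T >-> R}) :
  \int[weighted mf f0]_x (g x)%:E = \int[mu]_x ((f x)%:E * (g x)%:E).
Proof.
under [LHS]eq_integral do rewrite fimfunE -fsumEFin//.
rewrite [LHS]ge0_integral_fsum//; last 2 first.
  - by move=> r; exact/measurable_EFinP/measurableT_comp.
  - by move=> n x _; rewrite EFinM nnfun_muleindic_ge0.
under [RHS]eq_integral.
  move=> x xD; rewrite fimfunE -fsumEFin// ge0_mule_fsumr; last first.
    by move=> r; rewrite EFinM nnfun_muleindic_ge0.
  over.
rewrite [RHS]ge0_integral_fsum//; last 2 first.
  - move=> r; apply: emeasurable_funM; first exact/measurable_EFinP.
    by apply/measurable_EFinP; exact: measurable_funM.
  - move=> n x _; rewrite mule_ge0 ?lee_fin//.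
    by have := nnfun_muleindic_ge0 g n x; rewrite -EFinM lee_fin.
apply: eq_fsbigr => r _.
rewrite integralZl_indic_nnsfun// weighted_indic//.
have [r0|r0] := leP 0%R r.
  rewrite -ge0_integralZl//.
  - by apply: eq_integral => x _; rewrite EFinM muleCA.
  - by apply: emeasurable_funM; apply/measurable_EFinP.
  - by move=> x _; rewrite mule_ge0// lee_fin.
rewrite preimage_nnfun0// [X in _ = X]integral0_eq; last first.
  by move=> x _; rewrite indic0 mulr0 mule0.
rewrite integral0_eq ?mule0// => x _.
by rewrite indic0 mule0.
Qed.

Lemma ge0_integral_weighted (g : T -> \bar R) :
  measurable_fun [set: T] g -> (forall x, 0 <= g x) ->
  \int[weighted mf f0]_x g x = \int[mu]_x ((f x)%:E * g x).
Proof.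
move=> mg g0; pose g_ := nnsfun_approx measurableT mg.
transitivity (limn (fun n => \int[weighted mf f0]_x (g_ n x)%:E)).
  rewrite -monotone_convergence//=.
  - apply: eq_integral => x _; apply/esym/cvg_lim => //=.
    exact: cvg_nnsfun_approx.
  - by move=> n; exact/measurable_EFinP/measurable_funTS.
  - by move=> n x _; rewrite lee_fin.
  - by move=> x _ m n mn; rewrite lee_fin; exact/lefP/nd_nnsfun_approx.
transitivity (limn (fun n => \int[mu]_x ((f x)%:E * (g_ n x)%:E))).
  by apply: congr_lim; apply/funext => n; exact: weighted_nnsfun.
rewrite -monotone_convergence//=.
- apply: eq_integral => x _; apply/cvg_lim => //=.
  by apply: cvgeZl => //; exact: cvg_nnsfun_approx.
- move=> n; apply: emeasurable_funM; first exact/measurable_EFinP.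
  exact/measurable_EFinP/measurable_funTS.
- by move=> n x _; rewrite mule_ge0// lee_fin.
- move=> x _ m n mn; rewrite lee_wpmul2l// lee_fin//.
  exact/lefP/nd_nnsfun_approx.
Qed.

End weighted_measure.

(** * The measure weighted by a positive part *)

Section positive_part_measure.
Context d (T : measurableType d) (R : realType) (P : probability T R).
Implicit Types (X U : {RV P >-> R}).

(** Makes the randomization take values in [0, 1] everywhere and not only almost
surely. *)
Definition clamp (u : R) : R := Num.max 0 (Num.min u 1).

Lemma clamp01 u : 0 <= clamp u <= 1.
Proof. by rewrite /clamp le_max lexx ge_max ler01 ge_min lexx orbT. Qed.

Lemma clamp_id u : 0 <= u <= 1 -> clamp u = u.
Proof. by move=> /andP[u0 u1]; rewrite /clamp min_l// max_r. Qed.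

Lemma measurable_clamp : measurable_fun [set: R] clamp.
Proof. by apply: measurable_maxr => //; apply: measurable_minr. Qed.

Definition pos_part (X : T -> R) (w : T) : R := Num.max (X w) 0.

Lemma pos_part_ge0 X w : 0 <= pos_part X w.
Proof. by rewrite le_max lexx orbT. Qed.

Lemma measurable_pos_part X : measurable_fun [set: T] (pos_part X).
Proof. exact: measurable_maxr. Qed.

(** The measure that assigns to an event the integral of max (X, 0) over it; on the
positive side, the truncated moment G of X is its distribution function. *)
Definition pos_measure X : {measure set T -> \bar R} :=
  weighted P (measurable_pos_part X) (pos_part_ge0 X).

Lemma uniform_cdf (t : R) : 0 <= t <= 1 ->
  uniform_prob (@ltr01 R) [set u | u <= t] = t%:E.
Proof.
move=> /andP[t0 t1]; rewrite /uniform_prob integral_uniform_pdf.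
have -> : [set u | u <= t] `&` `[0, 1] = `[0, t]%classic.
  apply/seteqP; split => u /=; rewrite !in_itv/=.
    by move=> [ut /andP[-> _]].
  by move=> /andP[u0 ut]; split => //; rewrite u0 (le_trans ut).
rewrite (eq_integral (fun=> 1%E)); last first.
  move=> u; rewrite inE/= in_itv/= => /andP[u0 ut].
  by rewrite /uniform_pdf u0 (le_trans ut)//= subr0 invr1.
rewrite integral_cst//= mul1e lebesgue_measure_itv/= lte_fin.
by have [_|] := ltP 0 t; rewrite ?oppr0 ?addr0// => t0'; congr EFin; apply/eqP; rewrite eq_le t0.
Qed.

(** On an atom of X the density is constant, so the independence of X and U under P
gives the uniformity of U there under the weighted measure. *)
Lemma pos_measure_setting X U : P.-integrable [set: T] (EFin \o X) ->
  has_law U (uniform_prob (@ltr01 R)) -> independent_maps P X U ->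
  quantile_setting (pos_measure X) X (clamp \o U).
Proof.
move=> iX lU XU; split.
- exact: measurable_funPT.
- by apply: measurableT_comp measurable_clamp _; exact: measurable_funPT.
- rewrite -[pos_measure X _]/(\int[P]_w (pos_part X w)%:E)%E.
  have [mX] := integrableP _ _ _ iX; apply: le_lt_trans.
  apply: ge0_le_integral => //.
  + by move=> w _; rewrite lee_fin pos_part_ge0.
  + by apply/measurable_EFinP; exact: measurable_pos_part.
  + exact: measurableT_comp.
  + by move=> w _; rewrite /= lee_fin /pos_part ge_max ler_norm normr_ge0.
- rewrite -[LHS]/(\int[P]_(w in [set w | (X w <= 0)%R]) (pos_part X w)%:E)%E.
  by apply: integral0_eq => w /= Xw; rewrite /pos_part max_r.
- by move=> w; exact: clamp01.
move=> x t t01; have /andP[t0 t1] := t01.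
have mx : measurable (X @^-1` [set x]).
  by rewrite -[X in measurable X]setTI; exact: measurable_funP.
have nuE (A : set T) : measurable A -> A `<=` X @^-1` [set x] ->
    pos_measure X A = ((Num.max x 0)%:E * P A)%E.
  move=> mA AX; rewrite -[LHS]/(\int[P]_(w in A) (pos_part X w)%:E)%E.
  rewrite -integral_cst//; apply: eq_integral => w.
  by rewrite inE => /AX /= Xx; rewrite /pos_part Xx.
have -> : [set w | X w = x] = X @^-1` [set x] by [].
have [t1E|tn1] := eqVneq t 1.
  rewrite t1E mul1e; congr (pos_measure X _).
  apply/seteqP; split => w /= => [[]//|Xx]; split => //.
  by have /andP[] := clamp01 (U w).
have tlt1 : t < 1 by rewrite lt_neqAle tn1.
have UtE : [set w | X w = x /\ (clamp \o U) w <= t] =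
    X @^-1` [set x] `&` U @^-1` [set u | u <= t].
  apply/seteqP; split => w /= [Xx Ut]; split => //.
    by move: Ut; rewrite /clamp ge_max ge_min (leNgt 1) tlt1 orbF => /andP[].
  by rewrite /clamp ge_max ge_min Ut t0.
have mt : measurable [set u : R | u <= t].
  by rewrite -set_itvNyc; exact: measurable_itv.
have mUt : measurable (U @^-1` [set u | u <= t]).
  by rewrite -[X in measurable X]setTI; exact: measurable_funP.
rewrite UtE (nuE _ (measurableI _ _ mx mUt) (@subIsetl _ _ _)) (nuE _ mx (@subset_refl _ _)).
rewrite XU//.
have -> : P (U @^-1` [set u | u <= t]) = t%:E.
  by rewrite -uniform_cdf//; exact: lU.
by rewrite muleA muleC.
Qed.

End positive_part_measure.

(** * The reciprocating function through quantiles *)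

Section reciprocating.
Context d (T : measurableType d) (R : realType) (P : probability T R).
Implicit Types (X U : {RV P >-> R}) (x y c u : R).

Definition negRV X : {RV P >-> R} := (\- X : {mfun T >-> R}).

Definition pos_cumul X y := cumul (pos_measure X) X y.
Definition pos_cumul_lt X y := cumul_lt (pos_measure X) X y.
Definition pos_mass X := mass (pos_measure X).

Definition pos_setting X U := quantile_setting (pos_measure X) X (@clamp R \o U).

Lemma pos_cumulE X U y : pos_setting X U ->
  (pos_cumul X y)%:E = (\int[P]_(w in [set w | (X w <= y)%R]) (pos_part X w)%:E)%E.
Proof.
by move=> s; rewrite /pos_cumul /cumul -(qs_finE s)//; exact: qs_measurable_le s y.
Qed.

(** For a positive argument G is the distribution function of the weighted measure. *)
Lemma recG_pos X U y : pos_setting X U -> 0 <= y -> recG X y%:E = (pos_cumul X y)%:E.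
Proof.
move=> s y0; rewrite (pos_cumulE y s) /recG lee_fin y0 unlock [RHS]integral_mkcond.
apply: eq_integral => w _; rewrite patchE lee_fin /pos_part.
case: ifPn => [/set_mem/= ->|].
  by rewrite andbT; have [X0|X0] := ltP 0 (X w); rewrite ?mulr1 ?mulr0.
by rewrite notin_setE/= => /negP/negbTE ->; rewrite andbF mulr0.
Qed.

Lemma pos_massE X : P.-integrable [set: T] (EFin \o X) ->
  (pos_mass X)%:E = (\int[P]_w (pos_part X w)%:E)%E.
Proof.
move=> iX; rewrite /pos_mass /mass fineK// ge0_fin_numE//.
rewrite -[pos_measure X _]/(\int[P]_w (pos_part X w)%:E)%E.
have [mX] := integrableP _ _ _ iX; apply: le_lt_trans.
apply: ge0_le_integral => //.
- by move=> w _; rewrite lee_fin pos_part_ge0.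
- by apply/measurable_EFinP; exact: measurable_pos_part.
- exact: measurableT_comp.
- by move=> w _; rewrite /= lee_fin /pos_part ge_max ler_norm normr_ge0.
Qed.

Lemma recG0 X : recG X 0%E = 0%E.
Proof.
rewrite /recG lexx unlock integral0_eq// => w _.
by rewrite lee_fin; case: ltgtP => //= _; rewrite mulr0.
Qed.

Lemma recG_opp X (y : \bar R) : (0 <= y)%E -> recG (negRV X) y = recG X (- y)%E.
Proof.
rewrite le_eqVlt => /predU1P[<-|y0]; first by rewrite oppe0 !recG0.
rewrite /recG (ltW y0) leNgt oppe_lt0 y0/= unlock.
apply: eq_integral => w _; congr EFin; rewrite oppr_gt0; congr (_ * _).
by rewrite andbC; congr ((_ && _)%:R); rewrite EFinN leeNl.
Qed.

(** By symmetry all facts about the negative side follow from the positive one. *)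
Lemma xminus_opp X (h : \bar R) : xminus X h = (- xplus (negRV X) h)%E.
Proof.
rewrite /xminus /xplus /ereal_inf oppeK; congr ereal_sup.
apply/seteqP; split => y /=.
  move=> [y0 hy]; exists (- y)%E; last by rewrite oppeK.
  by rewrite oppe_ge0 recG_opp ?oppeK ?oppe_ge0.
move=> [z [z0 hz] <-]; split; first by rewrite oppe_le0.
by rewrite -recG_opp.
Qed.

Lemma xplus_mid X U c : pos_setting X U -> P.-integrable [set: T] (EFin \o X) ->
  0 < c -> c < pos_mass X ->
  exists x, [/\ 0 < x, xplus X c%:E = x%:E & forall y, c <= pos_cumul X y -> x <= y].
Proof.
move=> s iX c0 cm; have [x [x0 _ cx below]] := exists_quantile s c0 cm.
have min y : c <= pos_cumul X y -> x <= y.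
  by move=> cy; rewrite leNgt; apply/negP => /below; rewrite ltNge cy.
exists x; split => //; apply/eqP; rewrite eq_le; apply/andP; split.
  apply: ereal_inf_lbound; split; first by rewrite lee_fin ltW.
  by rewrite (recG_pos s) ?lee_fin// ltW.
apply: le_ereal_inf_tmp => -[y| |] [y0 hy] //; last by rewrite leey.
by rewrite lee_fin; apply: min; rewrite (recG_pos s) ?lee_fin// in hy *.
Qed.

(** If no rational q < X already has cumulated mass equal to the level or more, then
X is the least such point. Only countably many null events are
excluded in this way. *)
Lemma xplus_level X U w : pos_setting X U -> 0 < X w ->
  (forall q : rat, ~ (ratr q < X w /\
     level (pos_measure X) X (@clamp R \o U) w <= pos_cumul X (ratr q))) ->
  xplus X (level (pos_measure X) X (@clamp R \o U) w)%:E = (X w)%:E.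
Proof.
move=> s X0 gen; have /andP[l1 l2] := level_bounds s w.
apply/eqP; rewrite eq_le; apply/andP; split.
  apply: ereal_inf_lbound; split; first by rewrite lee_fin ltW.
  by rewrite (recG_pos s) ?lee_fin// ltW.
apply: le_ereal_inf_tmp => -[y| |] [y0 hy] //; last by rewrite leey.
rewrite lee_fin leNgt; apply/negP => yX.
rewrite lee_fin in y0; rewrite (recG_pos s)// lee_fin in hy.
have [q] := rat_in_itvoo yX; rewrite in_itv/= => /andP[yq qX].
apply: (gen q); split => //; apply: le_trans hy _.
by apply: (cumul_mono s); exact: ltW.
Qed.

Lemma cumul_cvg_left X U x : pos_setting X U ->
  pos_cumul X y @[y --> x^'-] --> pos_cumul_lt X x.
Proof.
move=> s; apply/cvgrPdist_lt => e e0.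
have [y0 y0x ey0] : exists2 y, y < x & pos_cumul_lt X x - e < pos_cumul X y.
  apply: contrapT => no.
  have : pos_cumul_lt X x <= pos_cumul_lt X x - e.
    apply: (cumul_left s) => y yx; rewrite leNgt; apply/negP => H.
    by apply: no; exists y.
  by rewrite lerDl oppr_ge0 leNgt e0.
near=> y.
have yx : y < x by near: y; exact: nbhs_left_lt.
have y0y : y0 <= y by near: y; exact: nbhs_left_ge.
have := cumul_le_lt s yx; have := cumul_mono s y0y.
rewrite -/(pos_cumul X y0) -/(pos_cumul X y) -/(pos_cumul_lt X x) => A1 A2.
by rewrite ger0_norm ?subr_ge0//; lra.
Unshelve. all: by end_near. Qed.

Lemma recH_pos X U x u : pos_setting X U -> 0 < x ->
  recH X x u = (pos_cumul_lt X x + u * (pos_cumul X x - pos_cumul_lt X x))%:E.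
Proof.
move=> s x0; rewrite /recH (ltW x0).
have -> : lim (recG X y%:E @[y --> x^'-]) = (pos_cumul_lt X x)%:E.
  apply/cvg_lim => //.
  apply: (@cvg_trans _ ((pos_cumul X y)%:E @[y --> x^'-])).
    apply: near_eq_cvg; near=> y; rewrite (recG_pos s)//.
    by near: y; exact: nbhs_left_ge.
  by apply: cvg_EFin; [exact: nearW|exact: cumul_cvg_left s].
by rewrite (recG_pos s) ?ltW// -EFinB -EFinM -EFinD.
Unshelve. all: by end_near. Qed.

Lemma recH_neg X U x u : pos_setting (negRV X) U -> x < 0 ->
  recH X x u = (pos_cumul_lt (negRV X) (- x) +
    u * (pos_cumul (negRV X) (- x) - pos_cumul_lt (negRV X) (- x)))%:E.
Proof.
move=> s x0; rewrite /recH leNgt x0/=.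
have GE y : y < 0 -> recG X y%:E = (pos_cumul (negRV X) (- y))%:E.
  move=> y0; rewrite -(recG_pos s) ?oppr_ge0; last exact: ltW.
  by rewrite recG_opp ?lee_fin ?oppr_ge0 ?(ltW y0)// -EFinN opprK.
have -> : lim (recG X y%:E @[y --> x^'+]) = (pos_cumul_lt (negRV X) (- x))%:E.
  apply/cvg_lim => //.
  apply: (@cvg_trans _ ((pos_cumul (negRV X) (- y))%:E @[y --> x^'+])).
    apply: near_eq_cvg; near=> y; apply/esym/GE.
    by near: y; exact: nbhs_right_lt.
  apply/cvg_at_rightNP; rewrite (_ : _ \o -%R = fun y => (pos_cumul (negRV X) y)%:E).
    by apply: cvg_EFin; [exact: nearW|exact: cumul_cvg_left s].
  by apply/funext => y /=; rewrite opprK.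
by rewrite GE// -EFinB -EFinM -EFinD.
Unshelve. all: by end_near. Qed.

(** Without an atom the value of the randomization is irrelevant, so the variable U_X
may be replaced by U. *)
Lemma pos_cumul_atom0 X U x : pos_setting X U -> P (X @^-1` [set x]) = 0%E ->
  pos_cumul X x = pos_cumul_lt X x.
Proof.
move=> s Px; rewrite /pos_cumul /pos_cumul_lt (cumul_atom s).
rewrite (_ : pos_measure X _ = 0%E) ?addr0//.
rewrite -[LHS]/(\int[P]_(w in X @^-1` [set x]) (pos_part X w)%:E)%E.
apply: null_set_integral => //.
by apply/measurable_EFinP/measurable_funTS; exact: measurable_pos_part.
Qed.

Definition pos_level X U := level (pos_measure X) X (@clamp R \o U).

Lemma recipX_pos X U w : pos_setting X U -> 0 <= U w <= 1 -> 0 < X w ->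
  recipX X U w = (- xplus (negRV X) (pos_level X U w)%:E)%E.
Proof.
move=> s U01 X0; rewrite /recipX /recip (ltW X0) xminus_opp; congr (- xplus _ _)%E.
rewrite (recH_pos _ s)// /pos_level /level/= clamp_id// /randomize.
rewrite -[cumul _ _ _]/(pos_cumul X (X w)) -[cumul_lt _ _ _]/(pos_cumul_lt X (X w)).
case: ifPn => //; rewrite negbK => /eqP P0.
by rewrite (pos_cumul_atom0 s P0) subrr !mulr0.
Qed.

Lemma recipX_neg X U w : pos_setting (negRV X) U -> 0 <= U w <= 1 -> X w < 0 ->
  recipX X U w = xplus X (pos_level (negRV X) U w)%:E.
Proof.
move=> s U01 X0; rewrite /recipX /recip leNgt X0/=; congr (xplus _ _)%E.
rewrite (recH_neg _ s)// /pos_level /level/= clamp_id// /randomize.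
rewrite -[cumul _ _ _]/(pos_cumul (negRV X) (- X w)).
rewrite -[cumul_lt _ _ _]/(pos_cumul_lt (negRV X) (- X w)).
case: ifPn => //; rewrite negbK => /eqP P0.
rewrite (@pos_cumul_atom0 _ _ (- X w) s) ?subrr ?mulr0//.
rewrite (_ : _ @^-1` _ = X @^-1` [set X w])//.
by apply/seteqP; split => v /= => [/oppr_inj|->].
Qed.

(** This is the centring of X. *)
Lemma mass_opp X : zero_mean X -> pos_mass X = pos_mass (negRV X).
Proof.
move=> [iX EX].
have iN : P.-integrable [set: T] (EFin \o negRV X).
  by have := integrableN iX; apply: eq_integrable.
have E1 : (\int[P]_w ((EFin \o X)^\+ w) = (pos_mass X)%:E)%E.
  by rewrite pos_massE//; apply: eq_integral => w _; rewrite funeposE/= -EFin_max.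
have E2 : (\int[P]_w ((EFin \o X)^\- w) = (pos_mass (negRV X))%:E)%E.
  by rewrite pos_massE//; apply: eq_integral => w _; rewrite funenegE/= -EFin_max.
move: EX; rewrite unlock.
have -> : (\int[P]_w (X w)%:E = \int[P]_w (EFin \o X) w)%E by [].
rewrite integralE E1 E2 -EFinB => -[] /eqP.
by rewrite subr_eq0 => /eqP.
Qed.

End reciprocating.

(** * Exchanging a variable with its partner *)

Section swap.
Context d (T : measurableType d) (R : realType) (P : probability T R).
Implicit Types (X U : {RV P >-> R}) (x y c u : R).

(** Null for the weighted measure means null for P where the density is positive. *)
Lemma ae_not_null X (A : set T) : measurable A -> pos_measure X A = 0%E ->
  {ae P, forall w, 0 < X w -> ~ A w}.
Proof.
move=> mA nA.
have mD : measurable [set w | 0 < X w].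
  rewrite -[X in measurable X]setTI (_ : [set w | 0 < X w] = X @^-1` `]0, +oo[).
    by apply: measurable_funP => //; exact: measurable_itv.
  by rewrite set_itvE.
have mAD : measurable (A `&` [set w | 0 < X w]) by exact: measurableI.
have mpos : measurable_fun [set: T] (fun w => (pos_part X w)%:E).
  by apply/measurable_EFinP; exact: measurable_pos_part.
have I0 : (\int[P]_(w in A `&` [set w | (0 < X w)%R]) `|(pos_part X w)%:E| = 0)%E.
  apply/eqP; rewrite eq_le; apply/andP; split; last exact: integral_ge0.
  rewrite -nA -[pos_measure X A]/(\int[P]_(w in A) (pos_part X w)%:E)%E.
  rewrite (eq_integral (fun w => (pos_part X w)%:E)); last first.
    by move=> w _; rewrite gee0_abs// lee_fin pos_part_ge0.
  apply: ge0_subset_integral => //; first exact: measurable_funTS.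
  by move=> w _; rewrite lee_fin pos_part_ge0.
have mposAD : measurable_fun (A `&` [set w | 0 < X w]) (fun w => (pos_part X w)%:E).
  exact: measurable_funTS.
have H0 := (ae_eq_integral_abs P mAD mposAD).1 I0.
apply: filterS H0 => w H X0 Aw.
have [] : (pos_part X w)%:E = 0%E by exact: H (conj Aw X0).
by rewrite /pos_part max_l ?ltW// => X00; rewrite X00 ltxx in X0.
Qed.

Lemma ae_U01 U : has_law U (uniform_prob (@ltr01 R)) ->
  {ae P, forall w, 0 <= U w <= 1}.
Proof.
move=> lU.
have mI : measurable (`[0, 1]%classic : set R) by exact: measurable_itv.
have mU : measurable (U @^-1` `[0, 1]%classic).
  by rewrite -[X in measurable X]setTI; exact: measurable_funP.
have PU : P (U @^-1` `[0, 1]%classic) = 1%E.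
  by rewrite -[LHS]/(distribution P U _) lU// /uniform_prob integral_uniform_pdf1.
exists (~` (U @^-1` `[0, 1]%classic)); split.
- exact: measurableC.
- by rewrite probability_setC// PU subee.
- by move=> w /= nU; rewrite in_itv/=; exact: nU.
Qed.

(** The levels for which the generalized inverse is a finite positive number and gives
X back. *)
Definition generic_level X U w := [/\ 0 < pos_level X U w, pos_level X U w < pos_mass X &
  forall q : rat, ~ (ratr q < X w /\ pos_level X U w <= pos_cumul X (ratr q))].

Lemma ae_generic_level X U : pos_setting X U -> {ae P, forall w, 0 < X w -> generic_level X U w}.
Proof.
move=> s.
have a1 := ae_not_null (measurable_level_le s 0) (level_null_le0 s).
have mge : measurable [set w | pos_mass X <= pos_level X U w].
  rewrite -[X in measurable X]setTI; apply: measurable_fun_le => //.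
  exact: measurable_level s.
have a2 := ae_not_null mge (level_null_ge_mass s).
pose qn (n : nat) : rat := odflt 0%R (unpickle n).
have a3 : {ae P, forall w, forall n, 0 < X w ->
    ~ (ratr (qn n) < X w /\ pos_level X U w <= pos_cumul X (ratr (qn n)))}.
  apply: ae_foralln => n.
  apply: ae_not_null (level_null_below s (ratr (qn n))).
  rewrite (_ : [set w | _] = ~` [set w | X w <= ratr (qn n)] `&`
     [set w | pos_level X U w <= pos_cumul X (ratr (qn n))]).
    apply: measurableI; first by apply: measurableC; exact: qs_measurable_le s _.
    exact: measurable_level_le s _.
  apply/seteqP; split => w /= [A B]; split => //.
    by apply/negP; rewrite -ltNge.
  by rewrite ltNge; apply/negP.
apply: filterS3 a1 a2 a3 => w b1 b2 b3 X0; split.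
- by rewrite ltNge; apply/negP; exact: b1.
- by rewrite ltNge; apply/negP; exact: b2.
move=> q; have := b3 (pickle q) X0; rewrite /qn pickleK; exact.
Qed.

(** A real-valued version of xplus; the value 0 outside ]0, pos_mass X[ is arbitrary. *)
Definition quantile X c : R := if 0 < c < pos_mass X then fine (xplus X c%:E) else 0.

Lemma quantileE X U c : pos_setting X U -> P.-integrable [set: T] (EFin \o X) ->
  0 < c -> c < pos_mass X -> xplus X c%:E = (quantile X c)%:E /\ 0 < quantile X c.
Proof.
move=> s iX c0 cm; rewrite /quantile c0 cm/=.
by have [x [x0 -> _]] := xplus_mid s iX c0 cm.
Qed.

Lemma measurable_quantile X U : pos_setting X U -> P.-integrable [set: T] (EFin \o X) ->
  measurable_fun [set: R] (quantile X).
Proof.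
move=> s iX; rewrite /quantile; apply: measurable_fun_if => //.
  by apply: measurable_and; apply: measurable_fun_ltr.
rewrite setTI; set D := _ @^-1` _ => mD.
have DE : D = [set` `]0, pos_mass X[].
  by apply/seteqP; split => c; rewrite /D/= in_itv.
move: mD; rewrite DE => mD.
apply: (measurability (@RGenCInfty.G R)) => //; first exact: RGenCInfty.measurableE.
move=> /= _ [_ [r ->] <-].
apply: is_interval_measurable => a b /= [] + ra [] + rb c /andP[ac cb].
rewrite !in_itv/= !andbT in ra rb * => /andP[a0 am] /andP[b0 bm].
have c0 : 0 < c by exact: lt_le_trans ac.
have cm : c < pos_mass X by exact: le_lt_trans bm.
split; first by rewrite c0 cm.
have [xa [xa0 Ea mina]] := xplus_mid s iX a0 am.
have [xc [xc0 Ec minc]] := xplus_mid s iX c0 cm.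
rewrite Ea/= in ra; rewrite Ec/= (le_trans ra)//.
have : (xplus X a%:E <= xplus X c%:E)%E.
  apply: ereal_inf_le_tmp => y [y0 hy]; split => //.
  by apply: le_trans hy; rewrite lee_fin.
by rewrite Ea Ec lee_fin.
Qed.

Lemma quantile_level X U w : pos_setting X U -> 0 < X w -> generic_level X U w ->
  quantile X (pos_level X U w) = X w.
Proof.
by move=> s X0 [l0 lm gen]; rewrite /quantile l0 lm (xplus_level s X0 gen).
Qed.

(** A real-valued measurable version of the reciprocating function along (X, U), to
which it is equal almost surely where X is not 0; at X = 0 it is set to 0. *)
Definition partner X U w : R :=
  if 0 < X w then - quantile (negRV X) (pos_level X U w)
  else if X w < 0 then quantile X (pos_level (negRV X) U w) else 0.

(** What the comparison needs of a single pair (X, U). *)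
Record pair_setting X U : Prop := PairSetting {
  ps_mean : zero_mean X ;
  ps_law : has_law U (uniform_prob (@ltr01 R)) ;
  ps_indep : independent_maps P X U }.

Lemma ps_integrable X U : pair_setting X U -> P.-integrable [set: T] (EFin \o X).
Proof. by case=> -[]. Qed.

Lemma ps_setting X U : pair_setting X U -> pos_setting X U.
Proof. by move=> [[iX _] lU XU]; exact: pos_measure_setting. Qed.

Lemma ps_opp X U : pair_setting X U -> pair_setting (negRV X) U.
Proof.
move=> [[iX EX] lU XU]; split => //.
  split; first by have := integrableN iX; apply: eq_integrable.
  move: EX; rewrite !unlock.
  rewrite (_ : (\int[P]_w (negRV X w)%:E)%E = (\int[P]_w (- (X w)%:E))%E)//.
  rewrite integralN ?integrable_add_def//.
  by move=> ->; rewrite oppe0.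
move=> A B mA mB; have := XU (-%R @^-1` A) B; apply => //.
by rewrite -[X in measurable X]setTI; exact: oppr_measurable.
Qed.

Lemma ps_mass X U : pair_setting X U -> pos_mass (negRV X) = pos_mass X.
Proof. by move=> [zX _ _]; rewrite (mass_opp zX). Qed.

Lemma ae_partner_pos X U : pair_setting X U -> {ae P, forall w, 0 < X w ->
  [/\ recipX X U w = (partner X U w)%:E, partner X U w < 0 &
      quantile X (pos_level X U w) = X w]}.
Proof.
move=> ps; have s := ps_setting ps; have s' := ps_setting (ps_opp ps).
have i' := ps_integrable (ps_opp ps).
apply: filterS2 (ae_U01 (ps_law ps)) (ae_generic_level s) => w U01 H X0.
have [l0 lm gen] := H X0.
have [E q0] := quantileE s' i' l0 (eq_ind _ (fun z => pos_level X U w < z) lm _ (esym (ps_mass ps))).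
rewrite /partner X0 (recipX_pos s U01 X0) E EFinN; split => //.
  by rewrite oppr_lt0.
exact: quantile_level s X0 (H X0).
Qed.

Lemma ae_partner_neg X U : pair_setting X U -> {ae P, forall w, X w < 0 ->
  [/\ recipX X U w = (partner X U w)%:E, 0 < partner X U w &
      quantile (negRV X) (pos_level (negRV X) U w) = - X w]}.
Proof.
move=> ps; have s := ps_setting ps; have s' := ps_setting (ps_opp ps).
have i := ps_integrable ps.
apply: filterS2 (ae_U01 (ps_law ps)) (ae_generic_level s') => w U01 H X0.
have X0' : 0 < negRV X w by rewrite /= oppr_gt0.
have [l0 lm gen] := H X0'.
have [E q0] := quantileE s i l0 (eq_ind _ (fun z => pos_level (negRV X) U w < z) lm _ (ps_mass ps)).
rewrite /partner ltNge (ltW X0)/= X0 (recipX_neg s' U01 X0) E; split => //.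
exact: quantile_level s' X0' (H X0').
Qed.

Lemma measurable_pos_level X U : pos_setting X U -> measurable_fun [set: T] (pos_level X U).
Proof. exact: measurable_level. Qed.

Lemma measurable_partner X U : pair_setting X U ->
  measurable_fun [set: T] (partner X U).
Proof.
move=> ps; have s := ps_setting ps; have s' := ps_setting (ps_opp ps).
apply: measurable_fun_ifT.
- exact: measurable_fun_ltr.
- apply: measurable_funN; apply: measurableT_comp (measurable_pos_level s).
  exact: measurable_quantile s' (ps_integrable (ps_opp ps)).
- apply: measurable_fun_ifT => //; first exact: measurable_fun_ltr.
  apply: measurableT_comp (measurable_pos_level s').
  exact: measurable_quantile s (ps_integrable ps).
Qed.

(** Both laws are uniform, and the total masses agree because X is centred. *)
Lemma level_law_eq X U (B : set R) : pair_setting X U -> measurable B ->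
  pos_measure X (pos_level X U @^-1` B) = pos_measure (negRV X) (pos_level (negRV X) U @^-1` B).
Proof.
move=> ps mB; have s := ps_setting ps; have s' := ps_setting (ps_opp ps).
pose L : {mfun T >-> R} := HB.pack (pos_level X U) (isMeasurableFun.Build _ _ _ _ _ (measurable_pos_level s)).
pose L' : {mfun T >-> R} := HB.pack (pos_level (negRV X) U) (isMeasurableFun.Build _ _ _ _ _ (measurable_pos_level s')).
have H (c : R) : pushforward (pos_measure X) L `]-oo, c[%classic =
    pushforward (pos_measure (negRV X)) L' `]-oo, c[%classic.
  rewrite /pushforward !set_itvE.
  rewrite -[LHS]/(pos_measure X [set w | pos_level X U w < c]).
  rewrite -[RHS]/(pos_measure (negRV X) [set w | pos_level (negRV X) U w < c]).
  rewrite (level_law_lt s c) (level_law_lt s' c).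
  by rewrite -[mass _]/(pos_mass X) -(ps_mass ps).
rewrite -[LHS]/(pushforward (pos_measure X) L B) -[RHS]/(pushforward (pos_measure (negRV X)) L' B).
apply: (measure_unique (@RGenInftyO.G R) (fun n : nat => `]-oo, n%:R[%classic)) => //.
- exact: RGenInftyO.measurableE.
- move=> _ _ [a ->] [b ->]; exists (Num.min a b).
  by apply/seteqP; split => x /=; rewrite !in_itv/= lt_min => /andP.
- by move=> n; exists n%:R.
- rewrite -subTset => x _; exists (Num.truncn x).+1 => //=.
  by rewrite in_itv/= truncnS_gt.
- by move=> _ [c ->]; exact: H.
- move=> n; rewrite /= /pushforward set_itvE.
  rewrite -[X in (X < _)%E]/(pos_measure X [set w | pos_level X U w < n%:R]).
  by rewrite (level_law_lt s) ltry.
Qed.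

(** Both sides integrate the same function of the level: at level c the pair is
formed by the upper and the lower quantile of c, whichever of the two is the
value of X. By level_law_eq the level has the same law under the two weighted
measures. *)
Lemma swap_identity X U (psi : R * R -> \bar R) : pair_setting X U ->
  measurable_fun [set: R * R] psi -> (forall z, 0 <= psi z)%E ->
  (\int[P]_w ((pos_part X w)%:E * psi (X w, partner X U w)) =
   \int[P]_w ((pos_part (negRV X) w)%:E * psi (partner X U w, X w)))%E.
Proof.
move=> ps mpsi psi0; have s := ps_setting ps; have s' := ps_setting (ps_opp ps).
have mL := measurable_pos_level s; have mL' := measurable_pos_level s'.
have mq := measurable_quantile s (ps_integrable ps).
have mq' := measurable_quantile s' (ps_integrable (ps_opp ps)).
have mR := measurable_partner ps.
pose Psi c := psi (quantile X c, - quantile (negRV X) c).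
have mPsi : measurable_fun [set: R] Psi.
  apply: measurableT_comp mpsi _; apply: measurable_fun_pair => //.
  exact: measurable_funN.
have mpos (Y : {RV P >-> R}) : measurable_fun [set: T] (fun w => (pos_part Y w)%:E).
  by apply/measurable_EFinP; exact: measurable_pos_part.
have m1 : measurable_fun [set: T] (fun w => (pos_part X w)%:E * psi (X w, partner X U w))%E.
  apply: emeasurable_funM => //; apply: measurableT_comp mpsi _.
  exact: measurable_fun_pair.
have m2 : measurable_fun [set: T] (fun w => (pos_part (negRV X) w)%:E * psi (partner X U w, X w))%E.
  apply: emeasurable_funM => //; apply: measurableT_comp mpsi _.
  exact: measurable_fun_pair.
have p0 (Y : {RV P >-> R}) w : (0 <= (pos_part Y w)%:E)%E by rewrite lee_fin pos_part_ge0.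
pose L : {mfun T >-> R} := HB.pack (pos_level X U) (isMeasurableFun.Build _ _ _ _ _ mL).
pose L' : {mfun T >-> R} := HB.pack (pos_level (negRV X) U) (isMeasurableFun.Build _ _ _ _ _ mL').
transitivity (\int[P]_w ((pos_part X w)%:E * Psi (pos_level X U w)))%E.
  apply: ge0_ae_eq_integral => //.
  - by apply: emeasurable_funM => //; exact: measurableT_comp mPsi mL.
  - by move=> w _; rewrite /Psi mule_ge0.
  - by move=> w _; rewrite /Psi mule_ge0.
  apply: filterS (ae_partner_pos ps) => w H _.
  have [X0|X0] := ltP 0 (X w); last by rewrite /pos_part max_r// !mul0e.
  have [_ _ E] := H X0.
  by rewrite /Psi E /partner X0.
transitivity (\int[P]_w ((pos_part (negRV X) w)%:E * Psi (pos_level (negRV X) U w)))%E; last first.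
  apply: ge0_ae_eq_integral => //.
  - by apply: emeasurable_funM => //; exact: measurableT_comp mPsi mL'.
  - by move=> w _; rewrite /Psi mule_ge0.
  - by move=> w _; rewrite /Psi mule_ge0.
  apply: filterS (ae_partner_neg ps) => w H _.
  have [X0|X0] := ltP (X w) 0; last first.
    by rewrite /pos_part max_r/= ?oppr_le0// !mul0e.
  have [_ _ E] := H X0.
  by rewrite /Psi E opprK /partner ltNge (ltW X0)/= X0.
have Psi0 c : (0 <= Psi c)%E by exact: psi0.
transitivity (\int[pos_measure X]_w Psi (pos_level X U w))%E.
  rewrite ge0_integral_weighted//; first exact: measurableT_comp mPsi mL.
transitivity (\int[pos_measure (negRV X)]_w Psi (pos_level (negRV X) U w))%E; last first.
  rewrite ge0_integral_weighted//; first exact: measurableT_comp mPsi mL'.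
transitivity (\int[pushforward (pos_measure X) L]_y Psi y)%E.
  by rewrite ge0_integral_pushforward// => y _; exact: psi0.
transitivity (\int[pushforward (pos_measure (negRV X)) L']_y Psi y)%E; last first.
  by rewrite ge0_integral_pushforward// => y _; exact: psi0.
by apply: eq_measure_integral => A mA _; exact: level_law_eq.
Qed.

End swap.

(** * Comparison for a single variable *)

Lemma measurable_natr_bool d (T : measurableType d) (R : realType) (b : T -> bool) :
  measurable_fun [set: T] b -> measurable_fun [set: T] (fun z => (b z)%:R : R).
Proof.
move=> mb; rewrite (_ : (fun z => _) = (fun z => if b z then 1 else 0 : R)).
  exact: measurable_fun_ifT.
by apply/funext => z; case: (b z).
Qed.

Section partner_inequality.
Context d (T : measurableType d) (R : realType) (P : probability T R).
Implicit Types (X U : {RV P >-> R}).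

(** On X < 0 one has max (- X, 0) reflected g (R, X) = g (X, R). The power - 1 is used
in place of the inverse because it is a measurable function. *)
Definition reflected (g : R * R -> R) (z : R * R) : R :=
  (z.2 < 0)%R%:R * g (z.2, z.1) * (- z.2) `^ (-1).

Lemma measurable_reflected g : measurable_fun [set: R * R] g ->
  measurable_fun [set: R * R] (reflected g).
Proof.
move=> mg; apply: measurable_funM.
  apply: measurable_funM.
    by apply: measurable_natr_bool; exact: measurable_fun_ltr.
  by apply: measurableT_comp mg _; exact: measurable_fun_pair.
apply: (measurableT_comp (measurable_powR (-1)) (g := fun z : R * R => - z.2)).
exact: measurable_funN.
Qed.

Lemma reflected_ge0 g z : (forall z, 0 <= g z) -> 0 <= reflected g z.
Proof. by move=> g0; rewrite /reflected !mulr_ge0 ?powR_ge0. Qed.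

(** The contribution of X < 0 is carried over to X > 0 by swap_identity; afterwards
only configurations with X = b > 0 and R = - a < 0 remain, and g (b, - a) and
g (- a, b) enter with the weights 1 and b / a. *)
Lemma integral_by_sign X U (g : R * R -> R) : pair_setting X U ->
  measurable_fun [set: R * R] g -> (forall z, 0 <= g z) ->
  (\int[P]_w (g (X w, partner X U w))%:E =
   \int[P]_w ((0 <= X w)%R%:R * g (X w, partner X U w) +
     pos_part X w * reflected g (X w, partner X U w))%:E)%E.
Proof.
move=> ps mg g0.
have mR := measurable_partner ps.
have mXR : measurable_fun [set: T] (fun w => (X w, partner X U w)) by exact: measurable_fun_pair.
have mRX : measurable_fun [set: T] (fun w => (partner X U w, X w)) by exact: measurable_fun_pair.
have mpsi := measurable_reflected mg.
have mg' := measurableT_comp mg mXR.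
have mpos (Y : {RV P >-> R}) : measurable_fun [set: T] (pos_part Y) by exact: measurable_pos_part.
have m1 : measurable_fun [set: T] (fun w => ((0 <= X w)%R%:R * g (X w, partner X U w))%:E).
  apply/measurable_EFinP; apply: measurable_funM => //.
  by apply: measurable_natr_bool; exact: measurable_fun_ler.
have p1 w : (0 <= ((0 <= X w)%R%:R * g (X w, partner X U w))%:E)%E.
  by rewrite lee_fin mulr_ge0.
have p2 (Y : {RV P >-> R}) z w : (0 <= (pos_part Y w * reflected g z)%:E)%E.
  by rewrite lee_fin mulr_ge0 ?pos_part_ge0 ?reflected_ge0.
under [RHS]eq_integral do rewrite EFinD.
rewrite ge0_integralD//=; last first.
  apply/measurable_EFinP; apply: measurable_funM => //.
  exact: measurableT_comp mpsi mXR.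
have -> : (\int[P]_w (pos_part X w * reflected g (X w, partner X U w))%:E =
    \int[P]_w (pos_part (negRV X) w * reflected g (partner X U w, X w))%:E)%E.
  have := @swap_identity _ _ _ P X U (EFin \o reflected g) ps.
  by apply; [exact/measurable_EFinP|move=> z; rewrite lee_fin reflected_ge0].
rewrite -ge0_integralD//=; last first.
  apply/measurable_EFinP; apply: measurable_funM => //.
  exact: measurableT_comp mpsi mRX.
apply: eq_integral => w _; rewrite -EFinD /reflected/= /pos_part/=.
have [X0|X0] := ltP (X w) 0.
  rewrite !mul1r mul0r add0r max_l ?oppr_ge0 ?(ltW X0)//.
  rewrite powR_inv1 ?oppr_ge0 ?(ltW X0)// mulrC mulfVK//.
  by rewrite oppr_eq0 lt_eqF.
by rewrite !mul0r mulr0 addr0 mul1r.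
Qed.

(** An almost sure version of the weight Y, finite everywhere. *)
Definition partner_product X U w : R := `|X w * partner X U w|.

Lemma asym_partner (p : R) X U w : 0 < p -> 0 < X w ->
  recipX X U w = (partner X U w)%:E -> partner X U w < 0 ->
  (asym_ratio X U w <= ((1 - p) / p)%:E)%E -> X w * p <= (1 - p) * - partner X U w.
Proof.
move=> p0 X0 E r0; rewrite /asym_ratio E X0 mule1 abse_EFin ltr0_norm//.
rewrite inver oppr_eq0 (lt_eqF r0) -EFinM lee_fin.
by rewrite ler_pdivrMr ?oppr_gt0// mulrAC ler_pdivlMr.
Qed.

Lemma bern_step_spread0 (p x : R) f : bern_step p 0 f x = f x.
Proof. by rewrite /bern_step !mul0r !addr0; ring. Qed.

(** After integral_by_sign the claim is two_point, divided by a, with X = b and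
R = - a. The function may depend on the product of X and R, because this product
is invariant under the exchange. *)
Lemma partner_inequality (p : R) X U (phi dphi : R -> R -> R) : 0 < p < 1 ->
  pair_setting X U ->
  {ae P, forall w, (asym_ratio X U w <= ((1 - p) / p)%:E)%E} ->
  measurable_fun [set: R * R] (fun z => phi z.1 z.2) ->
  (forall y x, 0 <= phi y x) ->
  (forall y : R, (forall x : R, is_derive x 1 (phi y) (dphi y x)) /\ convex3 (dphi y)) ->
  (\int[P]_w (phi (partner_product X U w) (X w))%:E <=
   \int[P]_w (bern_step p (Num.sqrt (partner_product X U w)) (phi (partner_product X U w)) 0)%:E)%E.
Proof.
move=> p01 ps ratio mphi phi0 dphiP; have /andP[p0 p1] := p01.
have mR := measurable_partner ps.
have mXR : measurable_fun [set: T] (fun w => (X w, partner X U w)) by exact: measurable_fun_pair.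
have mabs : measurable_fun [set: R * R] (fun z => `|z.1 * z.2|).
  by apply: measurableT_comp => //; exact: measurable_funM.
pose g1 (z : R * R) := phi `|z.1 * z.2| z.1.
pose g2 (z : R * R) := bern_step p (Num.sqrt `|z.1 * z.2|) (phi `|z.1 * z.2|) 0.
have mg1 : measurable_fun [set: R * R] g1.
  apply: (measurableT_comp mphi (g := fun z : R * R => (`|z.1 * z.2|, z.1))).
  exact: measurable_fun_pair.
have msqrt : measurable_fun [set: R * R] (fun z => Num.sqrt `|z.1 * z.2|).
  have ms : measurable_fun [set: R] (@Num.sqrt R).
    by apply: continuous_measurable_fun; exact: sqrt_continuous.
  exact: measurableT_comp ms mabs.
have mg2 : measurable_fun [set: R * R] g2.
  have H (c : R) : measurable_fun [set: R * R]
      (fun z => phi `|z.1 * z.2| (0 + Num.sqrt `|z.1 * z.2| * c)).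
    apply: (measurableT_comp mphi (g := fun z : R * R => (`|z.1 * z.2|, 0 + Num.sqrt `|z.1 * z.2| * c))).
    apply: measurable_fun_pair => //; apply: measurable_funD => //.
    exact: measurable_funM.
  by apply: measurable_funD; apply: measurable_funM => //; exact: H.
have g10 z : 0 <= g1 z by exact: phi0.
have g20 z : 0 <= g2 z.
  by rewrite /g2 /bern_step addr_ge0// mulr_ge0// ltW// subr_gt0.
rewrite (integral_by_sign ps mg1 g10) (integral_by_sign ps mg2 g20).
have mside (g : R * R -> R) : measurable_fun [set: R * R] g -> measurable_fun [set: T]
   (fun w => ((0 <= X w)%R%:R * g (X w, partner X U w) +
     pos_part X w * reflected g (X w, partner X U w))%:E).
  move=> mg; apply/measurable_EFinP; apply: measurable_funD; apply: measurable_funM => //.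
  - by apply: measurable_natr_bool; exact: measurable_fun_ler.
  - exact: measurableT_comp mg mXR.
  - exact: measurable_pos_part.
  - exact: measurableT_comp (measurable_reflected mg) mXR.
have pside (g : R * R -> R) : (forall z, 0 <= g z) -> forall w, (0 <= ((0 <= X w)%R%:R * g (X w, partner X U w) +
     pos_part X w * reflected g (X w, partner X U w))%:E)%E.
  by move=> g0 w; rewrite lee_fin addr_ge0// mulr_ge0 ?pos_part_ge0 ?reflected_ge0.
apply: ae_ge0_le_integral => //; do ?[exact: mside]; do ?[by move=> w _; exact: pside].
apply: filterS2 ratio (ae_partner_pos ps) => w rat part _.
rewrite lee_fin.
have [X0|X0|X0] := ltrgtP (X w) 0.
- by rewrite /pos_part max_r ?(ltW X0)// !mul0r.
- have [E r0 _] := part X0.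
  have := asym_partner p0 X0 E r0 rat.
  rewrite /pos_part max_l ?(ltW X0)// !mul1r /reflected/= r0 !mul1r.
  rewrite powR_inv1 ?oppr_ge0 ?(ltW r0)//.
  rewrite /g1 /g2/= [_ * X w as X in `|X|]mulrC.
  set b := X w in X0 *; set r := partner X U w in r0 *.
  have -> : `|b * r| = - r * b by rewrite normrM (gtr0_norm X0) (ltr0_norm r0) mulrC.
  set y := - r * b => bp.
  have a0 : 0 < - r by rewrite oppr_gt0.
  have [d1 c1] := dphiP y.
  have := two_point 0 p01 a0 X0 bp d1 c1; rewrite -/y !add0r opprK.
  have ai0 : 0 < (- r)^-1 by rewrite invr_gt0.
  have ra1 : (- r)^-1 * - r = 1 by rewrite mulVf// oppr_eq0 lt_eqF.
  set F1 := phi y b; set F2 := phi y r; set B := bern_step _ _ _ _ => H.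
  have : 0 <= (- r)^-1 * ((- r + b) * B - (- r * F1 + b * F2)).
    by rewrite mulr_ge0 ?subr_ge0 ?(ltW ai0).
  have -> : (- r)^-1 * ((- r + b) * B - (- r * F1 + b * F2)) =
      ((- r)^-1 * - r) * (B - F1) + b * (B * (- r)^-1) - b * (F2 * (- r)^-1) by ring.
  by rewrite ra1; lra.
- by rewrite /pos_part X0 maxxx !mul0r !addr0 !mul1r /g1 /g2/= mul0r normr0 sqrtr0 bern_step_spread0.
Qed.

End partner_inequality.

(** * Measurability of the self-normalization *)

Lemma nondecreasing_emeasurable (R : realType) (f : R -> \bar R) :
  {homo f : x y / x <= y >-> (x <= y)%E} -> measurable_fun [set: R] f.
Proof.
move=> mono; apply: (measurability (@ErealGenCInfty.G R)).
  exact: ErealGenCInfty.measurableE.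
move=> _ [_ [r ->] <-]; rewrite setTI.
apply: is_interval_measurable => a b /= + _ c /andP[ac _].
by rewrite !in_itv/= !andbT => ra; exact: le_trans ra (mono _ _ ac).
Qed.

Section measurable_versions.
Context d (T : measurableType d) (R : realType) (P : probability T R).
Implicit Types (X U : {RV P >-> R}).

Lemma measurable_xplus X : measurable_fun [set: R] (fun c => xplus X c%:E).
Proof.
apply: nondecreasing_emeasurable => a b ab.
apply: ereal_inf_le_tmp => y [y0 hy]; split => //.
by apply: le_trans hy; rewrite lee_fin.
Qed.

Lemma measurable_pos_cumul X U : pos_setting X U -> measurable_fun [set: R] (pos_cumul X).
Proof. exact: measurable_cumul. Qed.

Lemma measurable_pos_cumul_lt X U : pos_setting X U -> measurable_fun [set: R] (pos_cumul_lt X).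
Proof. exact: measurable_cumul_lt. Qed.

(** The level with the value of X and the randomization as separate arguments. This
gives measurability for the sigma-algebra of the pair, and it also covers the
randomization that is 1 off the atoms. *)
Definition interpolate X (z : R * R) : R :=
  pos_cumul_lt X z.1 + z.2 * (pos_cumul X z.1 - pos_cumul_lt X z.1).

Lemma measurable_interpolate X U : pos_setting X U ->
  measurable_fun [set: R * R] (interpolate X).
Proof.
move=> s; have mc := measurableT_comp (measurable_pos_cumul s) (@measurable_fst _ _ R R).
have ml := measurableT_comp (measurable_pos_cumul_lt s) (@measurable_fst _ _ R R).
apply: measurable_funD => //; apply: measurable_funM => //.
exact: measurable_funB.
Qed.

(** The partner as a function of the values of X and U, so that it is measurable for
the sigma-algebra of this pair. *)
Definition partner_of X (z : R * R) : R :=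
  if 0 < z.1 then - quantile (negRV X) (interpolate X (z.1, clamp z.2))
  else if z.1 < 0 then quantile X (interpolate (negRV X) (- z.1, clamp z.2)) else 0.

Lemma measurable_partner_of X U : pair_setting X U ->
  measurable_fun [set: R * R] (partner_of X).
Proof.
move=> ps; have s := ps_setting ps; have s' := ps_setting (ps_opp ps).
have mcl : measurable_fun [set: R * R] (fun z => clamp z.2).
  exact: measurableT_comp (@measurable_clamp R) (@measurable_snd _ _ R R).
apply: measurable_fun_ifT.
- exact: measurable_fun_ltr.
- apply: measurable_funN.
  apply: (measurableT_comp (measurable_quantile s' (ps_integrable (ps_opp ps)))).
  apply: (measurableT_comp (measurable_interpolate s)).
  exact: measurable_fun_pair.
- apply: measurable_fun_ifT => //; first exact: measurable_fun_ltr.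
  apply: (measurableT_comp (measurable_quantile s (ps_integrable ps))).
  apply: (measurableT_comp (measurable_interpolate s')).
  by apply: measurable_fun_pair => //; exact: measurable_funN.
Qed.

(** The probability of the atom at x is the jump of the distribution function at x,
hence a measurable function of x. *)
Lemma measurable_randomize X U : measurable_fun [set: T] (randomize X U).
Proof.
have mle y : measurable [set w | X w <= y].
  by rewrite -[X in measurable X]setTI; apply: measurable_fun_le.
have mlt y : measurable [set w | X w < y].
  rewrite -[X in measurable X]setTI (_ : [set w | X w < y] = X @^-1` `]-oo, y[).
    by apply: measurable_funP => //; exact: measurable_itv.
  by rewrite set_itvE.
pose a y := fine (P [set w | X w <= y]).
pose b y := fine (P [set w | X w < y]).
have ma : measurable_fun [set: R] a.
  apply: nondecreasing_measurable => // x y xy; apply: fine_le; rewrite ?fin_num_measure//.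
  by apply: le_measure; rewrite ?inE// => w wx; exact: le_trans (_ : X w <= x) xy.
have mb : measurable_fun [set: R] b.
  apply: nondecreasing_measurable => // x y xy; apply: fine_le; rewrite ?fin_num_measure//.
  by apply: le_measure; rewrite ?inE// => w /= /lt_le_trans; exact.
have PE x : (P (X @^-1` [set x]) != 0%E) = (b x < a x).
  have mx : measurable (X @^-1` [set x]).
    by rewrite -[X in measurable X]setTI; exact: measurable_funP.
  have : P [set w | X w <= x] = (P [set w | (X w < x)%R] + P (X @^-1` [set x]))%E.
    rewrite -measureU//; last first.
      by apply/seteqP; split => w //= [+ xw]; rewrite xw ltxx.
    congr (P _); apply/seteqP; split => w /=.
      by rewrite le_eqVlt => /orP[/eqP ->|]; [right|left].
    by move=> [/ltW|->].
  rewrite /a /b => ->; rewrite fineD ?fin_num_measure// ltrDl.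
  by rewrite lt_neqAle fine_ge0// andbT [in RHS]eq_sym fine_eq0// fin_num_measure.
rewrite /randomize; under eq_fun do rewrite PE.
apply: measurable_fun_ifT => //.
by apply: measurable_fun_ltr; [exact: measurableT_comp mb _|exact: measurableT_comp ma _].
Qed.

(** Where X vanishes the product is 0, so that only the branches X > 0 and X < 0 of
the reciprocating function matter, on which recH is the interpolated
distribution function. An almost sure identity would not be enough: the tail is
the probability of an event that has to be measurable. *)
Lemma measurable_Yprod X U : pair_setting X U -> measurable_fun [set: T] (Yprod X U).
Proof.
move=> ps; have s := ps_setting ps; have s' := ps_setting (ps_opp ps).
have mV := measurable_randomize X U.
have mh (Y : {RV P >-> R}) (sY : pos_setting Y U) (Z : {RV P >-> R}) : measurable_fun [set: T]
    (fun w => xplus Z (interpolate Y (Y w, randomize X U w))%:E).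
  apply: (measurableT_comp (measurable_xplus Z)).
  apply: (measurableT_comp (measurable_interpolate sY)).
  exact: measurable_fun_pair.
rewrite (_ : Yprod X U = fun w =>
   if 0 < X w then `|(X w)%:E * - xplus (negRV X) (interpolate X (X w, randomize X U w))%:E|%E
   else if X w < 0 then `|(X w)%:E * xplus X (interpolate (negRV X) (negRV X w, randomize X U w))%:E|%E
   else 0%E).
  apply: measurable_fun_ifT; first exact: measurable_fun_ltr.
    apply: measurableT_comp => //; apply: emeasurable_funM; first exact/measurable_EFinP.
    by apply: measurableT_comp (mh _ s _); exact: oppe_measurable.
  apply: measurable_fun_ifT => //; first exact: measurable_fun_ltr.
  apply: measurableT_comp => //; apply: emeasurable_funM; first exact/measurable_EFinP.
  exact: mh _ s' _.
apply/funext => w; rewrite /Yprod /recipX /recip.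
have [X0|X0|->] := ltrgtP (X w) 0; last by rewrite mul0e abse0.
- by rewrite (recH_neg _ s').
- by rewrite xminus_opp (recH_pos _ s).
Qed.

Lemma ae_Yprod X U : pair_setting X U -> {ae P, forall w, Yprod X U w = (partner_product X U w)%:E}.
Proof.
move=> ps; apply: filterS2 (ae_partner_pos ps) (ae_partner_neg ps) => w A B.
rewrite /Yprod /partner_product.
have [X0|X0|->] := ltrgtP (X w) 0; last by rewrite mul0e abse0 mul0r normr0.
- by have [-> _ _] := B X0; rewrite -EFinM.
- by have [-> _ _] := A X0; rewrite -EFinM.
Qed.

End measurable_versions.

(** * Replacing the variables one at a time *)

Section block_measurability.
Context d (T : measurableType d) (R : realType) (P : probability T R).
Context (I : finType) (W : I -> {mfun T >-> R}).
Local Notation blk J := (g_sigma_algebraType (block_gen W J)).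

Lemma block_gen_measurable (J : {set I}) : <<s block_gen W J >> `<=` measurable.
Proof.
apply: smallest_sub; first exact: sigma_algebra_measurable.
by move=> _ [i _ [B mB <-]]; exact: measurable_funP.
Qed.

Lemma measurable_blk d' (T' : measurableType d') (J : {set I}) (f : T -> T') :
  measurable_fun [set: blk J] f -> measurable_fun [set: T] f.
Proof.
by move=> mf _ B mB; apply: block_gen_measurable; exact: mf.
Qed.

Lemma measurable_blkS d' (T' : measurableType d') (J K : {set I}) (f : T -> T') :
  J \subset K -> measurable_fun [set: blk J] f -> measurable_fun [set: blk K] f.
Proof.
move=> JK mf _ B mB; have := mf measurableT B mB.
apply: smallest_sub; first exact: smallest_sigma_algebra.
move=> S [i iJ H]; apply: sub_sigma_algebra; exists i => //.
by rewrite /= (fintype.subsetP JK).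
Qed.

Lemma measurable_coord (J : {set I}) i : i \in J -> measurable_fun [set: blk J] (W i).
Proof.
move=> iJ _ B mB; apply: sub_sigma_algebra; exists i => //.
by exists B.
Qed.

Lemma maps_of_blocks_independent d1 (T1 : measurableType d1) d2 (T2 : measurableType d2)
  (J K : {set I}) (C : T -> T1) (D : T -> T2) : independent_coords P W ->
  (forall i, i \in J -> i \notin K) ->
  measurable_fun [set: blk J] C -> measurable_fun [set: blk K] D ->
  independent_maps P C D.
Proof.
move=> indep JK mC mD A B mA mB; apply: (blocks_independent indep JK).
  by have := mC measurableT A mA; rewrite setTI.
by have := mD measurableT B mB; rewrite setTI.
Qed.

Lemma measurable_blk_sum (eqJ : eqType) (V : eqJ -> T -> R) (K : {set I}) (l : seq eqJ) :
    (forall j, j \in l -> measurable_fun [set: blk K] (V j)) ->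
    measurable_fun [set: blk K] (fun w => \sum_(j <- l) V j w).
Proof.
elim: l => [|j l IHl] mV.
  by under eq_fun do rewrite big_nil; exact: measurable_cst.
under eq_fun do rewrite big_cons; apply: measurable_funD.
  by apply: mV; exact: mem_head.
by apply: IHl => k kl; apply: mV; rewrite inE kl orbT.
Qed.

End block_measurability.

Lemma independent_coords_of_mutual d (T : measurableType d) (R : realType)
    (P : probability T R) n (V : 'I_n -> {RV P >-> R}) :
  mutually_independent V -> independent_coords P V.
Proof.
move=> iV B mB; have := iV [set: 'I_n]%SET B mB.
rewrite (_ : [set` [set: 'I_n]%SET] = [set: 'I_n]); last first.
  by apply/seteqP; split => i //= _; rewrite inE.
by move=> ->; apply: eq_bigl => i; rewrite inE.
Qed.

Section joint.
Context d (T : measurableType d) (R : realType) (P : probability T R).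
Context (n : nat) (X U : 'I_n -> {RV P >-> R}).

(** All the variables as one family, whose blocks are then the pairs (X_i, U_i). *)
Definition joint (s : 'I_n + 'I_n) : {mfun T >-> R} :=
  match s with inl i => X i | inr i => U i end.

Lemma sigma_of_preimage (V : 'I_n -> {RV P >-> R}) i (A : set R) :
  measurable A -> sigma_of V (V i @^-1` A).
Proof.
move=> mA; apply: sub_sigma_algebra; exists i => //.
by exists A => //; rewrite setTI.
Qed.

Lemma sigma_of_cap (V : 'I_n -> {RV P >-> R}) (A : 'I_n -> set R) :
  (forall i, measurable (A i)) -> sigma_of V (\bigcap_i (V i @^-1` A i)).
Proof.
move=> mA; have sV := smallest_sigma_algebra [set: T]
  (\bigcup_i preimage_set_system [set: T] (V i) measurable).
apply: (@fin_bigcap_measurable _ (g_sigma_algebraType (\bigcup_i preimage_set_system [set: T] (V i) measurable))).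
  exact: finite_finset.
by move=> i _; exact: sigma_of_preimage.
Qed.

(** Independence inside each of the two families together with the independence of
the families. *)
Lemma joint_independent : mutually_independent X -> mutually_independent U ->
  independent_families X U -> independent_coords P joint.
Proof.
move=> iX iU XU A mA.
have -> : \bigcap_s (joint s @^-1` A s) =
    (\bigcap_i (X i @^-1` A (inl i))) `&` (\bigcap_i (U i @^-1` A (inr i))).
  apply/seteqP; split => w /=; first by move=> H; split => i _; exact: (H _ Logic.I).
  by move=> [HX HU] [i|i] _; [exact: HX|exact: HU].
rewrite XU; last 2 first.
- by apply: sigma_of_cap.
- by apply: sigma_of_cap.
rewrite !independent_coords_of_mutual//.
by rewrite big_sumType.
Qed.

Lemma pair_independent i : independent_families X U -> independent_maps P (X i) (U i).
Proof. by move=> XU A B mA mB; apply: XU; exact: sigma_of_preimage. Qed.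

End joint.

Section convexity.
Context {R : realType}.
Implicit Types (f g h : R -> R) (x y z : R).

(** By the mean value theorem, the slopes on consecutive intervals are values of the
nondecreasing function h at increasing points. *)
Lemma convex3_antiderivative g h : (forall x, is_derive x 1 g (h x)) ->
  {homo h : x y / x <= y} -> convex3 g.
Proof.
move=> dg mh x y z /andP[].
rewrite le_eqVlt => /predU1P[<- _|xy]; first by rewrite subrr mul0r addr0.
rewrite le_eqVlt => /predU1P[->|yz]; first by rewrite subrr mul0r add0r.
have mvt a b : a < b -> exists2 c, a < c < b & g b - g a = h c * (b - a).
  move=> ab; have [c cab E] := MVT ab (fun t _ => dg t)
    (is_derive_within_continuous (fun t _ => dg t)).
  by exists c; rewrite // in_itv in cab.
have [c1 /andP[_ c1y] E1] := mvt _ _ xy.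
have [c2 /andP[yc2 _] E2] := mvt _ _ yz.
have hc : h c1 <= h c2 by apply: mh; exact: ltW (lt_trans c1y yc2).
have : 0 <= (h c2 - h c1) * ((z - y) * (y - x)).
  by rewrite mulr_ge0 ?mulr_ge0 ?subr_ge0// ltW.
have -> : g z = h c2 * (z - y) + g y by rewrite -E2 subrK.
have -> : g x = g y - h c1 * (y - x) by rewrite -E1 opprB addrC subrK.
by lra.
Qed.

Lemma smooth3_convex_deriv f g h : smooth3 f g h -> convex3 g.
Proof. by move=> [_ dg _ mh _]; exact: convex3_antiderivative dg mh. Qed.

Lemma smooth3_convex f g h : smooth3 f g h -> convex3 f.
Proof.
move=> [df dg _ _ h0]; apply: (convex3_antiderivative df) => x y xy.
exact: (derive_ge0_le (g := h)).
Qed.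

Lemma convex3_scale g (a c k : R) : 0 <= c -> 0 <= k -> convex3 g ->
  convex3 (fun x => c * g ((a + x) * k)).
Proof.
move=> c0; rewrite le_eqVlt => /predU1P[<- _|k0 cg] x y z xyz.
  by rewrite !mulr0; lra.
have /andP[xy yz] := xyz.
have := cg ((a + x) * k) ((a + y) * k) ((a + z) * k).
rewrite !ler_pM2r// !lerD2l xy yz => /(_ isT).
set gx := g ((a + x) * k); set gy := g ((a + y) * k); set gz := g ((a + z) * k).
move=> H.
have : (z - x) * gy <= (z - y) * gx + (y - x) * gz.
  by rewrite -(ler_pM2l k0); lra.
by move=> /(ler_wpM2l c0); lra.
Qed.

End convexity.

Section hybrid.
Context d (T : measurableType d) (R : realType) (P : probability T R).
Context (n : nat) (X U : 'I_n -> {RV P >-> R}).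
Local Notation I := ('I_n + 'I_n)%type.
Local Notation W := (joint X U).
Local Notation blk J := (g_sigma_algebraType (block_gen W J)).

Definition pair_block (i : 'I_n) : {set I} := [set inl i; inr i].

Lemma measurable_partner_product (i : 'I_n) : pair_setting (X i) (U i) ->
  measurable_fun [set: blk (pair_block i)] (partner_product (X i) (U i)).
Proof.
move=> ps.
have mX : measurable_fun [set: blk (pair_block i)] (X i).
  by apply: (@measurable_coord _ _ _ _ W _ (inl i)); rewrite !inE eqxx.
have mU : measurable_fun [set: blk (pair_block i)] (U i).
  by apply: (@measurable_coord _ _ _ _ W _ (inr i)); rewrite !inE eqxx orbT.
apply: measurableT_comp => //; apply: measurable_funM => //.
have mXU : measurable_fun [set: blk (pair_block i)] (fun w => (X i w, U i w)).
  exact: measurable_fun_pair.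
exact: (measurableT_comp (measurable_partner_of ps) mXU).
Qed.

Context (p lam : R) (f g h : R -> R).
Hypothesis p01 : 0 < p < 1.
Hypothesis fgh : smooth3 f g h.
Hypothesis f0 : forall x, 0 <= f x.

(** Multiplying by a power with negative exponent yields the value f 0 at b = 0, since
this power of 0 is 0; so the rule 0 / 0 = 0 needs no case distinction. *)
Definition self_normed b x : R := f (x * b `^ (- (2 * lam)^-1)).

Lemma measurable_self_normed : measurable_fun [set: R * R] (fun z => self_normed z.1 z.2).
Proof.
have mf : measurable_fun [set: R] f.
  by apply: continuous_measurable_fun; exact: smooth3_continuous fgh.
apply: (measurableT_comp mf (g := fun z : R * R => z.2 * z.1 `^ (- (2 * lam)^-1))).
apply: measurable_funM => //.
exact: (measurableT_comp (measurable_powR _) (@measurable_fst _ _ R R)).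
Qed.

Lemma measurable_bern_mean_self d' (T' : measurableType d') (J : Type) (l : seq J)
    (s : J -> T' -> R) (a b : T' -> R) :
  (forall i, measurable_fun [set: T'] (s i)) -> measurable_fun [set: T'] a ->
  measurable_fun [set: T'] b ->
  measurable_fun [set: T'] (fun w => bern_mean p [seq s i w | i <- l] (self_normed (b w)) (a w)).
Proof.
move=> ms; elim: l a => [|i l IH] a ma mb.
  apply: (measurableT_comp measurable_self_normed (g := fun w => (b w, a w))).
  exact: measurable_fun_pair.
apply: measurable_funD; apply: measurable_funM => //; apply: IH => //;
  by apply: measurable_funD => //; exact: measurable_funM.
Qed.

Lemma bern_mean_ge0 l F x : (forall y, 0 <= F y) -> 0 <= bern_mean p l F x.
Proof.
have /andP[p0 p1] := p01; move=> F0; elim: l x => //= s l IH x.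
by rewrite addr_ge0// mulr_ge0// ?subr_ge0 ltW.
Qed.

Lemma self_normed_derive (y a b x : R) :
  is_derive x 1 (fun x => self_normed (b + y `^ lam) (a + x))
    ((b + y `^ lam) `^ (- (2 * lam)^-1) *
     g ((a + x) * (b + y `^ lam) `^ (- (2 * lam)^-1))).
Proof.
set c := (_ + _) `^ _.
have E z : (a + z) * c = a * c + c * z by ring.
rewrite (_ : (fun z => _) = (fun z => f (a * c + c * z))); last first.
  by apply/funext => z; rewrite -E.
by rewrite E [c * g _]mulrC; apply: is_derive_affine; exact: smooth3_d1 fgh _.
Qed.

Lemma self_normed_convex y a b : convex3 (fun x =>
  (b + y `^ lam) `^ (- (2 * lam)^-1) *
     g ((a + x) * (b + y `^ lam) `^ (- (2 * lam)^-1))).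
Proof.
set c := (_ + _) `^ _.
have c0 : 0 <= c by exact: powR_ge0.
exact: (convex3_scale _ c0 c0 (smooth3_convex_deriv fgh)).
Qed.

Hypothesis indep : independent_coords P W.
Hypothesis ps : forall i, pair_setting (X i) (U i).
Hypothesis ratio : forall i, {ae P, forall w,
  (asym_ratio (X i) (U i) w <= ((1 - p) / p)%:E)%E}.

Local Notation Y i := (partner_product (X i) (U i)).

(** With everything outside the pair (X_i, U_i) frozen, this is the comparison for one
variable, applied to a function that depends on Y_i through the denominator. *)
Lemma hybrid_step i (A B : T -> R) : 
  measurable_fun [set: blk (~: pair_block i)] A ->
  measurable_fun [set: blk (~: pair_block i)] B ->
  (\int[P]_w (self_normed (B w + Y i w `^ lam) (A w + X i w))%:E <=
   \int[P]_w (bern_step p (Num.sqrt (Y i w)) (self_normed (B w + Y i w `^ lam)) (A w))%:E)%E.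
Proof.
move=> mA mB.
pose y (z : R * R) := `|z.1 * partner_of (X i) z|.
have my : measurable_fun [set: R * R] y.
  apply: measurableT_comp => //; apply: measurable_funM => //.
  exact: measurable_partner_of (ps i).
have ms : measurable_fun [set: R * R] (fun z => Num.sqrt (y z)).
  have H : measurable_fun [set: R] (@Num.sqrt R).
    by apply: continuous_measurable_fun; exact: sqrt_continuous.
  exact: measurableT_comp H my.
have myl : measurable_fun [set: R * R] (fun z => y z `^ lam).
  exact: (measurableT_comp (measurable_powR _) my).
pose b (z : (R * R) * (R * R)) := z.2.2 + y z.1 `^ lam.
have m1 := @measurable_fst _ _ (R * R)%type (R * R)%type.
have m2 := @measurable_snd _ _ (R * R)%type (R * R)%type.
have m11 := measurableT_comp (@measurable_fst _ _ R R) m1.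
have m21 := measurableT_comp (@measurable_fst _ _ R R) m2.
have m22 := measurableT_comp (@measurable_snd _ _ R R) m2.
have mb : measurable_fun setT b.
  by apply: measurable_funD => //; exact: (measurableT_comp myl m1).
(* the pair with index i comes first, the frozen shifts second *)
pose F (z : (R * R) * (R * R)) := (self_normed (b z) (z.2.1 + z.1.1))%:E.
pose G (z : (R * R) * (R * R)) :=
  (bern_step p (Num.sqrt (y z.1)) (self_normed (b z)) z.2.1)%:E.
have mXU : measurable_fun [set: blk (pair_block i)] (fun w => (X i w, U i w)).
  apply: measurable_fun_pair.
    by apply: (@measurable_coord _ _ _ _ W _ (inl i)); rewrite !inE eqxx.
  by apply: (@measurable_coord _ _ _ _ W _ (inr i)); rewrite !inE eqxx orbT.
have mAB : measurable_fun [set: blk (~: pair_block i)] (fun w => (A w, B w)).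
  exact: measurable_fun_pair.
have ind : independent_maps P (fun w => (X i w, U i w)) (fun w => (A w, B w)).
  apply: (maps_of_blocks_independent indep _ mXU mAB) => s.
  by rewrite !inE => ->.
apply: (independent_integral_le (measurable_blk mXU) (measurable_blk mAB) ind
  (F := F) (G := G)).
- apply/measurable_EFinP.
  apply: (measurableT_comp measurable_self_normed (g := fun z => (b z, z.2.1 + z.1.1))).
  by apply: measurable_fun_pair => //; exact: measurable_funD.
- by move=> z; rewrite lee_fin; exact: f0.
- apply/measurable_EFinP.
  apply: (@measurable_bern_mean_self _ _ unit [:: tt] (fun _ z => Num.sqrt (y z.1)) (fun z => z.2.1) b) => //.
  by move=> _; exact: (measurableT_comp ms m1).
- by move=> z; rewrite lee_fin; apply: (@bern_mean_ge0 [:: _]) => x; exact: f0.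
move=> [a b0].
pose phi (u x : R) := self_normed (b0 + u `^ lam) (a + x).
rewrite [leRHS](_ : _ = (\int[P]_w
    (bern_step p (Num.sqrt (Y i w)) (phi (Y i w)) 0)%:E)%E); last first.
  by apply: eq_integral => w _; rewrite /G /bern_step /phi /= !add0r.
apply: (partner_inequality (phi := phi) p01 (ps i) (ratio i)) => //.
- apply: (measurableT_comp measurable_self_normed
    (g := fun z : R * R => (b0 + z.1 `^ lam, a + z.2))).
  apply: measurable_fun_pair; apply: measurable_funD => //.
  exact: (measurableT_comp (measurable_powR _) (@measurable_fst _ _ R R)).
- by move=> u x; exact: f0.
- move=> u; split; first exact: self_normed_derive.
  exact: self_normed_convex.
Qed.

(** After the first variable has been replaced, the two values of the Bernoulli
variable shift A by amounts that depend on the first pair only. The rest of the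
list is then treated by induction for each shift, and Y_i joins B. *)
Lemma hybrid (l : seq 'I_n) (J : {set I}) (A B : T -> R) : uniq l ->
  (forall i, i \in l -> inl i \notin J /\ inr i \notin J) ->
  measurable_fun [set: blk J] A -> measurable_fun [set: blk J] B ->
  (\int[P]_w (self_normed (B w + \sum_(i <- l) Y i w `^ lam) (A w + \sum_(i <- l) X i w))%:E <=
   \int[P]_w (bern_mean p [seq Num.sqrt (Y i w) | i <- l]
     (self_normed (B w + \sum_(i <- l) Y i w `^ lam)) (A w))%:E)%E.
Proof.
have /andP[p0 p1] := p01.
have mYi i : measurable_fun [set: blk (pair_block i)] (fun w => Y i w `^ lam).
  exact: (measurableT_comp (measurable_powR _) (measurable_partner_product (ps i))).
have mXi i : measurable_fun [set: blk (pair_block i)] (X i).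
  by apply: (@measurable_coord _ _ _ _ W _ (inl i)); rewrite !inE eqxx.
have msq i : measurable_fun [set: blk (pair_block i)] (fun w => Num.sqrt (Y i w)).
  have H : measurable_fun [set: R] (@Num.sqrt R).
    by apply: continuous_measurable_fun; exact: sqrt_continuous.
  exact: (measurableT_comp H (measurable_partner_product (ps i))).
elim: l J A B => [|i l IH] J A B.
  move=> _ _ mA mB; rewrite le_eqVlt; apply/orP; left; apply/eqP.
  by apply: eq_integral => w _; rewrite /= !big_nil !addr0.
move=> /= /andP[il ul] lJ mA mB.
have [iJ1 iJ2] := lJ i (mem_head _ _).
have JC : J \subset ~: pair_block i.
  by apply/fintype.subsetP => s sJ; rewrite !inE negb_or;
     apply/andP; split; apply/eqP => E; rewrite E ?(negbTE iJ1) ?(negbTE iJ2) in sJ.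
have pC j : j \in l -> pair_block j \subset ~: pair_block i.
  move=> jl; have ji : j != i by apply: contraNneq il => <-.
  apply/fintype.subsetP => s; rewrite !inE => /orP[] /eqP -> /=.
    by rewrite (inj_eq (@inl_inj _ _)) orbF.
  by rewrite (inj_eq (@inr_inj _ _)).
pose A' w := A w + \sum_(j <- l) X j w.
pose B' w := B w + \sum_(j <- l) Y j w `^ lam.
have mA' : measurable_fun [set: blk (~: pair_block i)] A'.
  apply: measurable_funD; first exact: measurable_blkS JC mA.
  by apply: measurable_blk_sum => j jl; exact: measurable_blkS (pC j jl) (mXi j).
have mB' : measurable_fun [set: blk (~: pair_block i)] B'.
  apply: measurable_funD; first exact: measurable_blkS JC mB.
  by apply: measurable_blk_sum => j jl; exact: measurable_blkS (pC j jl) (mYi j).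
have := hybrid_step mA' mB'.
under eq_integral do rewrite -[A' _ + _]addrA [_ + X i _]addrC -[B' _ + _]addrA [_ + Y i _ `^ _]addrC.
under eq_integral do rewrite -(big_cons _ _ i l xpredT (fun j => X j _))
  -(big_cons _ _ i l xpredT (fun j => Y j _ `^ lam)).
move=> /le_trans; apply.
pose B1 w := B w + Y i w `^ lam.
pose K := J :|: pair_block i.
have JK : J \subset K by exact: finset.subsetUl.
have iK : pair_block i \subset K by exact: finset.subsetUr.
have lK j : j \in l -> inl j \notin K /\ inr j \notin K.
  move=> jl; have ji : j != i by apply: contraNneq il => <-.
  have [j1 j2] := lJ j (mem_behead (s := i :: l) jl).
  by rewrite !inE (negbTE j1) (negbTE j2)/= (inj_eq (@inl_inj _ _)) (inj_eq (@inr_inj _ _)) orbF.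
have mB1 : measurable_fun [set: blk K] B1.
  by apply: measurable_funD; [exact: measurable_blkS JK mB|exact: measurable_blkS iK (mYi i)].
pose Az c w := A w + Num.sqrt (Y i w) * c.
have mAz c : measurable_fun [set: blk K] (Az c).
  apply: measurable_funD; first exact: measurable_blkS JK mA.
  by apply: measurable_funM => //; exact: measurable_blkS iK (msq i).
have E w : B' w + Y i w `^ lam = B1 w + \sum_(j <- l) Y j w `^ lam.
  by rewrite /B1 /B' addrAC.
have IHc c := IH K (Az c) B1 ul lK (mAz c) mB1.
have EA c w : Az c w + \sum_(j <- l) X j w = A' w + Num.sqrt (Y i w) * c.
  by rewrite /Az /A' addrAC.
pose V c w := self_normed (B1 w + \sum_(j <- l) Y j w `^ lam) (Az c w + \sum_(j <- l) X j w).
pose V' c w := bern_mean p [seq Num.sqrt (Y i w) | i <- l]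
     (self_normed (B1 w + \sum_(i <- l) Y i w `^ lam)) (Az c w).
pose zT := zval p true; pose zF := zval p false.
have mS : measurable_fun [set: T] (fun w => B1 w + \sum_(j <- l) Y j w `^ lam).
  apply: measurable_funD; first exact: measurable_blk mB1.
  by apply: measurable_sum => j; exact: measurable_blk (mYi j).
have mV c : measurable_fun [set: T] (V c).
  apply: (measurableT_comp measurable_self_normed (g := fun w =>
   (B1 w + \sum_(j <- l) Y j w `^ lam, Az c w + \sum_(j <- l) X j w))).
  apply: measurable_fun_pair => //; apply: measurable_funD; first exact: measurable_blk (mAz c).
  exact: measurable_sum.
have mV' c : measurable_fun [set: T] (V' c).
  apply: (measurable_bern_mean_self l (s := fun i w => Num.sqrt (Y i w))) => //.
    by move=> j; exact: measurable_blk (msq j).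
  exact: measurable_blk (mAz c).
have V0 c w : 0 <= V c w by exact: f0.
have V'0 c w : 0 <= V' c w by apply: bern_mean_ge0 => x; exact: f0.
have comb (Q : R -> T -> R) : (forall c, measurable_fun [set: T] (Q c)) ->
    (forall c w, 0 <= Q c w) ->
    (\int[P]_w (p * Q zT w + (1 - p) * Q zF w)%:E =
     p%:E * \int[P]_w (Q zT w)%:E + (1 - p)%:E * \int[P]_w (Q zF w)%:E)%E.
  move=> mQ Q0; under eq_integral do rewrite EFinD !EFinM.
  have q0 : (0 <= (1 - p)%:E)%E by rewrite lee_fin subr_ge0 ltW.
  have p0' : (0 <= p%:E)%E by rewrite lee_fin ltW.
  rewrite ge0_integralD//; last 4 first.
  - by move=> w _; rewrite mule_ge0// lee_fin.
  - by apply: emeasurable_funM => //; exact/measurable_EFinP.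
  - by move=> w _; rewrite mule_ge0// lee_fin.
  - by apply: emeasurable_funM => //; exact/measurable_EFinP.
  rewrite !ge0_integralZl//; try exact/measurable_EFinP.
  - by move=> w _; rewrite lee_fin.
  - by move=> w _; rewrite lee_fin.
rewrite [leLHS](_ : _ = \int[P]_w (p * V zT w + (1 - p) * V zF w)%:E)%E; last first.
  by apply: eq_integral => w _; rewrite /bern_step /V !EA E.
rewrite [leRHS](_ : _ = \int[P]_w (p * V' zT w + (1 - p) * V' zF w)%:E)%E; last first.
  by apply: eq_integral => w _; rewrite big_cons addrA.
rewrite !comb//; apply: leeD.
  by apply: lee_wpmul2l; [rewrite lee_fin ltW|exact: IHc].
by apply: lee_wpmul2l; [rewrite lee_fin subr_ge0 ltW|exact: IHc].
Qed.

End hybrid.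

(** * Sums of Bernoulli variables *)

Section averages.
Context {R : realType}.
Implicit Types (f g h : R -> R) (p x c lam : R) (l : seq R).

Lemma bern_mean_scale p l f c x :
  bern_mean p l (fun y => f (y * c)) x = bern_mean p [seq s * c | s <- l] f (x * c).
Proof.
elim: l x => //= s l IH x; rewrite /bern_step !IH !mulrDl.
by rewrite ![s * _ * c]mulrAC.
Qed.

(** Jensen's inequality for a two-point law with mean x. *)
Lemma convex_le_bern_step p s f x : 0 < p < 1 -> convex3 f -> f x <= bern_step p s f x.
Proof.
move=> /andP[p0 p1] cf.
have r0 : 0 < Num.sqrt (p * (1 - p)) by rewrite sqrtr_gt0 mulr_gt0// subr_gt0.
wlog s0 : s f x cf / 0 <= s.
  move=> W; have [|s0] := leP 0 s; first exact: W.
  have cf' : convex3 (fun y => f (- y)).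
    move=> u v w /andP[uv vw]; have := cf (- w) (- v) (- u).
    by rewrite !lerN2 uv vw => /(_ isT); lra.
  have := W (- s) (fun y => f (- y)) (- x) cf'; rewrite oppr_ge0 => /(_ (ltW s0)).
  by rewrite /bern_step !mulNr -!opprD !opprK.
rewrite /bern_step; set a := s * zval p true; set b := s * zval p false.
have ab : p * a + (1 - p) * b = 0 by rewrite /a /b zvalT zvalF; ring.
have a0 : 0 <= a by rewrite mulr_ge0// zvalT divr_ge0 ?subr_ge0// ltW.
have b0 : b <= 0 by rewrite mulr_ge0_le0// zvalF mulNr oppr_le0 divr_ge0// ltW.
have := cf (x + b) x (x + a); rewrite lerDl gerDl a0 b0 => /(_ isT).
have [a00|a00] := eqVneq a 0.
  have -> : b = 0.
    by apply/eqP; move: ab; rewrite a00 mulr0 add0r => /eqP; rewrite mulf_eq0 subr_eq0 gt_eqF.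
  by rewrite a00 addr0 => _; lra.
have b1 : b = - (p / (1 - p)) * a.
  have : (1 - p) != 0 by rewrite gt_eqF// subr_gt0.
  move=> q0; apply: (mulfI q0); rewrite (_ : (1 - p) * b = - (p * a)); last by lra.
  by field.
have -> : x + a - (x + b) = a / (1 - p) by rewrite b1; field; lra.
have -> : x + a - x = a by ring.
have -> : x - (x + b) = a * (p / (1 - p)) by rewrite b1; ring.
set f0 := f x; set f1 := f (x + a); set f2 := f (x + b) => H.
have a00' : 0 < a / (1 - p) by rewrite divr_gt0 ?subr_gt0// lt_neqAle eq_sym a00.
rewrite -(ler_pM2l a00') (le_trans H)// le_eqVlt; apply/orP; left; apply/eqP.
by field; lra.
Qed.

Lemma convex_le_bern_mean p l f g h x : 0 < p < 1 -> smooth3 f g h -> f x <= bern_mean p l f x.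
Proof.
move=> p01 fgh; have p01' : 0 <= p <= 1 by lra.
elim: l x => //= s l IH x; apply: (le_trans (convex_le_bern_step s x p01 (smooth3_convex fgh))).
exact: bern_step_le.
Qed.

Lemma lambda_star_gt0 p : 0 < p < 1 -> 0 < lambda_star p.
Proof.
move=> /andP[p0 p1]; rewrite /lambda_star; case: ifP => // _.
have s0 : 0 <= Num.sqrt (p - p ^+ 2) by exact: sqrtr_ge0.
have p20 : 0 < p ^+ 2 by exact: exprn_gt0.
by rewrite divr_gt0//; lra.
Qed.

(** Once the denominator is divided out, the powers of the scales have sum 1, and
equalize applies with mean 1 / n. If the denominator is 0 all scales are 0 and
the claim is Jensen's inequality. *)
Lemma self_normed_le_mean p lam f g h n (y : 'I_n -> R) :
  0 < p < 1 -> lambda_star p <= lam -> smooth3 f g h -> (0 < n)%N ->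
  (forall i, 0 <= y i) ->
  bern_mean p [seq Num.sqrt (y i) | i <- enum 'I_n]
    (self_normed lam f (\sum_(i <- enum 'I_n) y i `^ lam)) 0 <=
  bern_mean p (nseq n (n%:R^-1 `^ (2 * lam)^-1)) f 0.
Proof.
move=> p01 hl fgh n0 y0.
have lam0 : 0 < lam by exact: lt_le_trans (lambda_star_gt0 p01) hl.
set B := \sum_(i <- _) _; set k := (2 * lam)^-1.
have B0 : 0 <= B by apply: sumr_ge0 => i _; exact: powR_ge0.
rewrite /self_normed bern_mean_scale mul0r -/k.
have [B00|Bn0] := eqVneq B 0.
  have k0 : - k != 0 by rewrite oppr_eq0 invr_neq0// mulf_neq0// gt_eqF.
  rewrite B00 powR0// (_ : [seq _ | s <- _] = nseq n 0); last first.
    rewrite -map_comp (eq_map (g := fun=> 0)); last by move=> i /=; rewrite mulr0.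
    by rewrite -[in RHS](size_enum_ord n); elim: (enum _) => //= i s ->.
  apply: le_trans (convex_le_bern_mean _ _ p01 fgh).
  by elim: n {y y0 n0 B B0 B00} => //= n IH; rewrite bern_step_spread0.
have Bgt0 : 0 < B by rewrite lt_neqAle eq_sym Bn0.
have E : [seq s * B `^ (- k) | s <- [seq Num.sqrt (y i) | i <- enum 'I_n]] =
   [seq s `^ k | s <- [seq y i `^ lam / B | i <- enum 'I_n]].
  rewrite -!map_comp; apply: eq_map => i /=.
  rewrite powRM ?powR_ge0 ?invr_ge0// -powRrM powRN; congr (_ * _).
    by rewrite /k invfM mulrCA mulfV ?gt_eqF// mulr1 powR12_sqrt.
  by rewrite -powRN -[B^-1]powR_inv1// -powRrM mulN1r.
rewrite E.
have H := equalize (m := n%:R^-1) (l := [seq y i `^ lam / B | i <- enum 'I_n]) 0 p01 hl lam0 fgh.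
move: H; rewrite size_map size_enum_ord; apply.
  by move=> s /mapP[i _ ->]; rewrite divr_ge0 ?powR_ge0.
rewrite big_map -mulr_suml -/B mulfV// mulfV//.
by rewrite pnatr_eq0 -lt0n.
Qed.

End averages.

Section bernoulli_sample.
Context d (T : measurableType d) (R : realType) (P : probability T R).
Context (n : nat) (Z : 'I_n -> {RV P >-> R}) (p : R).
Hypothesis p01 : 0 < p < 1.
Hypothesis sample : std_bernoulli_sample p Z.

Lemma integral_std_bernoulli i (F : R -> R) : measurable_fun [set: R] F ->
  (forall x, 0 <= F x) ->
  (\int[P]_w (F (Z i w))%:E = (p * F (zval p true) + (1 - p) * F (zval p false))%:E)%E.
Proof.
move=> mF F0; have [_ law] := sample.
have mEF : measurable_fun [set: R] (EFin \o F) by exact/measurable_EFinP.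
rewrite -(@ge0_integral_distribution _ _ _ _ _ P (Z i) (EFin \o F))//.
have mz : measurable_fun [set: bool] (zval p) by [].
transitivity (\int[pushforward (bernoulli_prob p) (zval p)]_x (F x)%:E)%E.
  by apply: eq_measure_integral => A mA _; exact: law.
rewrite ge0_integral_pushforward//; last by move=> x _; rewrite lee_fin.
have p01' : 0 <= p <= 1 by have /andP[p0 p1] := p01; rewrite (ltW p0) (ltW p1).
by rewrite preimage_setT integral_bernoulli_prob// => b; rewrite /= lee_fin.
Qed.

Lemma sample_independent (s : 'I_n -> R) (l : seq 'I_n) i : i \notin l ->
  independent_maps P (fun w => \sum_(j <- l) s j * Z j w) (Z i).
Proof.
move=> il; have [iZ _] := sample.
apply: (maps_of_blocks_independent (independent_coords_of_mutual iZ)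
  (J := [set j in l]%SET) (K := [set i]%SET)).
- by move=> j; rewrite !inE => jl; apply: contraNneq il => <-.
- apply: measurable_blk_sum => j jl; apply: measurable_funM => //.
  by apply: measurable_coord; rewrite inE.
- by apply: measurable_coord; rewrite inE.
Qed.

(** Conditioning on one variable at a time. *)
Lemma integral_weighted_sample (s : 'I_n -> R) (l : seq 'I_n) (F : R -> R) x : uniq l ->
  measurable_fun [set: R] F -> (forall x, 0 <= F x) ->
  (\int[P]_w (F (x + \sum_(j <- l) s j * Z j w))%:E =
   (bern_mean p [seq s j | j <- l] F x)%:E)%E.
Proof.
move=> + mF F0.
have mbs (l' : seq R) : measurable_fun [set: R] (bern_mean p l' F).
  elim: l' => //= t l' IH; apply: measurable_funD; apply: measurable_funM => //;
    by apply: measurableT_comp IH _; exact: measurable_funD.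
elim: l x => [|i l IH] x /=.
  move=> _; under eq_integral do rewrite big_nil addr0.
  rewrite integral_cst//; transitivity ((F x)%:E * 1)%E; last exact: mule1.
  by congr (_ * _)%E; exact: probability_setT.
move=> /andP[il ul].
pose G (z : R * R) := (F (x + s i * z.2 + z.1))%:E.
have mC : measurable_fun [set: T] (fun w => \sum_(j <- l) s j * Z j w).
  by apply: measurable_sum => j; exact: measurable_funM.
transitivity (\int[P]_w G ((\sum_(j <- l) s j * Z j w)%R, Z i w))%E.
  by apply: eq_integral => w _; rewrite /G big_cons/= addrA.
rewrite (independent_tonelli mC _ (sample_independent s il))//; last 2 first.
- apply/measurable_EFinP; apply: (measurableT_comp mF (g := fun z : R * R => x + s i * z.2 + z.1)).
  by apply: measurable_funD; [apply: measurable_funD|] => //; exact: measurable_funM.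
- by move=> z; rewrite lee_fin.
rewrite /G /=; under eq_integral do rewrite IH//.
rewrite (integral_std_bernoulli i (F := fun z => bern_mean p [seq s j | j <- l] F (x + s i * z)))//.
- apply: (measurableT_comp (mbs _) (g := fun z => x + s i * z)).
  by apply: measurable_funD => //; exact: measurable_funM.
- by move=> z; apply: bern_mean_ge0 => //; exact: p01.
Qed.

Lemma expectation_sample lam (F : R -> R) : measurable_fun [set: R] F ->
  (forall x, 0 <= F x) ->
  (\int[P]_w (F (normalized_sum Z lam w))%:E =
   (bern_mean p (nseq n (n%:R^-1 `^ (2 * lam)^-1)) F 0)%:E)%E.
Proof.
move=> mF F0; set s := n%:R^-1 `^ _.
have -> : nseq n s = [seq s | j <- enum 'I_n].
  by rewrite -{1}(size_enum_ord n); elim: (enum _) => //= j l ->.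
rewrite -(integral_weighted_sample (fun=> s)) ?enum_uniq//.
apply: eq_integral => w _; rewrite add0r -mulr_sumr /normalized_sum big_enum mulrC.
by rewrite -powRN /s -[n%:R^-1]powR_inv1// -powRrM mulN1r.
Qed.

End bernoulli_sample.

(** * The upper bounds *)

Section domination.
Context d (T : measurableType d) (R : realType) (P : probability T R).
Context (n : nat) (X U : 'I_n -> {RV P >-> R}) (p lam : R).
Hypothesis ps : forall i, pair_setting (X i) (U i).

Local Notation D w := (poweR (\sum_(i < n) poweR (Yprod (X i) (U i) w) lam)%E
                 (2 * lam)^-1%R).

(** The value +oo of the denominator is also covered: fine sends it to 0, whose power
with exponent - 1 is 0. *)
Lemma self_norm_sumE w :
  self_norm_sum X U lam w = (\sum_(i < n) X i w) * (fine (D w)) `^ (-1).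
Proof.
rewrite /self_norm_sum; have : (0 <= D w)%E by exact: poweR_ge0.
case: (D w) => [r| |]//.
  rewrite lee_fin => r0; rewrite powR_inv1//=.
  have [->|rn0] := eqVneq r 0; first by rewrite invr0 mulr0 eqxx.
  by rewrite eqe (negbTE rn0) inver (negbTE rn0).
by move=> _ /=; rewrite powR0 ?mulr0 ?invey ?mule0// oppr_eq0 oner_eq0.
Qed.

Lemma measurable_self_norm_sum : measurable_fun [set: T] (self_norm_sum X U lam).
Proof.
rewrite (_ : self_norm_sum X U lam = fun w => (\sum_(i < n) X i w) * (fine (D w)) `^ (-1)).
  apply: measurable_funM; first exact: measurable_sum.
  apply: (measurableT_comp (measurable_powR _)).
  apply: (measurableT_comp (@fine_measurable R setT measurableT)).
  apply: (measurableT_comp (measurable_poweR _)).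
  apply: emeasurable_sum => i; apply: (measurableT_comp (measurable_poweR _)).
  exact: measurable_Yprod (ps i).
by apply/funext => w; exact: self_norm_sumE.
Qed.

Lemma ae_self_norm_sum : {ae P, forall w, self_norm_sum X U lam w =
  (\sum_(i < n) X i w) * (\sum_(i < n) partner_product (X i) (U i) w `^ lam) `^ (- (2 * lam)^-1)}.
Proof.
have H : {ae P, forall w, forall i, Yprod (X i) (U i) w = (partner_product (X i) (U i) w)%:E}.
  have : {ae P, forall w, forall m : nat, match (m < n)%N =P true with
     | ReflectT h => Yprod (X (Ordinal h)) (U (Ordinal h)) w = (partner_product (X (Ordinal h)) (U (Ordinal h)) w)%:E
     | _ => True end}.
    apply: ae_foralln => m; case: eqP => [h|_]; last exact: aeW.
    exact: ae_Yprod.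
  apply: filterS => w H [m mn]; have := H m.
  by case: eqP => // h; rewrite (_ : Ordinal h = Ordinal mn)//; exact: val_inj.
apply: filterS H => w H; rewrite self_norm_sumE; congr (_ * _).
have -> : (\sum_(i < n) poweR (Yprod (X i) (U i) w) lam)%E =
    (\sum_(i < n) partner_product (X i) (U i) w `^ lam)%:E.
  by rewrite -sumEFin; apply: eq_bigr => i _; rewrite H poweR_EFin.
by rewrite poweR_EFin/= -powRrM mulrN1.
Qed.

End domination.

Section upper_bound.
Context d (T : measurableType d) (R : realType) (P : probability T R).
Context (n : nat) (X U : 'I_n -> {RV P >-> R}) (p lam : R).

Lemma admissible_pair i : admissible p X U -> pair_setting (X i) (U i).
Proof.
by move=> [[_ mX] [_ lU] XU _]; split => //; exact: pair_independent.
Qed.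

Lemma self_norm_expectation_le f : 0 < p < 1 -> (0 < n)%N -> admissible p X U ->
  lambda_star p <= lam -> Hplus 3 f ->
  (\int[P]_w (f (self_norm_sum X U lam w))%:E <=
   (bern_mean p (nseq n (n%:R^-1 `^ (2 * lam)^-1)) f 0)%:E)%E.
Proof.
move=> p01 n0 adm hl Hf; have [fgh f0] := Hplus_smooth3 Hf.
have ps i := admissible_pair i adm.
have [[iX _] [iU _] XU ratio] := adm.
have indep := joint_independent iX iU XU.
have mf : measurable_fun [set: R] f.
  by apply: continuous_measurable_fun; exact: smooth3_continuous fgh.
pose Y i w := partner_product (X i) (U i) w.
have mYl i : measurable_fun [set: T] (fun w => Y i w `^ lam).
  apply: (measurableT_comp (measurable_powR _)).
  exact: (measurable_blk (measurable_partner_product (ps i))).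
have msq i : measurable_fun [set: T] (fun w => Num.sqrt (Y i w)).
  have H : measurable_fun [set: R] (@Num.sqrt R).
    by apply: continuous_measurable_fun; exact: sqrt_continuous.
  exact: (measurableT_comp H (measurable_blk (measurable_partner_product (ps i)))).
have mB : measurable_fun [set: T] (fun w => \sum_(i <- enum 'I_n) Y i w `^ lam).
  exact: measurable_sum.
have msn := measurable_self_normed lam fgh.
have -> : (\int[P]_w (f (self_norm_sum X U lam w))%:E =
    \int[P]_w (self_normed lam f (0 + \sum_(i <- enum 'I_n) Y i w `^ lam)
       (0 + \sum_(i <- enum 'I_n) X i w))%:E)%E.
  apply: ge0_ae_eq_integral => //.
  - by apply/measurable_EFinP; exact: (measurableT_comp mf (measurable_self_norm_sum lam ps)).
  - apply/measurable_EFinP; apply: (measurableT_comp msn (g := fun w =>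
      (0 + \sum_(i <- enum 'I_n) Y i w `^ lam, 0 + \sum_(i <- enum 'I_n) X i w))).
    apply: measurable_fun_pair; apply: measurable_funD => //.
    exact: measurable_sum.
  - by move=> w _; rewrite lee_fin.
  - by move=> w _; rewrite lee_fin; exact: f0.
  apply: filterS (ae_self_norm_sum lam ps) => w -> _.
  by rewrite /self_normed !add0r !big_enum.
have m0 : measurable_fun [set: g_sigma_algebraType (block_gen (joint X U) finset.set0)]
    (cst (0 : R)) by exact: measurable_cst.
have H := @hybrid _ _ _ P n X U p lam f _ _ p01 fgh f0 indep ps ratio
  (enum 'I_n) finset.set0 (cst 0) (cst 0) (enum_uniq 'I_n) _ m0 m0.
apply: le_trans (H _) _; first by move=> i _; rewrite !inE.
apply: (@le_trans _ _ (\int[P]_w (bern_mean p (nseq n (n%:R^-1 `^ (2 * lam)^-1)) f 0)%:E)%E).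
  apply: ge0_le_integral => //.
  - by move=> w _; rewrite lee_fin; apply: (bern_mean_ge0 p01) => x; exact: f0.
  - apply/measurable_EFinP.
    apply: (measurable_bern_mean_self p lam fgh (enum 'I_n) (s := fun i w => Num.sqrt (Y i w))) => //.
    by apply: measurable_funD => //.
  - move=> w _; rewrite lee_fin add0r; apply: (self_normed_le_mean p01 hl fgh n0) => i.
    exact: normr_ge0.
rewrite integral_cst//.
apply: (@le_trans _ _ ((bern_mean p (nseq n (n%:R^-1 `^ (2 * lam)^-1)) f 0)%:E * 1)%E); last by rewrite mule1.
by apply: lee_wpmul2l; [rewrite lee_fin; apply: bern_mean_ge0|rewrite probability_le1].
Qed.

(** For the tail, Markov's inequality with the cube of a positive part bounds it by the
truncated third moment of the Bernoulli sum, and tail_le_lc concludes. *)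
Lemma self_norm_dominated d' (T' : measurableType d') (P' : probability T' R)
    (Z : 'I_n -> {RV P' >-> R}) : 0 < p < 1 -> (0 < n)%N -> admissible p X U ->
  std_bernoulli_sample p Z -> lambda_star p <= lam ->
  dominated P P' (self_norm_sum X U lam) (normalized_sum Z lam).
Proof.
move=> p01 n0 adm sZ hl.
have [p0 p1] := andP p01.
have ps i := admissible_pair i adm.
have mS := measurable_self_norm_sum lam ps.
split=> [f Hf|x].
  have [fgh f0] := Hplus_smooth3 Hf.
  have mf : measurable_fun [set: R] f.
    by apply: continuous_measurable_fun; exact: smooth3_continuous fgh.
  rewrite !unlock; apply: (le_trans (self_norm_expectation_le p01 n0 adm hl Hf)).
  by rewrite (expectation_sample p01 sZ lam mf f0).
set l := nseq n (n%:R^-1 `^ (2 * lam)^-1).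
set q := fun y => fine (tail P' (normalized_sum Z lam) y).
have integral_ge d1 (T1 : measurableType d1) (Q : probability T1 R) (S : T1 -> R) u :
    measurable_fun [set: T1] S ->
    (\int[Q]_w (indic_ge u (S w))%:E = Q [set w | (u <= S w)%R])%E.
  move=> mS1; rewrite (_ : [set w | (u <= S w)%R] = [set w | (u <= S w)%R] `&` setT) ?setIT//.
  have mA : measurable [set w | (u <= S w)%R].
    by rewrite -[X in measurable X]setTI; apply: measurable_fun_le.
  rewrite -[in RHS](setIT [set w | _]) -integral_indic//.
  apply: eq_integral => w _; rewrite indicE /indic_ge; congr ((nat_of_bool _)%:R%:E).
  by apply/idP/idP => [H|/set_mem//]; exact/mem_set.
have mI u : measurable_fun [set: R] (indic_ge u : R -> R).
  by apply: measurable_natr_bool; exact: measurable_fun_ler.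
have mTn : measurable_fun [set: T'] (normalized_sum Z lam).
  by apply: measurable_funM => //; exact: measurable_sum.
have qE : q = atoms_tail (bern_atoms p l 0).
  apply/funext => u; rewrite /q /tail -integral_ge// (expectation_sample p01 sZ lam (mI u)).
    by rewrite bern_atomsE.
  by move=> y; exact: ler0n.
have tail1 : (tail P (self_norm_sum X U lam) x <= 1)%E.
  by apply: probability_le1; rewrite -[X in measurable X]setTI; apply: measurable_fun_le.
have tailE : tail P (self_norm_sum X U lam) x = (fine (tail P (self_norm_sum X U lam) x))%:E.
  by rewrite fineK// ge0_fin_numE ?(le_lt_trans tail1) ?ltry// measure_ge0.
rewrite tailE lee_fin; set P0 := fine _ in tailE *.
have P01 : P0 <= 1 by rewrite -lee_fin -tailE.
have qle1 y : q y <= 1.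
  rewrite -lee_fin /q fineK; last by rewrite fin_num_measure// -[X in measurable X]setTI; apply: measurable_fun_le.
  by apply: probability_le1; rewrite -[X in measurable X]setTI; apply: measurable_fun_le.
have [lcq _] := lc_majorant_least qle1.
apply: (tail_le_lc (L := bern_atoms p l 0)) => //.
- by move=> wu; exact: bern_atoms_gt0.
- exact: bern_atoms_mass.
- by rewrite -qE.
move=> t tx; rewrite -bern_atomsE.
have := self_norm_expectation_le p01 n0 adm hl (Hplus_ppart t).
rewrite -lee_fin; apply: le_trans.
rewrite EFinM -tailE /tail -integral_ge// muleC.
have c0 : 0 <= (x - t) ^+ 3 by rewrite exprn_ge0// subr_ge0 ltW.
have mIS : measurable_fun [set: T] (fun w => (indic_ge x (self_norm_sum X U lam w))%:E).
  by apply/measurable_EFinP; exact: measurableT_comp (mI x) mS.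
rewrite -ge0_integralZl//; last by move=> w _; rewrite lee_fin ler0n.
apply: ge0_le_integral => //.
- by move=> w _; rewrite mule_ge0// lee_fin ler0n.
- exact: emeasurable_funM.
- apply/measurable_EFinP; apply: measurable_funX; apply: measurable_maxr => //.
  exact: measurable_funB.
move=> w _; rewrite -EFinM lee_fin /indic_ge.
have [xS|xS] := leP x (self_norm_sum X U lam w); last first.
  by rewrite mulr0n mulr0 exprn_ge0// ppart_ge0.
rewrite mulr1n mulr1; apply: lerXn2r; rewrite ?nnegrE ?ppart_ge0 ?subr_ge0 ?(ltW tx)//.
by rewrite /ppart le_max lerD2r xS.
Qed.

End upper_bound.

(** * Unequal weights below the critical exponent *)

Section sharpness.
Context {R : realType}.
Implicit Types (p lam x t s a b u : R).

(** The common scale of the Bernoulli sum that corresponds to s1 and s2 after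
multiplication by the denominator. *)
Definition power_mean lam s1 s2 : R :=
  ((s1 `^ (2 * lam) + s2 `^ (2 * lam)) / 2) `^ (2 * lam)^-1.

Lemma ppart_scale r t x : 0 < r -> ppart (t / r) (x / r) = ppart t x / r.
Proof.
move=> r0; rewrite /ppart -mulrBl.
have [xt|xt] := leP (x - t) 0.
  by rewrite mul0r max_r// mulr_le0_ge0// invr_ge0 ltW.
by rewrite max_l// divr_ge0// ltW.
Qed.

(** The average of the cubed positive part over two Bernoulli steps, with all lengths
multiplied by sqrt (p (1 - p)) so that no root appears. *)
Definition bern_pair p s1 s2 t : R :=
  p ^+ 2 * ppart t ((1 - p) * (s1 + s2)) ^+ 3 +
  p * (1 - p) * (ppart t ((1 - p) * s1 - p * s2) ^+ 3 +
                 ppart t ((1 - p) * s2 - p * s1) ^+ 3) +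
  (1 - p) ^+ 2 * ppart t (- p * (s1 + s2)) ^+ 3.

Lemma bern_mean_pair p s1 s2 t : 0 < p < 1 -> let r := Num.sqrt (p * (1 - p)) in
  bern_mean p [:: s1; s2] (fun x => ppart (t / r) x ^+ 3) 0 =
  bern_pair p s1 s2 t / r ^+ 3.
Proof.
move=> /andP[p0 p1] r.
have r0 : 0 < r by rewrite sqrtr_gt0 mulr_gt0// subr_gt0.
have rn0 : r != 0 by rewrite gt_eqF.
rewrite /= /bern_step zvalT zvalF -/r !add0r.
have E (u v : R) : s1 * (u / r) + s2 * (v / r) = (s1 * u + s2 * v) / r by ring.
rewrite !E !ppart_scale// /bern_pair.
have -> : s1 * (1 - p) + s2 * (1 - p) = (1 - p) * (s1 + s2) by ring.
have -> : s1 * (1 - p) + s2 * - p = (1 - p) * s1 - p * s2 by ring.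
have -> : s1 * - p + s2 * (1 - p) = (1 - p) * s2 - p * s1 by ring.
have -> : s1 * - p + s2 * - p = - p * (s1 + s2) by ring.
by rewrite !expr_div_n; ring.
Qed.

(** To the left of all atoms the average is a cubic polynomial in t in which the
variance is multiplied by - 3 t. The variance is proportional to the sum of the
squares of the scales, which is 1 for the scales 1, 0 and less than 1 for the
power mean when lam < 1. *)
Lemma small_power_exceeds p lam : 0 < p < 1 -> 0 < lam < 1 -> exists t,
  bern_pair p (power_mean lam 1 0) (power_mean lam 1 0) t < bern_pair p 1 0 t.
Proof.
move=> /andP[p0 p1] /andP[l0 l1].
rewrite /power_mean powR1 powR0 ?addr0; last by rewrite mulf_neq0// ?gt_eqF.
set s := _ `^ _.
have s0 : 0 <= s by exact: powR_ge0.
have s2 : s ^+ 2 < 2^-1.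
  rewrite -powR_mulrn// -powRrM mul1r.
  have -> : (2 * lam)^-1 * 2 = lam^-1 by field; rewrite gt_eqF.
  rewrite -[ltRHS]powRr1//.
  have h1 : 0 < 2^-1 :> R by [].
  have h2 : 2^-1 < 1 :> R by rewrite invf_lt1// ltr1n.
  have il : 1 < lam^-1 by rewrite invf_gt1.
  rewrite /powR !gt_eqF// ltr_expR ltr_nM2r//.
  by rewrite ln_lt0// h1 h2.
have s1 : s <= 1.
  by rewrite -(@ler_pXn2r _ 2)// ?nnegrE// expr1n; lra.
have s30 : 0 <= s ^+ 3 by exact: exprn_ge0.
have s31 : s ^+ 3 <= 1 by exact: exprn_ile1.
pose w := 1 - 2 * s ^+ 2; have w0 : 0 < w by rewrite /w; lra.
(* atoms are at least - 2; the second term makes - 3 t w exceed the bound 1 on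
   the third moments *)
pose t := - 2 - w^-1; exists t.
have wi : 0 < w^-1 by rewrite invr_gt0.
have wt : t * w = - 2 * w - 1 by rewrite /t mulrBl mulVf ?gt_eqF.
have expand (a b : R) : 0 <= a <= 1 -> 0 <= b <= 1 ->
    bern_pair p a b t = p * (1 - p) * (1 - 2 * p) * (a ^+ 3 + b ^+ 3)
      - 3 * t * (p * (1 - p)) * (a ^+ 2 + b ^+ 2) - t ^+ 3.
  move=> /andP[a0 a1] /andP[b0 b1].
  have pa : 0 <= p * a <= 1 by rewrite mulr_ge0 ?(ltW p0)//= mulr_ile1 ?(ltW p0) ?(ltW p1).
  have pb : 0 <= p * b <= 1 by rewrite mulr_ge0 ?(ltW p0)//= mulr_ile1 ?(ltW p0) ?(ltW p1).
  have t2 : t <= - 2 by rewrite /t; lra.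
  by rewrite /bern_pair !ppartE; [ring|lra..].
rewrite !expand//; do ?[by rewrite ?s0 ?s1 ?lexx ?ler01].
have pq : 0 < p * (1 - p) by rewrite mulr_gt0// subr_gt0.
rewrite -subr_gt0.
have -> : p * (1 - p) * (1 - 2 * p) * (1 ^+ 3 + 0 ^+ 3) -
  3 * t * (p * (1 - p)) * (1 ^+ 2 + 0 ^+ 2) - t ^+ 3 -
  (p * (1 - p) * (1 - 2 * p) * (s ^+ 3 + s ^+ 3) -
   3 * t * (p * (1 - p)) * (s ^+ 2 + s ^+ 2) - t ^+ 3) =
  p * (1 - p) * ((1 - 2 * p) * (1 - 2 * s ^+ 3) - 3 * (t * w)).
  by rewrite /w; ring.
rewrite mulr_gt0// wt.
have : `|(1 - 2 * p) * (1 - 2 * s ^+ 3)| <= 1.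
  by rewrite normrM mulr_ile1// ler_norml; lra.
by rewrite ler_norml => /andP[]; lra.
Qed.

End sharpness.

Section power_expansion.
Context {R : realType}.
Implicit Types (a b u x c : R).

Lemma is_derive_powR_shift a c x : 0 < 1 + c * x ->
  is_derive x 1 (fun y => (1 + c * y) `^ a) (a * (1 + c * x) `^ (a - 1) * c).
Proof.
move=> h; apply: (is_derive_affine (f := fun z => z `^ a)).
exact: is_derive1_powR.
Qed.

(** The power function is above its tangent at 1. *)
Lemma powR_tangent a u : 1 <= a -> 0 <= u -> 1 + a * u <= (1 + u) `^ a.
Proof.
move=> a1 u0.
have [f' E] : exists f', f' = fun x => a * (1 + x) `^ (a - 1) - a by exists (fun x => a * (1 + x) `^ (a - 1) - a).
have : (1 + 1 * 0) `^ a + (0 - a * 0) <= (1 + 1 * u) `^ a + (0 - a * u).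
  apply: (derive_ge0_le (f := fun x => (1 + 1 * x) `^ a + (0 - a * x)) (g := f')) => // x /andP[x0 xu].
    have D := is_deriveD (is_derive_powR_shift a (c := 1) (x := x) _)
       (is_derive_affine (f := id) (c := 0) (k := - a) (x := x) (is_derive_id _ _)).
    have pos : 0 < 1 + 1 * x by lra.
    have := D pos; rewrite E mul1r mulr1 mul1r => H.
    rewrite (_ : (fun y => _) = (fun y => (1 + 1 * y) `^ a) + (fun y => 0 + - a * y)) //.
    by apply/funext => y; rewrite -mulNr.
  rewrite E; have : 1 <= (1 + x) `^ (a - 1) by rewrite -[leLHS](powRr0 (1 + x)) ler_powR; lra.
  by move=> h; have := ler_wpM2l (le_trans ler01 a1) h; lra.
by rewrite mulr0 addr0 powR1 mul1r; lra.
Qed.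

(** Taylor expansion of order two. The constant a (a - 1) is enlarged by the factor
b / 2 > 1 to absorb the error term, and the range of x is chosen so that
(1 + x)^(a - 2) <= b - 1. *)
Lemma symmetric_power_bounds a b : 2 <= a -> 2 < b -> exists2 x0, 0 < x0 < 1 &
  forall x, 0 <= x <= x0 ->
    2 <= (1 + x) `^ a + (1 - x) `^ a <= 2 + a * (a - 1) * b / 2 * x ^+ 2.
Proof.
move=> a2 b2.
pose L := ln (b - 1) / (a - 1).
have l0 : 0 < ln (b - 1) by rewrite ln_gt0; lra.
have L0 : 0 < L by rewrite divr_gt0; lra.
exists (Num.min L 2^-1); first by rewrite lt_min L0/= gt_min; lra.
move=> x /andP[x0 xL].
have xL1 : x <= L by apply: le_trans xL _; rewrite ge_min lexx.
have x2 : x <= 2^-1 by apply: le_trans xL _; rewrite ge_min lexx orbT.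
pose F c e (y : R) := (1 + c * y) `^ e.
have dF c e (y : R) : 0 < 1 + c * y -> is_derive y 1 (F c e) (e * F c (e - 1) y * c).
  exact: is_derive_powR_shift.
have pos1 (y : R) : 0 <= y -> 0 < 1 + 1 * y by lra.
have posN (y : R) : y <= x -> 0 < 1 + -1 * y by lra.
pose phi1 (y : R) := a * F 1 (a - 1) y - a * F (-1) (a - 1) y.
have dphi (y : R) : 0 <= y <= x -> is_derive y 1 (F 1 a + F (-1) a) (phi1 y).
  move=> /andP[y0 yx]; apply: is_derive_eq.
    apply: is_deriveD; [exact: dF (pos1 _ y0)|exact: dF (posN _ yx)].
  by rewrite /phi1 !mulr1 mulrN1.
have big1 (e y : R) : 0 <= e -> 0 <= y -> 1 <= F 1 e y.
  by move=> e0 y0; rewrite /F -[leLHS](powRr0 (1 + 1 * y)) ler_powR; lra.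
have small1 (e y : R) : 0 <= e -> 0 <= y <= x -> F (-1) e y <= 1.
  move=> e0 /andP[y0 yx]; apply: (@le_trans _ _ (1 `^ e)); last by rewrite powR1.
  by apply: ge0_ler_powR; rewrite ?nnegrE; lra.
have E y : (F 1 a + F (-1) a) y = (1 + y) `^ a + (1 - y) `^ a.
  by rewrite /F -[LHS]/((1 + 1 * y) `^ a + (1 + -1 * y) `^ a) mul1r mulN1r.
have E0 : (F 1 a + F (-1) a) 0 = 2.
  by rewrite E subr0 addr0 powR1.
rewrite -E; apply/andP; split.
  rewrite -{1}E0; apply: (derive_ge0_le (g := phi1)) => // y /andP[y0 yx].
  rewrite /phi1 -mulrBr mulr_ge0 ?subr_ge0; [|lra|].
    by [].
  apply: (@le_trans _ _ 1); first by apply: small1; lra.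
  by apply: big1; lra.
set k := a * (a - 1) * b / 2.
pose lin (z : R) := id (0 + (2 * k) * z).
have dlin (y : R) : is_derive y 1 lin (1 * (2 * k)).
  by apply: is_derive_affine; exact: is_derive_id.
pose G1 := lin - (a *: F 1 (a - 1) - a *: F (-1) (a - 1)).
have dG1 (y : R) : 0 <= y <= x -> is_derive y 1 G1
    (2 * k - a * (a - 1) * (F 1 (a - 2) y + F (-1) (a - 2) y)).
  move=> /andP[y0 yx].
  have D1 := is_deriveZ a (dF 1 (a - 1) y (pos1 _ y0)).
  have D2 := is_deriveZ a (dF (-1) (a - 1) y (posN _ yx)).
  apply: (is_derive_eq (is_deriveB (dlin y) (is_deriveB D1 D2))).
  rewrite /GRing.scale/= (_ : a - 1 - 1 = a - 2); last by ring.
  by ring.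
have G1E (y : R) : G1 y = 2 * k * y - phi1 y.
  by rewrite -[LHS]/((0 + 2 * k * y) - (a * F 1 (a - 1) y - a * F (-1) (a - 1) y)) add0r.
have G1_ge0 (y : R) : 0 <= y <= x -> 0 <= 2 * k * y - phi1 y.
  move=> /andP[y0 yx].
  have : G1 0 <= G1 y.
    apply: (derive_ge0_le (f := G1) (g := fun z => 2 * k - a * (a - 1) *
      (F 1 (a - 2) z + F (-1) (a - 2) z)) y0) => [z /andP[z0 zy]|z /andP[z0 zy]].
      by apply: dG1; rewrite z0 (le_trans zy).
    have zx : z <= x by lra.
    have f2 : F (-1) (a - 2) z <= 1 by apply: small1; lra.
    have f1 : F 1 (a - 2) z <= b - 1.
      rewrite /F mul1r /powR gt_eqF; last by lra.
      rewrite -[leRHS]lnK; last by rewrite posrE; lra.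
      rewrite ler_expR.
      have lz : ln (1 + z) <= L by apply: le_trans (le_ln1Dx _) _; lra.
      apply: (@le_trans _ _ ((a - 1) * L)); last by rewrite /L mulrCA divff ?mulr1//; lra.
      apply: (@le_trans _ _ ((a - 2) * L)); first by rewrite ler_wpM2l//; lra.
      by rewrite ler_wpM2r//; lra.
    have aa : 0 <= a * (a - 1) by rewrite mulr_ge0; lra.
    have := ler_wpM2l aa (lerD f1 f2).
    by rewrite /k; lra.
  by rewrite !G1E /phi1 /F !mulr0 !addr0 powR1 !subrr.
pose sq (z : R) := z ^+ 2.
have dsq (y : R) : is_derive y 1 sq (2 * y).
  have -> : sq = (fun z => (z - 0) ^+ 2) by apply/funext => z; rewrite subr0.
  by apply: (is_derive_eq (is_derive_expn_shift _ _ _)); rewrite subr0 expr1.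
pose G := k *: sq - (F 1 a + F (-1) a).
have dG (y : R) : 0 <= y <= x -> is_derive y 1 G (2 * k * y - phi1 y).
  move=> yx; apply: (is_derive_eq (is_deriveB (is_deriveZ k (dsq y)) (dphi y yx))).
  by rewrite /GRing.scale/=; ring.
have : G 0 <= G x.
  apply: (derive_ge0_le (f := G) (g := fun z => 2 * k * z - phi1 z) x0) => y /andP[y0 yx].
  by apply: G1_ge0; rewrite !ltW.
rewrite -[X in X <= _]/(k * 0 ^+ 2 - (F 1 a + F (-1) a) 0).
rewrite -[X in _ <= X]/(k * x ^+ 2 - (F 1 a + F (-1) a) x).
by rewrite E0; lra.
Qed.

End power_expansion.

Section sharpness_below_half.
Context {R : realType}.
Implicit Types (p lam x t s a b u m : R).

(** For this threshold exactly the lowest of the four atoms is below it. *)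
Lemma bern_pair_above p th m x : 0 < p < 2^-1 -> th = Num.sqrt (p * (1 - p)) / (1 - p) ->
  1 <= m -> 0 <= x <= th ->
  bern_pair p (m + x) (m - x) (1 - 2 * p - th) =
    p * (p * (2 * (1 - p) * m - (1 - 2 * p - th)) ^+ 3 +
      2 * (1 - p) * (m * (1 - 2 * p) - (1 - 2 * p - th)) ^+ 3 +
      6 * (1 - p) * (m * (1 - 2 * p) - (1 - 2 * p - th)) * x ^+ 2).
Proof.
move=> /andP[p0 p2] thE m1 /andP[x0 xth].
have th1 : th <= 1.
  rewrite thE ler_pdivrMr ?mul1r; last by lra.
  have q0 : 0 <= 1 - p by lra.
  have -> : 1 - p = Num.sqrt ((1 - p) ^+ 2) by rewrite sqrtr_sqr ger0_norm.
  rewrite ler_wsqrtr// expr2 sqrtr_sqr ger0_norm//; apply: ler_wpM2r => //; lra.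
have pm : p * 1 <= p * m by rewrite ler_wpM2l// ltW.
have p2m : (1 - 2 * p) * 1 <= (1 - 2 * p) * m by rewrite ler_wpM2l//; lra.
rewrite /bern_pair (ppart0 (x := - p * (m + x + (m - x)))); last by lra.
rewrite !ppartE; [|lra..].
by ring.
Qed.

Lemma theta_identity p th : 0 < p < 2^-1 -> th = Num.sqrt (p * (1 - p)) / (1 - p) ->
  [/\ 0 < th, (1 - p) * th ^+ 2 = p & Num.sqrt (p * (1 - p)) = (1 - p) * th].
Proof.
move=> /andP[p0 p2] ->; have q0 : 0 < 1 - p by lra.
have pq : 0 < p * (1 - p) by rewrite mulr_gt0.
split; first by rewrite divr_gt0// sqrtr_gt0.
  rewrite expr_div_n sqr_sqrtr ?ltW//; field; lra.
by rewrite mulrCA mulfV ?gt_eqF// mulr1.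
Qed.

(** Another form of (2 lam - 1) (p + sqrt (p (1 - p))) < 1. *)
Lemma below_lambda_star p lam th : 0 < p < 2^-1 ->
  th = Num.sqrt (p * (1 - p)) / (1 - p) -> lam < lambda_star p ->
  p * (1 + th) * (2 * lam - 1) < th.
Proof.
move=> p02 thE; have [th0 thp r] := theta_identity p02 thE.
have /andP[p0 p2] := p02.
rewrite /lambda_star ltW//.
have -> : p - p ^+ 2 = p * (1 - p) by ring.
rewrite r.
have q0 : 0 < (1 - p) * th by rewrite mulr_gt0; lra.
have p20 : 0 < p ^+ 2 by rewrite exprn_gt0.
rewrite ltr_pdivlMr; last by lra.
set r0 := (1 - p) * th in q0 * => H.
have r2 : r0 ^+ 2 = p * (1 - p) by rewrite /r0 (_ : _ ^+ 2 = (1 - p) * ((1 - p) * th ^+ 2)); [rewrite thp; ring|ring].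
have D0 : 0 < r0 + 2 * p ^+ 2 by lra.
have pr : 0 < p + r0 by lra.
have H1 : (2 * lam - 1) * (r0 + 2 * p ^+ 2) < 1 + p - r0 by lra.
have H2 : (p + r0) * (1 + p - r0) = r0 + 2 * p ^+ 2.
  have -> : (p + r0) * (1 + p - r0) = p + r0 + p ^+ 2 - r0 ^+ 2 by ring.
  by rewrite r2; ring.
have H3 : (p + r0) * (2 * lam - 1) < 1.
  rewrite -(ltr_pM2r D0) mul1r -[ltRHS]H2 -mulrA ltr_pM2l//.
have -> : p * (1 + th) * (2 * lam - 1) = th * ((p + r0) * (2 * lam - 1)).
  rewrite mulrA; congr (_ * _).
  have -> : th * (p + r0) = p * th + (1 - p) * th ^+ 2 by rewrite /r0; ring.
  by rewrite thp; ring.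
by rewrite -[ltRHS]mulr1 ltr_pM2l.
Qed.

Let moment p t y :=
  p * (2 * (1 - p) * y - t) ^+ 3 + 2 * (1 - p) * (y * (1 - 2 * p) - t) ^+ 3.

Lemma moment_mono p th m v : 0 < p < 2^-1 -> 0 < th -> 1 <= m <= v ->
  moment p (1 - 2 * p - th) m <= moment p (1 - 2 * p - th) v.
Proof.
move=> /andP[p0 p2] th0 /andP[m1 mv].
have q0 : 0 < 1 - p by lra.
have q2 : 0 < 1 - 2 * p by lra.
have A1 : (1 - p) * m <= (1 - p) * v by rewrite ler_pM2l.
have A2 : (1 - p) * 1 <= (1 - p) * m by rewrite ler_pM2l.
have A3 : (1 - 2 * p) * m <= (1 - 2 * p) * v by rewrite ler_pM2l.
have A4 : (1 - 2 * p) * 1 <= (1 - 2 * p) * m by rewrite ler_pM2l.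
apply: lerD; rewrite ler_pM2l ?mulr_gt0//; apply: lerXn2r; rewrite ?nnegrE; lra.
Qed.

(** Up to the factor p and to second order in x, the spread of the scales adds 6 (1 - p) th x^2 to the average,
and the growth of the power mean, about (a - 1) x^2 / 2 with a = 2 lam, adds
6 (1 - p) K times that growth. So the claim is K (a - 1) / 2 < th, which is
below_lambda_star. *)
Lemma large_power_exceeds p lam : 0 < p < 2^-1 -> 1 <= lam -> lam < lambda_star p ->
  exists s1 s2 t, [/\ 0 < s1, 0 <= s2 &
    bern_pair p (power_mean lam s1 s2) (power_mean lam s1 s2) t < bern_pair p s1 s2 t].
Proof.
move=> p02 l1 ls; have /andP[p0 p2] := p02.
have [th thE] : exists th, th = Num.sqrt (p * (1 - p)) / (1 - p) by eexists.
have [th0 thp _] := theta_identity p02 thE.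
have key := below_lambda_star p02 thE ls.
pose a := 2 * lam; have a2 : 2 <= a by rewrite /a; lra.
pose K := 2 * p * (1 + th).
have K0 : 0 < K by rewrite !mulr_gt0//; lra.
pose gap := th - p * (1 + th) * (a - 1); have gap0 : 0 < gap by rewrite subr_gt0.
(* uses up half of the gap in the second order condition *)
pose b := 2 + 2 * gap / (K * (a - 1)).
have b2 : 2 < b by rewrite /b ltrDl divr_gt0// mulr_gt0; lra.
have [x0 /andP[x00 x01] hx0] := symmetric_power_bounds a2 b2.
pose e := (a - 1) * b / 4.
have e0 : 0 < e by rewrite divr_gt0// mulr_gt0; lra.
have eK : K * e = th - gap / 2.
  by rewrite /e /b /gap /K; field; rewrite !gt_eqF//; lra.
pose c3 := 8 * p * (1 - p) ^+ 3 + 2 * (1 - p) * (1 - 2 * p) ^+ 3.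
pose c2 := 12 * p * (1 - p) ^+ 2 * (1 + th) + 6 * (1 - p) * th * (1 - 2 * p) ^+ 2.
have q0 : 0 < 1 - p by lra.
have q2 : 0 < 1 - 2 * p by lra.
have c30' : 0 < c3 by rewrite addr_gt0// !mulr_gt0 ?exprn_gt0.
have c20 : 0 < c2 by rewrite addr_gt0// !mulr_gt0 ?exprn_gt0//; lra.
(* the last bound makes the terms of order x ^ 3 and more smaller than the other
   half of the gap *)
pose x := Num.min (Num.min x0 th) (Num.min (e + 1)^-1 (3 * (1 - p) * gap / ((c2 + c3) * e ^+ 2 + 1))).
have Ce : 0 < (c2 + c3) * e ^+ 2 + 1 by rewrite addr_gt0// mulr_gt0 ?exprn_gt0// addr_gt0.
have xgt0 : 0 < x.
  by rewrite !lt_min x00 th0 invr_gt0 divr_gt0// ?mulr_gt0// addr_gt0.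
have xx0 : x <= x0 by rewrite !ge_min lexx.
have xth : x <= th by rewrite !ge_min lexx orbT.
have xe : x * (e + 1) <= 1.
  by rewrite -ler_pdivlMr ?addr_gt0// mul1r !ge_min lexx !orbT.
have xg : x * ((c2 + c3) * e ^+ 2 + 1) <= 3 * (1 - p) * gap.
  by rewrite -ler_pdivlMr// !ge_min lexx !orbT.
have x1 : x < 1 by exact: le_lt_trans xx0 x01.
pose u := e * x ^+ 2.
have x2x : x ^+ 2 <= x by rewrite expr2 ler_piMr// ltW.
have u0 : 0 <= u by rewrite mulr_ge0 ?sqr_ge0// ltW.
have u1 : u <= 1.
  by apply: le_trans (ler_wpM2l (ltW e0) x2x) _; lra.
have /andP[A1 A2] : 2 <= (1 + x) `^ a + (1 - x) `^ a <= 2 + a * (a - 1) * b / 2 * x ^+ 2.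
  by apply: hx0; rewrite (ltW xgt0).
set A := ((1 + x) `^ a + (1 - x) `^ a) / 2.
have A1' : 1 <= A by rewrite /A; lra.
have A2' : A <= (1 + u) `^ a.
  have a1 : 1 <= a by lra.
  apply: le_trans (powR_tangent a1 u0); rewrite /A /u /e.
  by lra.
have a0 : 0 < a by lra.
have ai : 0 <= a^-1 by rewrite invr_ge0 ltW.
pose m := power_mean lam (1 + x) (1 - x).
have mE : m = A `^ a^-1 by [].
have m1 : 1 <= m.
  rewrite mE; apply: (@le_trans _ _ (1 `^ a^-1)); first by rewrite powR1.
  by apply: ge0_ler_powR; rewrite ?nnegrE ?ler01 ?(le_trans ler01 A1')//.
have mu : m <= 1 + u.
  rewrite mE; apply: (@le_trans _ _ (((1 + u) `^ a) `^ a^-1)).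
    by apply: ge0_ler_powR; rewrite ?nnegrE ?powR_ge0 ?(le_trans ler01 A1').
  by rewrite -powRrM divff ?gt_eqF// powRr1// addr_ge0.
exists (1 + x), (1 - x), (1 - 2 * p - th); split; [lra|lra|].
rewrite -/m -{1}[m]addr0 -{2}[m]subr0 (bern_pair_above p02 thE)//; last by rewrite lexx ltW.
rewrite (bern_pair_above p02 thE)//; last by rewrite (ltW xgt0).
rewrite ltr_pM2l// expr0n/= mulr0 addr0.
set t := 1 - 2 * p - th.
pose F y := moment p t y.
have FE : F (1 + u) = F 1 + 6 * (1 - p) * K * u + c2 * u ^+ 2 + c3 * u ^+ 3.
  have KE : K = p * (1 + th) ^+ 2 + (1 - 2 * p) * th ^+ 2.
    have -> : p * (1 + th) ^+ 2 + (1 - 2 * p) * th ^+ 2 =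
      p + 2 * p * th + (1 - p) * th ^+ 2 by ring.
    by rewrite thp /K; ring.
  by rewrite KE /F /moment /t /c2 /c3; ring.
have Fmono : F m <= F (1 + u).
  by apply: moment_mono => //; rewrite m1.
apply: (le_lt_trans Fmono); rewrite FE.
have -> : 1 * (1 - 2 * p) - t = th by rewrite /t; ring.
have F1 : F 1 = p * (2 * (1 - p) * 1 - t) ^+ 3 + 2 * (1 - p) * th ^+ 3.
  by rewrite /F /moment /t; ring.
rewrite -F1.
have u2 : u ^+ 2 <= e ^+ 2 * x ^+ 3.
  rewrite /u exprMn ler_wpM2l ?sqr_ge0// -exprM (exprS _ 3) ler_piMl ?exprn_ge0 ?(ltW xgt0) ?(ltW x1)//.
have u3 : u ^+ 3 <= u ^+ 2 by rewrite exprS ler_piMl ?sqr_ge0.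
have hx : 0 < x ^+ 2 * (6 * (1 - p) * (th - K * e) - (c2 + c3) * e ^+ 2 * x).
  rewrite mulr_gt0 ?exprn_gt0// eK subr_gt0.
  have -> : 6 * (1 - p) * (th - (th - gap / 2)) = 3 * (1 - p) * gap by field.
  by lra.
have h2 := ler_wpM2l (ltW c20) u2; have h3 := ler_wpM2l (ltW c30') (le_trans u3 u2).
have -> : 6 * (1 - p) * K * u = 6 * (1 - p) * (K * e) * x ^+ 2 by rewrite /u; ring.
by lra.
Qed.

End sharpness_below_half.

Lemma sharp_exceeds (R : realType) (p lam : R) : 0 < p < 1 -> 0 < lam < lambda_star p ->
  exists s1 s2 t, [/\ 0 < s1, 0 <= s2 &
    bern_pair p (power_mean lam s1 s2) (power_mean lam s1 s2) t < bern_pair p s1 s2 t].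
Proof.
move=> p01 /andP[l0 ls]; have [l1|l1] := ltP lam 1.
  have [|t Ht] := small_power_exceeds p01 (lam := lam); first by rewrite l0.
  by exists 1, 0, t; split.
have p2 : 0 < p < 2^-1.
  case/andP: p01 => -> p1 /=; rewrite ltNge; apply/negP => p2; move: ls.
  suff -> : lambda_star p = 1 by rewrite ltNge l1.
  rewrite /lambda_star; case: ifP => // p2'.
  have -> : p = 2^-1 by apply/eqP; rewrite eq_le p2 p2'.
  have -> : 2^-1 - 2^-1 ^+ 2 = (2^-1 : R) ^+ 2 by field.
  by rewrite sqrtr_sqr ger0_norm ?invr_ge0//; field.
exact: large_power_exceeds.
Qed.

(** * Two-valued variables *)

Section two_valued.
Context d (T : measurableType d) (R : realType) (P : probability T R).
Implicit Types (X U : {RV P >-> R}).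

Lemma ae_zero_of_integral (F : T -> \bar R) : measurable_fun [set: T] F ->
  (forall w, 0 <= F w)%E -> (\int[P]_w F w = 0)%E -> {ae P, forall w, F w = 0%E}.
Proof.
move=> mF F0 I0.
have I0' : (\int[P]_(w in [set: T]) `|F w| = 0)%E.
  by rewrite -[RHS]I0; apply: eq_integral => w _; rewrite gee0_abs.
by apply: filterS ((ae_eq_integral_abs P measurableT mF).1 I0') => w; apply.
Qed.

Lemma measurable_posM X (psi : R * R -> \bar R) (f : T -> R * R) :
  measurable_fun [set: T] f -> measurable_fun [set: R * R] psi ->
  measurable_fun [set: T] (fun w => (pos_part X w)%:E * psi (f w))%E.
Proof.
move=> mf mpsi; apply: emeasurable_funM; last exact: measurableT_comp mpsi mf.
by apply/measurable_EFinP; exact: measurable_pos_part.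
Qed.

(** The swap identity for the indicator of R different from - a gives R = - a almost
surely on X = b, and likewise R = b on X = - a. *)
Lemma two_valued_recip X U (a b : R) : pair_setting X U -> 0 < a -> 0 < b ->
  (forall w, X w = b \/ X w = - a) ->
  {ae P, forall w, Yprod X U w = (a * b)%:E /\ (asym_ratio X U w <= (b / a)%:E)%E}.
Proof.
move=> ps a0 b0 Xab.
have mR := measurable_partner ps.
have mXR : measurable_fun [set: T] (fun w => (X w, partner X U w)) by exact: measurable_fun_pair.
have mRX : measurable_fun [set: T] (fun w => (partner X U w, X w)) by exact: measurable_fun_pair.
pose off (c : R) (x : R) : R := (x != c)%:R.
have moff c : measurable_fun [set: R] (off c).
  rewrite (_ : off c = fun x => if x == c then 0 else 1 : R).
    by apply: measurable_fun_ifT => //; exact: measurable_fun_eqr.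
  by apply/funext => x; rewrite /off; case: eqP.
have off0 c x : (0 <= (off c x)%:E)%E by rewrite lee_fin ler0n.
have mpsi1 : measurable_fun [set: R * R] (fun z => (off (- a) z.2)%:E).
  by apply/measurable_EFinP; exact: (measurableT_comp (moff _) (@measurable_snd _ _ R R)).
have mpsi2 : measurable_fun [set: R * R] (fun z => (off b z.1)%:E).
  by apply/measurable_EFinP; exact: (measurableT_comp (moff _) (@measurable_fst _ _ R R)).
have pos0 (Y : {RV P >-> R}) w : (0 <= (pos_part Y w)%:E)%E by rewrite lee_fin pos_part_ge0.
have H1 : {ae P, forall w, ((pos_part X w)%:E * (off (- a) (partner X U w))%:E = 0)%E}.
  apply: ae_zero_of_integral; first exact: (measurable_posM X mXR mpsi1).
    by move=> w; rewrite mule_ge0.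
  rewrite (swap_identity ps mpsi1 (fun z => off0 _ _)) integral0_eq// => w _ /=.
  rewrite /pos_part /off /=; case: (Xab w) => ->; last by rewrite eqxx mule0.
  by rewrite max_r ?oppr_le0 ?(ltW b0)// mul0e.
have H2 : {ae P, forall w, ((pos_part (negRV X) w)%:E * (off b (partner X U w))%:E = 0)%E}.
  apply: ae_zero_of_integral; first exact: (measurable_posM (negRV X) mRX mpsi2).
    by move=> w; rewrite mule_ge0.
  rewrite -(swap_identity ps mpsi2 (fun z => off0 _ _)) integral0_eq// => w _ /=.
  rewrite /pos_part /off; case: (Xab w) => ->; first by rewrite eqxx mule0.
  by rewrite max_r ?oppr_le0 ?(ltW a0)// mul0e.
apply: filterS (filterI (filterI H1 H2) (filterI (ae_partner_pos ps) (ae_partner_neg ps))).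
move=> w [[E1 E2] [E3 E4]].
have off_eq (c x y : R) : 0 < c -> (c%:E * (off y x)%:E = 0)%E -> x = y.
  move=> c0; rewrite -EFinM => -[] /eqP; rewrite mulf_eq0 (gt_eqF c0)/= /off.
  by case: (eqVneq x y) => // _; rewrite oner_eq0.
have [X0|X0] := ltP 0 (X w).
  have Xb : X w = b by case: (Xab w) => // Xa; move: X0; rewrite Xa oppr_gt0 ltNge (ltW a0).
  have [rE r0 _] := E3 X0.
  have pE : partner X U w = - a.
    by apply: (off_eq (pos_part X w)) => //; rewrite /pos_part max_l// ltW.
  rewrite /Yprod /asym_ratio rE pE Xb b0 mule1; split.
    by rewrite -EFinM abse_EFin mulrN normrN ger0_norm ?mulr_ge0 ?(ltW a0) ?(ltW b0)// mulrC.
  by rewrite abse_EFin normrN gtr0_norm// inver (gt_eqF a0).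
have Xa : X w = - a by case: (Xab w) => // Xb; move: X0; rewrite Xb leNgt b0.
have X0' : X w < 0 by rewrite Xa oppr_lt0.
have [rE r0 _] := E4 X0'.
have pE : partner X U w = b.
  by apply: (off_eq (pos_part (negRV X) w)) => //; rewrite /pos_part/= max_l ?oppr_gt0 ?oppr_ge0.
rewrite /Yprod /asym_ratio rE pE Xa; split.
  by rewrite -EFinM abse_EFin mulNr normrN ger0_norm ?mulr_ge0 ?(ltW a0) ?(ltW b0).
by rewrite oppr_gt0 ltNge (ltW a0)/= mule0 lee_fin divr_ge0// ltW.
Qed.

End two_valued.

(** * A product model of independent families *)

Section product_model.
Context (R : realType) d1 (S1 : measurableType d1) d2 (S2 : measurableType d2).
Context (q1 : probability S1 R) (q2 : probability S2 R).
Local Notation Omega := ((S1 * S1) * (S2 * S2))%type.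

(** Two independent copies of q1 together with two independent copies of q2. *)
Definition model : probability Omega R := ((q1 \x q1) \x (q2 \x q2))%E.

Definition coordinate {S : Type} (i : 'I_2) (z : S * S) : S := if i == ord0 then z.1 else z.2.

Lemma measurable_coordinate d (S : measurableType d) i :
  measurable_fun [set: S * S] (coordinate i).
Proof.
rewrite (_ : coordinate i = if i == ord0 then fst else snd); first by case: (i == ord0).
by apply/funext => z; rewrite /coordinate; case: (i == ord0).
Qed.

Lemma pair_measure_cap d (S : measurableType d) (q : probability S R) (A : 'I_2 -> set S) :
  (forall i, measurable (A i)) ->
  (q \x q)%E (\bigcap_i (coordinate i @^-1` A i)) = (\prod_(i < 2) q (A i))%E.
Proof.
move=> mA; rewrite (_ : \bigcap_i _ = A ord0 `*` A ord_max).
  by rewrite big_ord_recl big_ord1 product_measure1E//; congr (_ * q (A _))%E; exact: val_inj.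
apply/seteqP; split => z /=; first by move=> H; split; exact: (H _ Logic.I).
move=> [H0 H1] i _ /=; rewrite /coordinate; case: eqP => [->//|i0].
rewrite (_ : i = ord_max)//; case: i i0 => [[|[|m]] im] i0 //; last exact: val_inj.
by case: i0; exact: val_inj.
Qed.

Lemma measurable_coord_preimage d (S : measurableType d) i (A : set S) :
  measurable A -> measurable (coordinate i @^-1` A).
Proof.
by move=> mA; rewrite -[X in measurable X]setTI; exact: measurable_coordinate.
Qed.

Lemma pair_measure_coord d (S : measurableType d) (q : probability S R) i (A : set S) :
  measurable A -> (q \x q)%E (coordinate i @^-1` A) = q A.
Proof.
move=> mA; pose C j := if j == i then A else setT.
have mC j : measurable (C j) by rewrite /C; case: ifP.
rewrite (_ : coordinate i @^-1` _ = \bigcap_j (coordinate j @^-1` C j)); last first.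
  apply/seteqP; split => z /=; last by move=> /(_ i Logic.I); rewrite /C/= eqxx.
  by move=> H j _; rewrite /C/=; case: eqP => // ->.
rewrite pair_measure_cap// (bigD1 i)//= big1 ?mule1; first by rewrite /C eqxx.
by move=> j /negbTE ji; rewrite /C ji probability_setT.
Qed.

Lemma measurable_coord_cap d (S : measurableType d) (A : 'I_2 -> set S) :
  (forall i, measurable (A i)) -> measurable (\bigcap_i (coordinate i @^-1` A i)).
Proof.
move=> mA; apply: fin_bigcap_measurable; first exact: finite_finset.
by move=> i _; exact: measurable_coord_preimage.
Qed.

Lemma model_fst (A : set (S1 * S1)) : measurable A ->
  model (fst @^-1` A) = (q1 \x q1)%E A.
Proof.
move=> mA; rewrite (_ : fst @^-1` A = A `*` setT); last first.
  by apply/seteqP; split => [w Aw|w []] //; split.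
transitivity ((q1 \x q1)%E A * (q2 \x q2)%E setT)%E; first exact: product_measure1E.
by rewrite probability_setT mule1.
Qed.

Lemma model_snd (B : set (S2 * S2)) : measurable B ->
  model (snd @^-1` B) = (q2 \x q2)%E B.
Proof.
move=> mB; rewrite (_ : snd @^-1` B = setT `*` B); last first.
  by apply/seteqP; split => [w Aw|w []] //; split.
transitivity ((q1 \x q1)%E setT * (q2 \x q2)%E B)%E; first exact: product_measure1E.
by rewrite probability_setT mul1e.
Qed.

Lemma model_independent (A : set (S1 * S1)) (B : set (S2 * S2)) :
  measurable A -> measurable B ->
  model (fst @^-1` A `&` snd @^-1` B) = (model (fst @^-1` A) * model (snd @^-1` B))%E.
Proof.
move=> mA mB; rewrite model_fst// model_snd//.
rewrite (_ : _ `&` _ = A `*` B); first exact: product_measure1E.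
by apply/seteqP; split => w.
Qed.

Variables (phi : 'I_2 -> S1 -> R) (psi : 'I_2 -> S2 -> R).
Hypothesis mphi : forall i, measurable_fun [set: S1] (phi i).
Hypothesis mpsi : forall i, measurable_fun [set: S2] (psi i).

Lemma measurable_first i : measurable_fun [set: Omega] (fun w => phi i (coordinate i w.1)).
Proof.
apply: (measurableT_comp (mphi i)).
apply: (measurableT_comp (@measurable_coordinate _ S1 i)); exact: measurable_fst.
Qed.

Lemma measurable_second i : measurable_fun [set: Omega] (fun w => psi i (coordinate i w.2)).
Proof.
apply: (measurableT_comp (mpsi i)).
apply: (measurableT_comp (@measurable_coordinate _ S2 i)); exact: measurable_snd.
Qed.

Definition first_family i : {RV model >-> R} :=
  HB.pack (fun w : Omega => phi i (coordinate i w.1))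
    (isMeasurableFun.Build _ _ _ _ _ (measurable_first i)).

Definition second_family i : {RV model >-> R} :=
  HB.pack (fun w : Omega => psi i (coordinate i w.2))
    (isMeasurableFun.Build _ _ _ _ _ (measurable_second i)).

Lemma mutual_of_coords n d (T : measurableType d) (P : probability T R)
    (V : 'I_n -> {RV P >-> R}) : independent_coords P V -> mutually_independent V.
Proof.
move=> iV J A mA.
pose B i := if i \in J then A i else setT.
have mB i : measurable (B i) by rewrite /B; case: ifP.
have -> : \bigcap_(i in [set` J]) (V i @^-1` A i) = \bigcap_i (V i @^-1` B i).
  apply/seteqP; split => w H i; rewrite /B/=; first by move=> _; case: ifP => // iJ; exact: H.
  by move=> iJ; have := H i Logic.I; rewrite /B/= iJ.
rewrite iV// [RHS]big_mkcond/=; apply: eq_bigr => i _; rewrite /B; case: ifP => // _.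
by rewrite preimage_setT probability_setT.
Qed.

Lemma preimage_measurable d (S : measurableType d) (f : S -> R) (A : set R) :
  measurable_fun [set: S] f -> measurable A -> measurable (f @^-1` A).
Proof. by move=> mf mA; rewrite -[X in measurable X]setTI; exact: mf. Qed.

Lemma first_law i (A : set R) : measurable A ->
  model (first_family i @^-1` A) = q1 (phi i @^-1` A).
Proof.
move=> mA; have mB := preimage_measurable (mphi i) mA.
rewrite -(pair_measure_coord q1 i mB) -model_fst//.
exact: measurable_coord_preimage.
Qed.

Lemma second_law i (A : set R) : measurable A ->
  model (second_family i @^-1` A) = q2 (psi i @^-1` A).
Proof.
move=> mA; have mB := preimage_measurable (mpsi i) mA.
rewrite -(pair_measure_coord q2 i mB) -model_snd//.
exact: measurable_coord_preimage.
Qed.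

Lemma first_independent : mutually_independent first_family.
Proof.
apply: mutual_of_coords => A mA.
under [RHS]eq_bigr do rewrite first_law//.
have mB i : measurable (phi i @^-1` A i) by exact: preimage_measurable.
rewrite -pair_measure_cap// -model_fst//; exact: measurable_coord_cap.
Qed.

Lemma second_independent : mutually_independent second_family.
Proof.
apply: mutual_of_coords => A mA.
under [RHS]eq_bigr do rewrite second_law//.
have mB i : measurable (psi i @^-1` A i) by exact: preimage_measurable.
rewrite -pair_measure_cap// -model_snd//; exact: measurable_coord_cap.
Qed.

(** An event of the first family is the inverse image of an event under the first
projection. *)
Lemma first_second_independent : independent_families first_family second_family.
Proof.
have sub d (S : measurableType d) (f : Omega -> S) (V : 'I_2 -> {RV model >-> R}) E :
    (forall i A, measurable A -> exists2 B, measurable B & V i @^-1` A = f @^-1` B) ->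
    sigma_of V E -> exists2 B, measurable B & E = f @^-1` B.
  move=> H VE; have : preimage_set_system [set: Omega] f measurable E.
    move: VE; apply: smallest_sub.
      exact: sigma_algebra_preimage (sigma_algebra_measurable _).
    move=> _ [i _ [A mA <-]]; have [B mB HB] := H i A mA.
    by exists B => //; rewrite !setTI.
  by move=> [B mB <-]; exists B => //; rewrite setTI.
move=> E F EE FF.
have [A mA ->] : exists2 A : set (S1 * S1), measurable A & E = fst @^-1` A.
  apply: sub EE => i A mA; exists (coordinate i @^-1` (phi i @^-1` A)) => //.
  by apply: measurable_coord_preimage; exact: preimage_measurable.
have [B mB ->] : exists2 B : set (S2 * S2), measurable B & F = snd @^-1` B.
  apply: sub FF => i B mB; exists (coordinate i @^-1` (psi i @^-1` B)) => //.
  by apply: measurable_coord_preimage; exact: preimage_measurable.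
exact: model_independent.
Qed.

End product_model.

(** * Scaled Bernoulli variables as admissible variables *)

Section extremal_model.
Context (R : realType) (p : R) (s : 'I_2 -> R).
Hypothesis p01 : 0 < p < 1.
Hypothesis s0 : forall i, 0 <= s i.

Local Notation r := (Num.sqrt (p * (1 - p))).

Let mz (c : 'I_2 -> R) i : measurable_fun [set: bool] (fun b => c i * zval p b).
Proof. by []. Qed.

Let mid (i : 'I_2) : measurable_fun [set: R] (@id R).
Proof. exact: measurable_id. Qed.

Definition bernoulli_model := model (bernoulli_prob p) (uniform_prob (@ltr01 R)).

Definition scaled_bits (c : 'I_2 -> R) : 'I_2 -> {RV bernoulli_model >-> R} :=
  first_family (bernoulli_prob p) (uniform_prob (@ltr01 R)) (mz c).

Definition uniform_bits : 'I_2 -> {RV bernoulli_model >-> R} :=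
  second_family (bernoulli_prob p) (uniform_prob (@ltr01 R)) mid.

Local Notation X := (scaled_bits s).
Local Notation Z := (scaled_bits (fun=> 1)).
Local Notation U := uniform_bits.

Lemma bits_sample : std_bernoulli_sample p Z.
Proof.
split; first exact: first_independent.
move=> i A mA; rewrite /distribution /pushforward.
transitivity (bernoulli_prob p ((fun b => 1 * zval p b) @^-1` A)).
  exact: (@first_law _ _ _ _ _ (bernoulli_prob p) (uniform_prob (@ltr01 R)) _ (mz (fun=> 1)) i A mA).
rewrite /std_bernoulli_law; congr (bernoulli_prob p _).
by apply/seteqP; split => b /=; rewrite mul1r.
Qed.

Lemma scaled_bitsE i w : X i w = s i * Z i w.
Proof. by rewrite /= mul1r. Qed.

Lemma scaled_bits_values i w :
  X i w = s i * (1 - p) / r \/ X i w = - (s i * p / r).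
Proof.
rewrite /=; case: (coordinate i w.1).
  by left; rewrite zvalT mulrA.
by right; rewrite zvalF mulNr mulrN mulrA.
Qed.

Lemma uniform_bits_law i : has_law (U i) (uniform_prob (@ltr01 R)).
Proof.
move=> A mA.
exact: (@second_law _ _ _ _ _ (bernoulli_prob p) (uniform_prob (@ltr01 R)) _ mid i A mA).
Qed.

Lemma bits_independent : independent_families X U.
Proof. exact: first_second_independent. Qed.

(** The positive and the negative part have the same integral, as the values of Z are
in the ratio (1 - p) : - p and have the probabilities p and 1 - p. *)
Lemma scaled_bits_mean i : zero_mean (X i).
Proof.
have /andP[p0 p1] := p01.
have r0 : 0 < r by rewrite sqrtr_gt0 mulr_gt0// subr_gt0.
have iX : bernoulli_model.-integrable [set: _] (EFin \o X i).
  apply: (@le_integrable _ _ _ _ _ measurableT _ (EFin \o cst (s i / r))).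
  - by apply/measurable_EFinP.
  - move=> w _; rewrite -[(EFin \o X i) w]/((X i w)%:E) /= lee_fin.
    have sr0 : 0 <= s i / r by rewrite divr_ge0 ?s0// ltW.
    rewrite [leRHS]ger0_norm//.
    have -> : s i * zval p (coordinate i w.1) = X i w by [].
    case: (scaled_bits_values i w) => ->.
      by rewrite mulrAC ger0_norm ?mulr_ge0 ?subr_ge0 ?(ltW p1)// ler_piMr//; lra.
    by rewrite normrN mulrAC ger0_norm ?mulr_ge0 ?(ltW p0)// ler_piMr// ltW.
  - exact: finite_measure_integrable_cst.
split => //; rewrite unlock.
have pos (F : R -> R) : measurable_fun [set: R] F -> (forall x, 0 <= F x) ->
  (\int[bernoulli_model]_w (F (Z i w))%:E = (p * F (zval p true) + (1 - p) * F (zval p false))%:E)%E.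
  exact: (integral_std_bernoulli p01 bits_sample i).
rewrite (_ : \int[_]_w (X i w)%:E = \int[bernoulli_model]_w (EFin \o X i) w)%E// integralE.
have -> : (\int[bernoulli_model]_w (EFin \o X i)^\+ w =
    \int[bernoulli_model]_w (Num.max (s i * Z i w) 0)%:E)%E.
  by apply: eq_integral => w _; rewrite funeposE/= -EFin_max mul1r.
have -> : (\int[bernoulli_model]_w (EFin \o X i)^\- w =
    \int[bernoulli_model]_w (Num.max (- (s i * Z i w)) 0)%:E)%E.
  by apply: eq_integral => w _; rewrite funenegE/= -EFin_max mul1r.
rewrite (pos (fun z => Num.max (s i * z) 0))//; last 2 first.
- by apply: measurable_maxr => //; exact: measurable_funM.
- by move=> x; rewrite le_max lexx orbT.
rewrite (pos (fun z => Num.max (- (s i * z)) 0))//; last 2 first.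
- by apply: measurable_maxr => //; apply: measurable_funN; exact: measurable_funM.
- by move=> x; rewrite le_max lexx orbT.
rewrite zvalT zvalF -EFinB.
have sT : 0 <= s i * ((1 - p) / r) by rewrite mulr_ge0// divr_ge0// ?subr_ge0 ltW.
have sF : s i * (- p / r) <= 0.
  by rewrite mulr_ge0_le0// mulNr oppr_le0 divr_ge0// ltW.
rewrite (max_l sT) (max_r sF) max_r ?oppr_le0// max_l ?oppr_ge0//.
by congr EFin; ring.
Qed.

Lemma bits_pair_setting i : pair_setting (X i) (U i).
Proof.
split; [exact: scaled_bits_mean|exact: uniform_bits_law|].
exact: pair_independent bits_independent.
Qed.

(** The two values of X_i have absolute product s_i^2 and ratio (1 - p) / p, which is
the largest one allowed. *)
Lemma bits_recip i : {ae bernoulli_model, forall w,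
  Yprod (X i) (U i) w = (s i ^+ 2)%:E /\
  (asym_ratio (X i) (U i) w <= ((1 - p) / p)%:E)%E}.
Proof.
have /andP[p0 p1] := p01.
have r0 : 0 < r by rewrite sqrtr_gt0 mulr_gt0// subr_gt0.
have r2 : r ^+ 2 = p * (1 - p) by rewrite sqr_sqrtr//; apply: mulr_ge0; lra.
have := s0 i; rewrite le_eqVlt => /predU1P[s00|sgt0].
  apply: aeW => w; have X0 : X i w = 0 by rewrite /= -s00 mul0r.
  rewrite /Yprod /asym_ratio X0 -s00 ltxx mule0 mul0e abse0 expr0n; split => //.
  by rewrite lee_fin; apply: divr_ge0; lra.
have a0 : 0 < s i * p / r by rewrite divr_gt0// mulr_gt0.
have b0 : 0 < s i * (1 - p) / r by rewrite divr_gt0// mulr_gt0// subr_gt0.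
apply: filterS (two_valued_recip (bits_pair_setting i) a0 b0 (scaled_bits_values i)).
move=> w [-> H]; split.
  congr EFin; transitivity (s i ^+ 2 * (p * (1 - p) / r ^+ 2)).
    by field; rewrite gt_eqF.
  by rewrite r2 divff ?mulr1// mulf_neq0// gt_eqF// subr_gt0.
rewrite (_ : (1 - p) / p = (s i * (1 - p) / r) / (s i * p / r))//.
by field; rewrite !gt_eqF.
Qed.

Lemma bits_admissible : admissible p X U.
Proof.
split.
- by split; [exact: first_independent|exact: scaled_bits_mean].
- by split; [exact: second_independent|exact: uniform_bits_law].
- exact: bits_independent.
- by move=> i; apply: filterS (bits_recip i) => w [].
Qed.

End extremal_model.

(** * Sharpness *)

Section optimality.
Context (R : realType).
Implicit Types (p lam t x : R).

Lemma ae_bits_self_norm p lam (s : 'I_2 -> R) : 0 < p < 1 -> (forall i, 0 <= s i) ->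
  {ae bernoulli_model p, forall w,
    self_norm_sum (scaled_bits p s) (uniform_bits p) lam w =
    (\sum_(i < 2) s i * scaled_bits p (fun=> 1) i w) *
    (\sum_(i < 2) s i `^ (2 * lam)) `^ (- (2 * lam)^-1)}.
Proof.
move=> p01 s0.
have ps i := bits_pair_setting p01 s0 i.
have Yi i : {ae bernoulli_model p, forall w,
    partner_product (scaled_bits p s i) (uniform_bits p i) w = s i ^+ 2}.
  apply: filterS2 (bits_recip p01 s0 i) (ae_Yprod (ps i)) => w [-> _] [->].
  by [].
have i1 (i : 'I_2) : i = ord0 \/ i = ord_max.
  by case: i => [[|[|m]] im] //; [left|right]; exact: val_inj.
apply: filterS3 (ae_self_norm_sum lam ps) (Yi ord0) (Yi ord_max) => w -> Y0 Y1.
congr (_ * _ `^ _); first by apply: eq_bigr => i _; rewrite scaled_bitsE.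
apply: eq_bigr => i _.
have -> : partner_product (scaled_bits p s i) (uniform_bits p i) w = s i ^+ 2 by case: (i1 i) => ->.
by rewrite -powR_mulrn// -powRrM.
Qed.

(** The weights are the constants s_i^2, so that the self-normalized sum is a constant
multiple of s_1 Z_1 + s_2 Z_2; the constant is absorbed by rescaling t. *)
Lemma domination_of_bits p lam (s1 s2 : R) t : 0 < p < 1 -> 0 < lam -> 0 < s1 -> 0 <= s2 ->
  (forall s : 'I_2 -> R, (forall i, 0 <= s i) ->
    dominated (bernoulli_model p) (bernoulli_model p)
      (self_norm_sum (scaled_bits p s) (uniform_bits p) lam)
      (normalized_sum (scaled_bits p (fun=> 1)) lam)) ->
  bern_pair p s1 s2 t <= bern_pair p (power_mean lam s1 s2) (power_mean lam s1 s2) t.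
Proof.
move=> p01 lam0 s10 s20 dom; have /andP[p0 p1] := p01.
pose s (i : 'I_2) := if i == ord0 then s1 else s2.
have s0 i : 0 <= s i by rewrite /s; case: ifP => // _; exact: ltW.
have [+ _] := dom s s0.
set r := Num.sqrt (p * (1 - p)).
have r0 : 0 < r by rewrite sqrtr_gt0 mulr_gt0// subr_gt0.
pose k := (2 * lam)^-1.
pose B := s1 `^ (2 * lam) + s2 `^ (2 * lam).
have B0 : 0 < B by rewrite ltr_pwDl ?powR_gt0 ?powR_ge0.
pose c := B `^ (- k); have c0 : 0 < c by exact: powR_gt0.
have BE : \sum_(i < 2) s i `^ (2 * lam) = B by rewrite big_ord_recl big_ord1.
pose f x := ppart (t / r * c) x ^+ 3.
move=> /(_ f (Hplus_ppart _)); rewrite !unlock.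
have [/smooth3_continuous cf f0] := Hplus_smooth3 (Hplus_ppart (t / r * c)).
have mf : measurable_fun [set: R] f by exact: continuous_measurable_fun.
rewrite (expectation_sample p01 (bits_sample p) lam mf f0).
have ps i := bits_pair_setting p01 s0 i.
have fc x : f (x * c) = ppart (t / r) x ^+ 3 * c ^+ 3.
  have := @ppart_scale R c^-1 (t / r) x; rewrite invr_gt0 !invrK => /(_ c0) E.
  by rewrite /f E exprMn.
have -> : (\int[bernoulli_model p]_w
    ((f \o self_norm_sum (scaled_bits p s) (uniform_bits p) lam) w)%:E =
    \int[bernoulli_model p]_w
      (f ((0 + \sum_(i <- enum 'I_2) s i * scaled_bits p (fun=> 1) i w) * c))%:E)%E.
  apply: ge0_ae_eq_integral => //.
  - apply/measurable_EFinP; exact: (measurableT_comp mf (measurable_self_norm_sum lam ps)).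
  - apply/measurable_EFinP; apply: (measurableT_comp mf (g := fun w => (0 + \sum_(i <- enum 'I_2) s i * scaled_bits p (fun=> 1) i w) * c)).
    apply: measurable_funM => //; apply: measurable_funD => //.
    by apply: measurable_sum => i; exact: measurable_funM.
  - by move=> w _; rewrite lee_fin; exact: f0.
  - by move=> w _; rewrite lee_fin; exact: f0.
  apply: filterS (ae_bits_self_norm lam p01 s0) => w E _.
  by rewrite /= E BE add0r big_enum.
have mfc : measurable_fun [set: R] (fun x => f (x * c)).
  by apply: (measurableT_comp mf (g := fun x => x * c)); exact: measurable_funM.
rewrite (integral_weighted_sample p01 (bits_sample p) s
  (F := fun x => f (x * c)) 0 (enum_uniq _) mfc (fun x => f0 _)) lee_fin.
have -> : nseq 2 (2^-1 `^ k) = [seq x * c | x <- nseq 2 (power_mean lam s1 s2)].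
  rewrite map_nseq /power_mean -/B -/k (powRM _ (ltW B0))// mulrAC -powRD ?subrr ?powRr0 ?mul1r//.
  by apply/implyP => _; rewrite gt_eqF.
rewrite -[X in bern_mean _ _ f X](mul0r c) -(bern_mean_scale p _ f).
have scale l : bern_mean p l (fun x => f (x * c)) 0 =
    bern_mean p l (fun x => ppart (t / r) x ^+ 3) 0 * c ^+ 3.
  elim: l 0 => [|x l IH] y /=; first exact: fc.
  by rewrite /bern_step !IH; ring.
rewrite !scale ler_pM2r ?exprn_gt0//.
have -> : [seq s j | j <- enum 'I_2] = [:: s1; s2].
  by rewrite enum_ordSl enum_ordSl enum_ord0.
rewrite !(bern_mean_pair _ _ _ p01) ler_pM2r// invr_gt0 exprn_gt0//.
Qed.

End optimality.

Theorem corollary2p6 (R : realType) (p : R) (hp : 0 < p < 1) :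
  (forall (n : nat) (d : measure_display) (T : measurableType d)
      (P : probability T R) (X U : 'I_n -> {RV P >-> R})
      (d' : measure_display) (T' : measurableType d')
      (P' : probability T' R) (Z : 'I_n -> {RV P' >-> R}) (lambda : R),
    (0 < n)%N -> admissible p X U -> std_bernoulli_sample p Z ->
    lambda_star p <= lambda ->
    dominated P P' (self_norm_sum X U lambda) (normalized_sum Z lambda)) /\
  ~ (exists lambda0 : R, 0 < lambda0 < lambda_star p /\
      forall (n : nat) (d : measure_display) (T : measurableType d)
        (P : probability T R) (X U : 'I_n -> {RV P >-> R})
        (d' : measure_display) (T' : measurableType d')
        (P' : probability T' R) (Z : 'I_n -> {RV P' >-> R}) (lambda : R),
      (0 < n)%N -> admissible p X U -> std_bernoulli_sample p Z ->
      lambda0 <= lambda ->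
      dominated P P' (self_norm_sum X U lambda) (normalized_sum Z lambda)).
Proof.
split=> [n d T P X U d' T' P' Z lam|[lam [hlam dom]]].
  exact: self_norm_dominated.
have [s1 [s2 [t [s10 s20]]]] := sharp_exceeds hp hlam.
have /andP[l0 _] := hlam.
rewrite ltNge => /negP; apply; apply: (domination_of_bits t hp l0 s10 s20) => s s0.
by apply: dom => //; [exact: bits_admissible|exact: bits_sample].
Qed.
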